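(* Let $f$ be a semiregular function on $B(0,R_0)$. For all $R<R_0$ and all $I \in \mathbb{S}$ there exist a polynomial $P(q)$ having coefficients in $L_I$ and a regular function $g : B(0,R) \to \mathbb{H}$ such that $f = P^{-*}*g$ on $B(0,R)$.
   Context: $\mathbb{H}$ is the skew field of real quaternions, $\mathbb{S} = \{q \in \mathbb{H} : q^2=-1\}$, $L_I = \mathbb{R} + I\mathbb{R}$ for $I\in\mathbb{S}$, $B(0,R)=\{q\in\mathbb{H}:|q|<R\}$; here $0<R_0\le\infty$ and $0<R<R_0$. For a domain $\Omega\subseteq\mathbb{H}$ set $\Omega_I=\Omega\cap L_I$ and, for $f:\Omega\to\mathbb{H}$, $f_I=f|_{\Omega_I}$. A real differentiable $f:\Omega\to\mathbb{H}$ is regular if for every $I\in\mathbb{S}$ the function $\frac12\left(\frac{\partial}{\partial x}+I\frac{\partial}{\partial y}\right)f_I(x+Iy)$ vanishes identically on $\Omega_I$. Regular functions on $B(0,R)$ are exactly the sums of power series $\sum_{n\ge0}q^na_n$, $a_n\in\mathbb{H}$, converging in $B(0,R)$; polynomials are of the form $\sum_n q^n a_n$ (finite sum). Poles: if a regular $f$ is defined on an annulus $\{z\in L_I: R_1<|z-p|<R_2\}$ in a complex line $L_I$ through $p$ (for an isolated singularity in $L_I$, $R_1=0$), write $f_I(z)=\sum_{n\in\mathbb{Z}}(z-p)^na_n$ there, $a_n\in\mathbb{H}$ (for real $p$ the $a_n$ do not depend on $I$). The point $p$ is a pole if there is $n\in\mathbb{N}$ (possibly $0$) with $a_{-m}=0$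 for all $m>n$; otherwise $p$ is an essential singularity. Semiregular: let $\mathcal{S}\subseteq\Omega$ be such that $\mathcal{S}\cap L_I$ is a discrete subset of $\Omega_I$ for all $I\in\mathbb{S}$; a regular function $f:\Omega\setminus\mathcal{S}\to\mathbb{H}$ is semiregular on $\Omega$ if $\mathcal{S}$ contains no essential singularities for $f$ (equivalently, every $f_I$ is meromorphic on $\Omega_I$). Regular operations: for $f=\sum q^na_n$, $g=\sum q^nb_n$ regular on $B(0,R)$, $f*g(q)=\sum_n q^n\sum_{k=0}^na_kb_{n-k}$, $f^c(q)=\sum_n q^n\bar a_n$, $f^s=f*f^c=f^c*f$. With $\mathcal{Z}_{f^s}$ the zero set of $f^s$ in $B(0,R)$ and $f\not\equiv0$, the left regular quotient is $f^{-*}*g:B(0,R)\setminus\mathcal{Z}_{f^s}\to\mathbb{H}$, $f^{-*}*g(q)=\frac{1}{f^s(q)}\,f^c*g(q)$. Equality of semiregular functions means equality at the points where both sides are defined. *)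

(* Defs.v *)
From Stdlib Require Import Reals ZArith ClassicalEpsilon.
From Coquelicot Require Import Coquelicot.
Open Scope R_scope.

(* (a, b, c, d) stands for a + b i + c j + d k.  The additive group, the
   topology and the real normed space structure (used by [locally],
   [filterdiff], [is_derive], [is_series]) are those of the product. *)
Definition H : Type := (R * R * R * R)%type.

Definition H_NormedModule : NormedModule R_AbsRing :=
  prod_NormedModule R_AbsRing
    (prod_NormedModule R_AbsRing
      (prod_NormedModule R_AbsRing R_NormedModule R_NormedModule)
      R_NormedModule)
    R_NormedModule.

Definition Hmul (p q : H) : H :=
  let '(a1, b1, c1, d1) := p in
  let '(a2, b2, c2, d2) := q in
  (a1 * a2 - b1 * b2 - c1 * c2 - d1 * d2,
   a1 * b2 + b1 * a2 + c1 * d2 - d1 * c2,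
   a1 * c2 - b1 * d2 + c1 * a2 + d1 * b2,
   a1 * d2 + b1 * c2 - c1 * b2 + d1 * a2).

Definition RtoH (x : R) : H := (x, 0, 0, 0).

Ltac H_ring :=
  repeat match goal with
  | x : H |- _ => destruct x as [[[? ?] ?] ?]
  end;
  cbv -[Rplus Rmult Rminus Ropp IZR]; repeat apply (f_equal2 pair); ring.

Lemma Hmul_assoc (x y z : H) : Hmul x (Hmul y z) = Hmul (Hmul x y) z.
Proof. H_ring. Qed.

Lemma Hmul_1_r (x : H) : Hmul x (RtoH 1) = x.
Proof. H_ring. Qed.

Lemma Hmul_1_l (x : H) : Hmul (RtoH 1) x = x.
Proof. H_ring. Qed.

Lemma Hmul_plus_r (x y z : H) :
  Hmul (@plus H_NormedModule x y) z
  = @plus H_NormedModule (Hmul x z) (Hmul y z).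
Proof. H_ring. Qed.

Lemma Hmul_plus_l (x y z : H) :
  Hmul x (@plus H_NormedModule y z)
  = @plus H_NormedModule (Hmul x y) (Hmul x z).
Proof. H_ring. Qed.

Definition H_Ring_mixin : Ring.mixin_of H_NormedModule :=
  Ring.Mixin H_NormedModule Hmul (RtoH 1)
    Hmul_assoc Hmul_1_r Hmul_1_l Hmul_plus_r Hmul_plus_l.

Canonical H_Ring : Ring :=
  Ring.Pack H (Ring.Class H (AbelianGroup.class H_NormedModule) H_Ring_mixin) H.

Declare Scope H_scope.
Delimit Scope H_scope with H.
Bind Scope H_scope with H.
Notation "p + q" := (@plus H_Ring p q) : H_scope.
Notation "p - q" := (@minus H_Ring p q) : H_scope.
Notation "- q" := (@opp H_Ring q) : H_scope.
Notation "p * q" := (@mult H_Ring p q) : H_scope.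
Notation "q ^ n" := (@pow_n H_Ring q n) : H_scope.
Notation "0" := (@zero H_Ring) : H_scope.
Notation "1" := (@one H_Ring) : H_scope.

Definition Hconj (q : H) : H := let '(a, b, c, d) := q in (a, - b, - c, - d)%R.

Definition Hnormsq (q : H) : R :=
  let '(a, b, c, d) := q in a ^ 2 + b ^ 2 + c ^ 2 + d ^ 2.

Definition Hnorm (q : H) : R := sqrt (Hnormsq q).

Definition Hinv (q : H) : H := (RtoH (/ Hnormsq q) * Hconj q)%H.

Definition imag_unit (I : H) : Prop := (I * I = - (1))%H.

Definition slice (I : H) (x y : R) : H := (RtoH x + I * RtoH y)%H.

Definition L (I q : H) : Prop := exists x y : R, q = slice I x y.

Definition Ball (r : Rbar) (q : H) : Prop := Rbar_lt (Hnorm q) r.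

(* A function U -> H is represented by a total function whose values off U are
   irrelevant, hence the differentiability within U.  The set U is meant to
   meet every L I in a relatively open subset of L I, so that the two partial
   derivatives below only depend on the restriction of f to U; it is not
   assumed to be open in H because it is also used for the complement of a set
   of singularities, of which only the sections by the L I are controlled. *)
Definition regular (U : H -> Prop) (f : H -> H) : Prop :=
  (forall q, U q ->
     @ex_filterdiff R_AbsRing H_NormedModule H_NormedModule
       f (within U (@locally H_NormedModule q))) /\
  (forall (I : H) (x y : R), imag_unit I -> U (slice I x y) ->
     exists dx dy : H,
       @is_derive R_AbsRing H_NormedModule (fun t => f (slice I t y)) x dx /\
       @is_derive R_AbsRing H_NormedModule (fun t => f (slice I x t)) y dy /\
       (RtoH (1 / 2) * (dx + I * dy) = 0)%H).

Definition is_Hseries (u : nat -> H) (l : H) : Prop :=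
  @is_series R_AbsRing H_NormedModule u l.

(* The two halves of the Laurent series sum_(n in Z) w^n a_n are required to
   converge separately. *)
Definition is_laurent_sum (a : Z -> H) (w v : H) : Prop :=
  exists v1 v2 : H,
    is_Hseries (fun n => w ^ n * a (Z.of_nat n))%H v1 /\
    is_Hseries (fun n => Hinv w ^ (S n) * a (- Z.of_nat (S n))%Z)%H v2 /\
    (v = v1 + v2)%H.

(* For f defined on U, a point p of L I which is a pole (possibly of order 0,
   i.e. a removable singularity) of the restriction of f to L I. *)
Definition pole (U : H -> Prop) (f : H -> H) (I p : H) : Prop :=
  exists (r : R) (a : Z -> H),
    0 < r /\
    (forall z, L I z -> 0 < Hnorm (z - p)%H < r ->
       U z /\ is_laurent_sum a (z - p)%H (f z)) /\
    (exists n : nat, forall m : nat, (n < m)%nat ->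
       a (- Z.of_nat m)%Z = 0%H).

Definition essential_singularity (U : H -> Prop) (f : H -> H) (I p : H) : Prop :=
  ~ pole U f I p.

(* "Discrete in Omega" means without accumulation points in Omega. *)
Definition slice_discrete (Omega Sg : H -> Prop) : Prop :=
  forall I p, imag_unit I -> Omega p -> L I p ->
    @locally H_NormedModule p (fun z => Sg z -> L I z -> z = p).

Definition semiregular (Omega Sg : H -> Prop) (f : H -> H) : Prop :=
  let U := fun q => Omega q /\ ~ Sg q in
  (forall q, Sg q -> Omega q) /\
  slice_discrete Omega Sg /\
  regular U f /\
  (forall I p, imag_unit I -> Sg p -> L I p -> ~ essential_singularity U f I p).

Definition is_expansion (r : R) (f : H -> H) (a : nat -> H) : Prop :=
  forall q, Ball r q -> is_Hseries (fun n => q ^ n * a n)%H (f q).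

(* The coefficients of the power series of f, which are unique if they exist
   and r > 0, and do exist when f is regular on Ball r. *)
Definition coef (r : R) (f : H -> H) : nat -> H :=
  epsilon (inhabits (fun _ => 0%H)) (is_expansion r f).

(* The sum of a convergent series; [Series] is real-valued. *)
Definition HSeries (u : nat -> H) : H :=
  (Series (fun n => fst (fst (fst (u n)))), Series (fun n => snd (fst (fst (u n)))),
   Series (fun n => snd (fst (u n))), Series (fun n => snd (u n))).

Definition reg_mul (r : R) (f g : H -> H) (q : H) : H :=
  HSeries (fun n => q ^ n *
    @sum_n H_Ring (fun k => coef r f k * coef r g (n - k)%nat) n)%H.

Definition reg_conj (r : R) (f : H -> H) (q : H) : H :=
  HSeries (fun n => q ^ n * Hconj (coef r f n))%H.

Definition reg_sym (r : R) (f : H -> H) : H -> H := reg_mul r f (reg_conj r f).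

(* Meaningful off the zero set of [reg_sym r f]. *)
Definition left_quotient (r : R) (f g : H -> H) (q : H) : H :=
  (Hinv (reg_sym r f q) * reg_mul r (reg_conj r f) g q)%H.

Definition polynomial_over (K : H -> Prop) (P : H -> H) : Prop :=
  exists (N : nat) (a : nat -> H),
    (forall n, K (a n)) /\
    (forall q, P q = @sum_n H_Ring (fun n => q ^ n * a n)%H N).

(* Main.v *)
Require Import Defs.
From Stdlib Require Import Reals Lra Lia List Classical ClassicalEpsilon FunctionalExtensionality.
From Coquelicot Require Import Coquelicot.
Open Scope R_scope.

(** On one slice [L I] the function [f] is meromorphic.  Its poles in the closed
    disc of radius [r] are finite in number, so that a polynomial [P] clears
    them, and [P f] extends to a holomorphic function on the disc of [L I] of
    radius [r], which is the sum of a power series there.  Read in the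
    quaternionic variable, this series is a regular function [g] on the ball.

    The zeros of [P] are taken in conjugate pairs, so that [P] has real
    coefficients.  Real coefficients are central: the regular product by [P] is
    the pointwise product, and the quotient of [g] by [P] is [g q] divided by
    [P q] ([left_quotient_evalH]).  It remains to see that [P f = g] off the
    singularities, on all slices and not only on [L I].  The two sides agree on
    the real axis, which lies in every slice, and on each slice [L J] the
    identity principle applies, once the poles of [f] on [L J] have been cleared
    by another polynomial ([semiregular_eq_regular]).

    Regularity is only a differentiability condition, without continuity of the
    derivatives, hence the theory of one complex variable starts at Goursat's
    theorem ([rect_int_holo]).  In the logarithmic coordinate an annulus is a
    rectangle, and Cauchy's theorem for rectangles says that the integral of a
    holomorphic function over a circle about 0 does not depend on the radius
    ([circle_int_const]).  Applied to the slope of a function at a point, with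
    that point as an exception, this gives Cauchy's formula and the Taylor
    expansion ([holo_taylor]); uniqueness of Taylor coefficients on the real axis
    gives the identity principle ([holo_identity]).

    Quaternionic functions on [L J] are reduced to complex functions by the
    complex linear coordinates [lam].  Poles are removed without a theorem on
    removable singularities: a polynomial with two zeros more than the order of
    the pole makes the product [O(|z - p|^2)], hence differentiable at [p] when
    extended by 0 ([clear_poles], [semiregular_cleared]). *)

(** * Complex differentiability *)

Definition Ccont (F : C -> C) (z : C) : Prop :=
  forall eps, 0 < eps -> exists del, 0 < del /\
    forall w, Cmod (w - z) < del -> Cmod (F w - F z) < eps.

(** Complex differentiability in Caratheodory's form: the slope function,
    extended to [z], is continuous there.  With this form the rules of
    calculus are algebraic identities, and the slope, which is holomorphic off
    [z], is the function to which Cauchy's theorem is applied below. *)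
Definition holo (F : C -> C) (z : C) : Prop :=
  exists D, Ccont D z /\ forall w, F w = (F z + D w * (w - z))%C.

Lemma Cmod_sub_0 (x y : C) : Cmod (x - y) = 0 -> x = y.
Proof.
  intros H0. apply Cmod_eq_0 in H0.
  replace x with ((x - y) + y)%C by ring. rewrite H0. ring.
Qed.

Lemma Cmod_sub_pos (x y : C) : x <> y -> 0 < Cmod (x - y).
Proof.
  intros Hn. destruct (Cmod_ge_0 (x - y)) as [Hp | He]; [exact Hp |].
  exfalso. apply Hn, Cmod_sub_0. now symmetry.
Qed.

Lemma Csub_neq_0 (x y : C) : x <> y -> (x - y)%C <> 0%C.
Proof.
  intros Hn He. apply Hn, Cmod_sub_0. rewrite He. apply Cmod_0.
Qed.

Lemma Cmod_sub_sym (x y : C) : Cmod (x - y) = Cmod (y - x).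
Proof. rewrite <- Cmod_opp. f_equal. ring. Qed.

Lemma Cmod_le_sub (x y : C) : Cmod x <= Cmod (x - y) + Cmod y.
Proof.
  replace x with ((x - y) + y)%C at 1 by ring. apply Cmod_triangle.
Qed.

Lemma Cmod_self_0 (x : C) : Cmod (x - x) = 0.
Proof. replace (x - x)%C with (RtoC 0) by ring. apply Cmod_0. Qed.

Lemma Cmod_le_sum (z : C) : Cmod z <= Rabs (Re z) + Rabs (Im z).
Proof.
  pose proof (Cmod2_alt z) as Hs. pose proof (Cmod_ge_0 z).
  pose proof (Rabs_pos (Re z)). pose proof (Rabs_pos (Im z)).
  rewrite <- (pow2_abs (Re z)), <- (pow2_abs (Im z)) in Hs. nra.
Qed.

Lemma Re_sub (x y : C) : Re (x - y) = Re x - Re y.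
Proof. reflexivity. Qed.

Lemma Im_sub (x y : C) : Im (x - y) = Im x - Im y.
Proof. reflexivity. Qed.

Lemma im_le_Cmod (z : C) : Rabs (Im z) <= Cmod z.
Proof. eapply Rle_trans; [apply Rmax_r | apply Rmax_Cmod]. Qed.

Lemma Ccont_const (c z : C) : Ccont (fun _ => c) z.
Proof.
  intros e He. exists 1. split; [lra |]. intros w _. now rewrite Cmod_self_0.
Qed.

Lemma Ccont_id (z : C) : Ccont (fun w => w) z.
Proof. intros e He. now exists e. Qed.

Lemma Ccont_plus (F G : C -> C) (z : C) :
  Ccont F z -> Ccont G z -> Ccont (fun w => F w + G w)%C z.
Proof.
  intros HF HG e He.
  destruct (HF (e / 2)) as (d1 & Hd1 & H1); [lra |].
  destruct (HG (e / 2)) as (d2 & Hd2 & H2); [lra |].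
  exists (Rmin d1 d2). split; [now apply Rmin_glb_lt |]. intros w Hw.
  pose proof (Rmin_l d1 d2). pose proof (Rmin_r d1 d2).
  specialize (H1 w ltac:(lra)). specialize (H2 w ltac:(lra)).
  replace (F w + G w - (F z + G z))%C with ((F w - F z) + (G w - G z))%C by ring.
  pose proof (Cmod_triangle (F w - F z) (G w - G z)). lra.
Qed.

Lemma Ccont_bounded (F : C -> C) (z : C) :
  Ccont F z -> exists del, 0 < del /\
    forall w, Cmod (w - z) < del -> Cmod (F w) <= Cmod (F z) + 1.
Proof.
  intros HF. destruct (HF 1 Rlt_0_1) as (d & Hd & H1).
  exists d. split; [exact Hd |]. intros w Hw. specialize (H1 w Hw).
  pose proof (Cmod_le_sub (F w) (F z)). lra.
Qed.

Lemma Ccont_mult (F G : C -> C) (z : C) :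
  Ccont F z -> Ccont G z -> Ccont (fun w => F w * G w)%C z.
Proof.
  intros HF HG e He.
  destruct (Ccont_bounded G z HG) as (d0 & Hd0 & H0).
  set (M := Cmod (G z) + 1) in *. set (N := Cmod (F z) + 1).
  assert (HM : 0 < M) by (unfold M; pose proof (Cmod_ge_0 (G z)); lra).
  assert (HN : 0 < N) by (unfold N; pose proof (Cmod_ge_0 (F z)); lra).
  destruct (HF (e / (2 * M))) as (d1 & Hd1 & H1); [apply Rdiv_lt_0_compat; lra |].
  destruct (HG (e / (2 * N))) as (d2 & Hd2 & H2); [apply Rdiv_lt_0_compat; lra |].
  exists (Rmin d0 (Rmin d1 d2)).
  split; [repeat apply Rmin_glb_lt; assumption |]. intros w Hw.
  pose proof (Rmin_l d0 (Rmin d1 d2)). pose proof (Rmin_r d0 (Rmin d1 d2)).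
  pose proof (Rmin_l d1 d2). pose proof (Rmin_r d1 d2).
  specialize (H0 w ltac:(lra)). specialize (H1 w ltac:(lra)).
  specialize (H2 w ltac:(lra)).
  replace (F w * G w - F z * G z)%C
    with ((F w - F z) * G w + F z * (G w - G z))%C by ring.
  pose proof (Cmod_triangle ((F w - F z) * G w) (F z * (G w - G z))) as Ht.
  rewrite !Cmod_mult in Ht.
  assert (Cmod (F w - F z) * Cmod (G w) <= Cmod (F w - F z) * M)
    by (apply Rmult_le_compat_l; [apply Cmod_ge_0 | exact H0]).
  assert (Cmod (F w - F z) * M < e / (2 * M) * M)
    by (apply Rmult_lt_compat_r; assumption).
  replace (e / (2 * M) * M) with (e / 2) in * by (field; lra).
  assert (Cmod (F z) * Cmod (G w - G z) <= N * Cmod (G w - G z))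
    by (apply Rmult_le_compat_r; [apply Cmod_ge_0 | unfold N; lra]).
  assert (N * Cmod (G w - G z) < N * (e / (2 * N)))
    by (apply Rmult_lt_compat_l; assumption).
  replace (N * (e / (2 * N))) with (e / 2) in * by (field; lra).
  lra.
Qed.

Lemma Ccont_comp (F G : C -> C) (z : C) :
  Ccont G z -> Ccont F (G z) -> Ccont (fun w => F (G w)) z.
Proof.
  intros HG HF e He. destruct (HF e He) as (d & Hd & H1).
  destruct (HG d Hd) as (d' & Hd' & H2). exists d'. split; [exact Hd' |].
  intros w Hw. apply H1, H2, Hw.
Qed.

Lemma Ccont_inv (z : C) : z <> 0%C -> Ccont Cinv z.
Proof.
  intros Hz e He. assert (Hm : 0 < Cmod z) by now apply Cmod_gt_0.
  exists (Rmin (Cmod z / 2) (e * (Cmod z * Cmod z) / 2)).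
  assert (0 < e * (Cmod z * Cmod z)) by (repeat apply Rmult_lt_0_compat; lra).
  split; [apply Rmin_glb_lt; lra |]. intros w Hw.
  pose proof (Rmin_l (Cmod z / 2) (e * (Cmod z * Cmod z) / 2)).
  pose proof (Rmin_r (Cmod z / 2) (e * (Cmod z * Cmod z) / 2)).
  pose proof (Cmod_le_sub z w) as Ht. rewrite Cmod_sub_sym in Ht.
  assert (Hw0 : w <> 0%C) by (apply Cmod_gt_0; lra).
  replace (/ w - / z)%C with ((z - w) * (/ w * / z))%C by (field; auto).
  rewrite !Cmod_mult, !Cmod_inv, Cmod_sub_sym by assumption.
  set (m := Cmod z) in *. set (n := Cmod w) in *. set (d := Cmod (w - z)) in *.
  assert (Hn : m / 2 < n) by lra.
  apply Rmult_lt_reg_r with (n * m); [apply Rmult_lt_0_compat; lra |].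
  replace (d * (/ n * / m) * (n * m)) with d by (field; lra).
  assert (e * m * (m / 2) < e * m * n)
    by (apply Rmult_lt_compat_l; [apply Rmult_lt_0_compat |]; lra).
  nra.
Qed.

Lemma Ccont_ext_loc (F G : C -> C) (z : C) (d : R) :
  0 < d -> (forall w, Cmod (w - z) < d -> F w = G w) -> Ccont F z -> Ccont G z.
Proof.
  intros Hd Heq HF e He. destruct (HF e He) as (d' & Hd' & H1).
  exists (Rmin d d'). split; [now apply Rmin_glb_lt |]. intros w Hw.
  pose proof (Rmin_l d d'). pose proof (Rmin_r d d').
  rewrite <- !Heq; [apply H1; lra | | lra]. now rewrite Cmod_self_0.
Qed.

Lemma holo_cont (F : C -> C) (z : C) : holo F z -> Ccont F z.
Proof.
  intros (D & HD & HF).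
  apply (Ccont_ext_loc (fun w => F z + D w * (w + - z))%C F z 1 Rlt_0_1).
  - intros w _. now rewrite (HF w).
  - repeat first [apply Ccont_plus | apply Ccont_mult | apply Ccont_const
                  | apply Ccont_id | exact HD].
Qed.

Lemma holo_const (c z : C) : holo (fun _ => c) z.
Proof. exists (fun _ => RtoC 0). split; [apply Ccont_const | intros; ring]. Qed.

Lemma holo_id (z : C) : holo (fun w => w) z.
Proof. exists (fun _ => RtoC 1). split; [apply Ccont_const | intros; ring]. Qed.

Lemma holo_plus (F G : C -> C) (z : C) :
  holo F z -> holo G z -> holo (fun w => F w + G w)%C z.
Proof.
  intros (D & HD & HF) (E & HE & HG). exists (fun w => D w + E w)%C.
  split; [now apply Ccont_plus |]. intros w. rewrite HF, HG. ring.
Qed.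

Lemma holo_mult (F G : C -> C) (z : C) :
  holo F z -> holo G z -> holo (fun w => F w * G w)%C z.
Proof.
  intros HF' HG'. pose proof (holo_cont F z HF') as HFc.
  destruct HF' as (D & HD & HF). destruct HG' as (E & HE & HG).
  exists (fun w => D w * G z + F w * E w)%C. split.
  - repeat first [apply Ccont_plus | apply Ccont_mult | apply Ccont_const
                  | assumption].
  - intros w. rewrite (HG w), (HF w). ring.
Qed.

Lemma holo_opp (F : C -> C) (z : C) : holo F z -> holo (fun w => - F w)%C z.
Proof.
  intros (D & HD & HF). exists (fun w => (- (1)) * D w)%C. split.
  - apply Ccont_mult; [apply Ccont_const | exact HD].
  - intros w. rewrite HF. ring.
Qed.

Lemma holo_minus (F G : C -> C) (z : C) :
  holo F z -> holo G z -> holo (fun w => F w - G w)%C z.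
Proof. intros HF HG. apply holo_plus; [exact HF | now apply holo_opp]. Qed.

Lemma holo_comp (F G : C -> C) (z : C) :
  holo G z -> holo F (G z) -> holo (fun w => F (G w)) z.
Proof.
  intros HG' (D & HD & HF). pose proof (holo_cont G z HG') as HGc.
  destruct HG' as (E & HE & HG). exists (fun w => D (G w) * E w)%C. split.
  - apply Ccont_mult; [now apply Ccont_comp | exact HE].
  - intros w. rewrite HF. replace (G w - G z)%C with (E w * (w - z))%C; [ring |].
    rewrite (HG w). ring.
Qed.

(** The slope function is defined at [z] by the derivative [D]. *)
Lemma holo_slope (F : C -> C) (z D : C) :
  (forall eps, 0 < eps -> exists del, 0 < del /\ forall w, Cmod (w - z) < del ->
     Cmod (F w - F z - D * (w - z)) <= eps * Cmod (w - z)) ->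
  holo F z.
Proof.
  intros Hd.
  exists (fun w => if excluded_middle_informative (w = z) then D
                   else (F w - F z) / (w - z))%C. split.
  - intros e He. destruct (Hd (e / 2)) as (d & Hd0 & H1); [lra |].
    exists d. split; [exact Hd0 |]. intros w Hw. specialize (H1 w Hw).
    destruct (excluded_middle_informative (z = z)) as [_ | n]; [| easy].
    destruct (excluded_middle_informative (w = z)) as [_ | n].
    + now rewrite Cmod_self_0.
    + pose proof (Cmod_sub_pos w z n) as Hp. pose proof (Csub_neq_0 w z n) as Hn.
      replace ((F w - F z) / (w - z) - D)%C
        with ((F w - F z - D * (w - z)) * / (w - z))%C by (field; exact Hn).
      rewrite Cmod_mult, Cmod_inv by exact Hn.
      apply Rmult_lt_reg_r with (Cmod (w - z)); [exact Hp |].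
      rewrite Rmult_assoc, Rinv_l by lra. nra.
  - intros w. destruct (excluded_middle_informative (w = z)) as [-> | n]; [ring |].
    field. now apply Csub_neq_0.
Qed.

Lemma holo_ext_loc (F G : C -> C) (z : C) (d : R) :
  0 < d -> (forall w, Cmod (w - z) < d -> F w = G w) -> holo F z -> holo G z.
Proof.
  intros Hd Heq (D & HD & HF). apply holo_slope with (D z). intros e He.
  destruct (HD e He) as (d' & Hd' & H1).
  exists (Rmin d d'). split; [now apply Rmin_glb_lt |]. intros w Hw.
  pose proof (Rmin_l d d'). pose proof (Rmin_r d d').
  rewrite <- !Heq; [| now rewrite Cmod_self_0 | lra].
  rewrite (HF w).
  replace (F z + D w * (w - z) - F z - D z * (w - z))%C
    with ((D w - D z) * (w - z))%C by ring.
  rewrite Cmod_mult. apply Rmult_le_compat_r; [apply Cmod_ge_0 |].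
  left. apply H1. lra.
Qed.

Lemma holo_inv (z : C) : z <> 0%C -> holo Cinv z.
Proof.
  intros Hz. assert (Hm : 0 < Cmod z) by now apply Cmod_gt_0.
  apply (holo_ext_loc
           (fun w => / z + (if excluded_middle_informative (w = 0%C)
                            then 0 else - (/ z * / w)) * (w - z))%C _ z (Cmod z) Hm).
  - intros w Hw. destruct (excluded_middle_informative (w = 0%C)) as [-> | n].
    + exfalso. revert Hw. rewrite Cmod_sub_sym.
      replace (z - 0)%C with z by ring. lra.
    + field. auto.
  - eexists. split; cycle 1.
    + intros w. replace (z - z)%C with (RtoC 0) by ring.
      rewrite Cmult_0_r, Cplus_0_r. reflexivity.
    + apply (Ccont_ext_loc (fun w => - (1) * (/ z * / w))%C _ z (Cmod z) Hm).
      * intros w Hw. destruct (excluded_middle_informative (w = 0%C)) as [-> | n];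
          [| ring].
        exfalso. revert Hw. rewrite Cmod_sub_sym.
        replace (z - 0)%C with z by ring. lra.
      * apply Ccont_mult; [apply Ccont_const |].
        apply Ccont_mult; [apply Ccont_const | now apply Ccont_inv].
Qed.

Lemma holo_pow (F : C -> C) (z : C) (n : nat) :
  holo F z -> holo (fun w => F w ^ n)%C z.
Proof.
  intros HF. induction n as [| n IH]; simpl; [apply holo_const |].
  now apply holo_mult.
Qed.
(** * Cauchy's theorem on rectangles *)

(** Integration in each coordinate; the estimates below are not sharp, since
    only the order of magnitude of integrals matters. *)
Definition CInt (f : R -> C) (a b : R) : C :=
  (RInt (fun t => Re (f t)) a b, RInt (fun t => Im (f t)) a b).

Definition Cex_RInt (f : R -> C) (a b : R) : Prop :=
  ex_RInt (fun t => Re (f t)) a b /\ ex_RInt (fun t => Im (f t)) a b.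

Definition Pcont (f : R -> C) (x : R) : Prop :=
  continuous (fun t => Re (f t)) x /\ continuous (fun t => Im (f t)) x.

Lemma continuous_eps (f : R -> R) (x : R) :
  continuous f x <->
  forall e, 0 < e -> exists d, 0 < d /\
    forall t, Rabs (t - x) < d -> Rabs (f t - f x) < e.
Proof.
  split.
  - intros Hf e He. apply filterlim_locally with (eps := mkposreal e He) in Hf.
    destruct Hf as [d Hd]. exists d. split; [apply cond_pos |]. exact Hd.
  - intros Hf. apply filterlim_locally. intros [e He].
    destruct (Hf e He) as (d & Hd & H1). exists (mkposreal d Hd). exact H1.
Qed.

Lemma Pcont_eps (f : R -> C) (x : R) :
  Pcont f x <->
  forall e, 0 < e -> exists d, 0 < d /\
    forall t, Rabs (t - x) < d -> Cmod (f t - f x) < e.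
Proof.
  split.
  - intros [Hr Hi] e He.
    destruct (proj1 (continuous_eps _ _) Hr (e / 2)) as (d1 & Hd1 & H1); [lra |].
    destruct (proj1 (continuous_eps _ _) Hi (e / 2)) as (d2 & Hd2 & H2); [lra |].
    exists (Rmin d1 d2). split; [now apply Rmin_glb_lt |]. intros t Ht.
    pose proof (Rmin_l d1 d2). pose proof (Rmin_r d1 d2).
    specialize (H1 t ltac:(lra)). specialize (H2 t ltac:(lra)).
    pose proof (Cmod_le_sum (f t - f x)) as Hs.
    rewrite Im_sub, Re_sub in Hs. lra.
  - intros Hf. split; apply continuous_eps; intros e He;
      destruct (Hf e He) as (d & Hd & H1); exists d; (split; [exact Hd |]);
      intros t Ht; specialize (H1 t Ht).
    + pose proof (re_le_Cmod (f t - f x)) as Hr.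
      rewrite Re_sub in Hr. lra.
    + pose proof (im_le_Cmod (f t - f x)) as Hr.
      rewrite Im_sub in Hr. lra.
Qed.

Lemma Pcont_comp (g : C -> C) (p : R -> C) (x : R) :
  Ccont g (p x) -> Pcont p x -> Pcont (fun t => g (p t)) x.
Proof.
  intros Hg Hp. apply Pcont_eps. intros e He.
  destruct (Hg e He) as (d & Hd & H1).
  destruct (proj1 (Pcont_eps _ _) Hp d Hd) as (d' & Hd' & H2).
  exists d'. split; [exact Hd' |]. intros t Ht. apply H1, H2, Ht.
Qed.

Lemma Pcont_horizontal (c x : R) : Pcont (fun t => (t, c)) x.
Proof. split; [apply continuous_id | apply continuous_const]. Qed.

Lemma Pcont_vertical (b y : R) : Pcont (fun t => (b, t)) y.
Proof. split; [apply continuous_const | apply continuous_id]. Qed.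

Lemma Pcont_ex_RInt (f : R -> C) (a b : R) :
  (forall x, Rmin a b <= x <= Rmax a b -> Pcont f x) -> Cex_RInt f a b.
Proof.
  intros Hf. split; apply (@ex_RInt_continuous R_CompleteNormedModule);
    intros x Hx; now destruct (Hf x Hx).
Qed.

Lemma CInt_ext (f g : R -> C) (a b : R) :
  (forall x, f x = g x) -> CInt f a b = CInt g a b.
Proof.
  intros Hfg. replace g with f; [reflexivity |]. now apply functional_extensionality.
Qed.

Lemma CInt_plus (f g : R -> C) (a b : R) :
  Cex_RInt f a b -> Cex_RInt g a b ->
  CInt (fun t => f t + g t)%C a b = (CInt f a b + CInt g a b)%C.
Proof.
  intros [Hf1 Hf2] [Hg1 Hg2]. unfold CInt, Cplus; cbn [fst snd].
  f_equal.
  - exact (RInt_plus (V := R_CompleteNormedModule) _ _ a b Hf1 Hg1).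
  - exact (RInt_plus (V := R_CompleteNormedModule) _ _ a b Hf2 Hg2).
Qed.

Lemma Cex_RInt_plus (f g : R -> C) (a b : R) :
  Cex_RInt f a b -> Cex_RInt g a b -> Cex_RInt (fun t => f t + g t)%C a b.
Proof.
  intros [Hf1 Hf2] [Hg1 Hg2].
  split.
  - exact (ex_RInt_plus (V := R_NormedModule) _ _ a b Hf1 Hg1).
  - exact (ex_RInt_plus (V := R_NormedModule) _ _ a b Hf2 Hg2).
Qed.

Lemma RInt_lincomb (u v : R -> R) (a b x y : R) :
  ex_RInt u a b -> ex_RInt v a b ->
  ex_RInt (fun t => x * u t + y * v t) a b /\
  RInt (fun t => x * u t + y * v t) a b = x * RInt u a b + y * RInt v a b.
Proof.
  intros Hu Hv.
  pose proof (ex_RInt_scal (V := R_NormedModule) u a b x Hu) as Hu'.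
  pose proof (ex_RInt_scal (V := R_NormedModule) v a b y Hv) as Hv'.
  split.
  - apply (ex_RInt_plus (V := R_NormedModule) _ _ a b Hu' Hv').
  - etransitivity; [apply (RInt_plus (V := R_CompleteNormedModule) _ _ a b Hu' Hv') |].
    rewrite !(RInt_scal (V := R_CompleteNormedModule)) by assumption. reflexivity.
Qed.

Lemma CInt_scal_both (c : C) (f : R -> C) (a b : R) :
  Cex_RInt f a b ->
  Cex_RInt (fun t => c * f t)%C a b /\
  CInt (fun t => c * f t)%C a b = (c * CInt f a b)%C.
Proof.
  intros [Hr Hi]. destruct c as [x y].
  destruct (RInt_lincomb _ _ a b x (- y) Hr Hi) as [E1 I1].
  destruct (RInt_lincomb _ _ a b x y Hi Hr) as [E2 I2].
  split; [split |].
  - eapply ex_RInt_ext; [| exact E1]. intros t _. unfold Re, Im. simpl. ring.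
  - eapply ex_RInt_ext; [| exact E2]. intros t _. unfold Re, Im. simpl. ring.
  - unfold CInt at 1, Cmult; cbn [fst snd]. f_equal.
    + etransitivity; [| etransitivity; [exact I1 | unfold CInt; simpl; ring]].
      apply RInt_ext. intros t _. unfold Re, Im. simpl. ring.
    + etransitivity; [| etransitivity; [exact I2 | unfold CInt; simpl; ring]].
      apply RInt_ext. intros t _. unfold Re, Im. simpl. ring.
Qed.

Lemma CInt_scal (c : C) (f : R -> C) (a b : R) :
  Cex_RInt f a b -> CInt (fun t => c * f t)%C a b = (c * CInt f a b)%C.
Proof. intros Hf. apply (CInt_scal_both c f a b Hf). Qed.

Lemma Cex_RInt_scal (c : C) (f : R -> C) (a b : R) :
  Cex_RInt f a b -> Cex_RInt (fun t => c * f t)%C a b.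
Proof. intros Hf. apply (CInt_scal_both c f a b Hf). Qed.

Lemma CInt_Chasles (f : R -> C) (a b c : R) :
  Cex_RInt f a b -> Cex_RInt f b c ->
  (CInt f a b + CInt f b c)%C = CInt f a c.
Proof.
  intros [H1 H2] [H3 H4]. unfold CInt, Cplus; cbn [fst snd].
  apply (f_equal2 pair).
  - exact (RInt_Chasles (V := R_CompleteNormedModule) _ a b c H1 H3).
  - exact (RInt_Chasles (V := R_CompleteNormedModule) _ a b c H2 H4).
Qed.

Lemma CInt_const (c : C) (a b : R) :
  CInt (fun _ => c) a b = (RtoC (b - a) * c)%C.
Proof.
  unfold CInt. rewrite !RInt_const. destruct c.
  unfold scal; simpl; unfold mult; simpl. unfold Cmult; simpl. f_equal; ring.
Qed.

Lemma CInt_bound (f : R -> C) (a b M : R) :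
  Cex_RInt f a b ->
  (forall x, Rmin a b <= x <= Rmax a b -> Cmod (f x) <= M) ->
  Cmod (CInt f a b) <= 2 * M * Rabs (b - a).
Proof.
  assert (Hreal : forall (g : R -> R) a b, ex_RInt g a b ->
    (forall x, Rmin a b <= x <= Rmax a b -> Rabs (g x) <= M) ->
    Rabs (RInt g a b) <= M * Rabs (b - a)).
  { assert (Hle : forall (g : R -> R) a b, a <= b -> ex_RInt g a b ->
      (forall x, a <= x <= b -> Rabs (g x) <= M) ->
      Rabs (RInt g a b) <= M * Rabs (b - a)).
    { intros g a' b' Hab Hg Hx. rewrite (Rabs_pos_eq (b' - a')) by lra.
      rewrite Rmult_comm. now apply abs_RInt_le_const. }
    intros g a' b' Hg Hx. destruct (Rle_dec a' b') as [Hab | Hab].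
    - apply Hle; [exact Hab | exact Hg |]. intros x H0. apply Hx.
      rewrite Rmin_left, Rmax_right by lra. exact H0.
    - rewrite <- (opp_RInt_swap (V := R_CompleteNormedModule))
        by now apply ex_RInt_swap.
      change (Rabs (- RInt g b' a') <= M * Rabs (b' - a')).
      rewrite Rabs_Ropp, Rabs_minus_sym. apply Hle; [lra | now apply ex_RInt_swap |].
      intros x H0. apply Hx. rewrite Rmin_right, Rmax_left by lra. exact H0. }
  intros [Hr Hi] HM.
  assert (H1 : Rabs (RInt (fun t => Re (f t)) a b) <= M * Rabs (b - a)).
  { apply Hreal; [exact Hr |]. intros x Hx.
    eapply Rle_trans; [apply re_le_Cmod | now apply HM]. }
  assert (H2 : Rabs (RInt (fun t => Im (f t)) a b) <= M * Rabs (b - a)).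
  { apply Hreal; [exact Hi |]. intros x Hx.
    eapply Rle_trans; [apply im_le_Cmod | now apply HM]. }
  eapply Rle_trans; [apply Cmod_le_sum |].
  unfold CInt. cbn [Re Im fst snd]. lra.
Qed.

(** The boundary integral over a rectangle with opposite corners [(a, c)] and
    [(b, d)].  These may come in any order, which changes the orientation; the
    integral is then additive in each interval without conditions on the order. *)
Definition rect_int (g : C -> C) (a b c d : R) : C :=
  (CInt (fun t => g (t, c)) a b - CInt (fun t => g (t, d)) a b
   + Ci * (CInt (fun t => g (b, t)) c d - CInt (fun t => g (a, t)) c d))%C.

Definition in_rect (a b c d : R) (w : C) : Prop :=
  a <= Re w <= b /\ c <= Im w <= d.

Lemma between (a b x y t : R) :
  a <= x <= b -> a <= y <= b -> Rmin x y <= t <= Rmax x y -> a <= t <= b.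
Proof.
  intros Hx Hy Ht. unfold Rmin, Rmax in Ht.
  destruct (Rle_dec x y); lra.
Qed.

Lemma Cex_horizontal (g : C -> C) (A B C' D c x y : R) :
  (forall w, in_rect A B C' D w -> Ccont g w) ->
  C' <= c <= D -> A <= x <= B -> A <= y <= B ->
  Cex_RInt (fun t => g (t, c)) x y.
Proof.
  intros Hg Hc Hx Hy. apply Pcont_ex_RInt. intros t Ht.
  apply (Pcont_comp g (fun t => (t, c))); [| apply Pcont_horizontal].
  apply Hg. split; [exact (between A B x y t Hx Hy Ht) | exact Hc].
Qed.

Lemma Cex_vertical (g : C -> C) (A B C' D b x y : R) :
  (forall w, in_rect A B C' D w -> Ccont g w) ->
  A <= b <= B -> C' <= x <= D -> C' <= y <= D ->
  Cex_RInt (fun t => g (b, t)) x y.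
Proof.
  intros Hg Hb Hx Hy. apply Pcont_ex_RInt. intros t Ht.
  apply (Pcont_comp g (fun t => (b, t))); [| apply Pcont_vertical].
  apply Hg. split; [exact Hb | exact (between C' D x y t Hx Hy Ht)].
Qed.

Lemma rect_int_split_x (g : C -> C) (A B C' D a b b' c d : R) :
  (forall w, in_rect A B C' D w -> Ccont g w) ->
  A <= a <= B -> A <= b <= B -> A <= b' <= B -> C' <= c <= D -> C' <= d <= D ->
  rect_int g a b' c d = (rect_int g a b c d + rect_int g b b' c d)%C.
Proof.
  intros Hg Ha Hb Hb' Hc Hd. unfold rect_int.
  rewrite <- (CInt_Chasles (fun t => g (t, c)) a b b'),
    <- (CInt_Chasles (fun t => g (t, d)) a b b')
    by (eapply Cex_horizontal; eassumption). ring.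
Qed.

Lemma rect_int_split_y (g : C -> C) (A B C' D a b c d d' : R) :
  (forall w, in_rect A B C' D w -> Ccont g w) ->
  A <= a <= B -> A <= b <= B -> C' <= c <= D -> C' <= d <= D -> C' <= d' <= D ->
  rect_int g a b c d' = (rect_int g a b c d + rect_int g a b d d')%C.
Proof.
  intros Hg Ha Hb Hc Hd Hd'. unfold rect_int.
  rewrite <- (CInt_Chasles (fun t => g (a, t)) c d d'),
    <- (CInt_Chasles (fun t => g (b, t)) c d d')
    by (eapply Cex_vertical; eassumption). ring.
Qed.

Lemma rect_int_bound (g : C -> C) (a b c d M : R) :
  (forall w, in_rect (Rmin a b) (Rmax a b) (Rmin c d) (Rmax c d) w ->
     Ccont g w /\ Cmod (g w) <= M) ->
  Cmod (rect_int g a b c d) <= 4 * M * (Rabs (b - a) + Rabs (d - c)).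
Proof.
  intros Hg.
  pose proof (Rmin_l a b). pose proof (Rmin_r a b).
  pose proof (Rmax_l a b). pose proof (Rmax_r a b).
  pose proof (Rmin_l c d). pose proof (Rmin_r c d).
  pose proof (Rmax_l c d). pose proof (Rmax_r c d).
  assert (Hh : forall y, Rmin c d <= y <= Rmax c d ->
            Cmod (CInt (fun t => g (t, y)) a b) <= 2 * M * Rabs (b - a)).
  { intros y Hy. apply CInt_bound.
    - eapply Cex_horizontal with (A := Rmin a b) (B := Rmax a b);
        [intros w Hw; apply (Hg w Hw) | exact Hy | lra | lra].
    - intros x Hx. apply Hg. split; assumption. }
  assert (Hv : forall x, Rmin a b <= x <= Rmax a b ->
            Cmod (CInt (fun t => g (x, t)) c d) <= 2 * M * Rabs (d - c)).
  { intros x Hx. apply CInt_bound.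
    - eapply Cex_vertical with (C' := Rmin c d) (D := Rmax c d);
        [intros w Hw; apply (Hg w Hw) | exact Hx | lra | lra].
    - intros y Hy. apply Hg. split; assumption. }
  pose proof (Hh c ltac:(lra)). pose proof (Hh d ltac:(lra)).
  pose proof (Hv a ltac:(lra)). pose proof (Hv b ltac:(lra)).
  unfold rect_int.
  set (X1 := CInt (fun t => g (t, c)) a b) in *.
  set (X2 := CInt (fun t => g (t, d)) a b) in *.
  set (Y1 := CInt (fun t => g (b, t)) c d) in *.
  set (Y2 := CInt (fun t => g (a, t)) c d) in *.
  pose proof (Cmod_triangle (X1 - X2) (Ci * (Y1 - Y2))) as T1.
  rewrite Cmod_mult, Cmod_Ci in T1.
  pose proof (Cmod_triangle X1 (- X2)) as T2. rewrite Cmod_opp in T2.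
  pose proof (Cmod_triangle Y1 (- Y2)) as T3. rewrite Cmod_opp in T3.
  fold (X1 - X2)%C in T2. fold (Y1 - Y2)%C in T3. lra.
Qed.

Lemma RInt_affine (u v a b : R) :
  RInt (fun t => u + v * t) a b = u * (b - a) + v * (b ^ 2 - a ^ 2) / 2.
Proof.
  apply is_RInt_unique.
  replace (u * (b - a) + v * (b ^ 2 - a ^ 2) / 2)
    with (minus (u * b + v * b ^ 2 / 2) (u * a + v * a ^ 2 / 2))
    by (unfold minus, plus, opp; simpl; field).
  apply (is_RInt_derive (fun t => u * t + v * t ^ 2 / 2)).
  - intros x _. auto_derive; [exact I | simpl; field].
  - intros x _. apply (continuous_plus (fun _ => u) (fun t => v * t)).
    + apply continuous_const.
    + apply (continuous_mult (fun _ => v) (fun t => t));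
        [apply continuous_const | apply continuous_id].
Qed.

Lemma rect_int_affine (p q : C) (a b c d : R) :
  rect_int (fun w => p + q * w)%C a b c d = 0%C.
Proof.
  destruct p as [p1 p2], q as [q1 q2].
  assert (Hh : forall y, CInt (fun t => (p1, p2) + (q1, q2) * (t, y))%C a b
    = ((p1 - q2 * y) * (b - a) + q1 * (b ^ 2 - a ^ 2) / 2,
       (p2 + q1 * y) * (b - a) + q2 * (b ^ 2 - a ^ 2) / 2)).
  { intros y. unfold CInt. rewrite <- !RInt_affine.
    f_equal; apply RInt_ext; intros t _; unfold Re, Im; simpl; ring. }
  assert (Hv : forall x, CInt (fun t => (p1, p2) + (q1, q2) * (x, t))%C c d
    = ((p1 + q1 * x) * (d - c) + (- q2) * (d ^ 2 - c ^ 2) / 2,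
       (p2 + q2 * x) * (d - c) + q1 * (d ^ 2 - c ^ 2) / 2)).
  { intros x. unfold CInt. rewrite <- !RInt_affine.
    f_equal; apply RInt_ext; intros t _; unfold Re, Im; simpl; ring. }
  unfold rect_int. rewrite !Hh, !Hv.
  unfold Ci, Cmult, Cplus, Cminus, Copp, RtoC; simpl. f_equal; field.
Qed.

Lemma rect_int_sub_affine (g : C -> C) (p q : C) (a b c d : R) :
  a <= b -> c <= d ->
  (forall w, in_rect a b c d w -> Ccont g w) ->
  rect_int g a b c d = rect_int (fun w => g w - (p + q * w))%C a b c d.
Proof.
  intros Hab Hcd Hg.
  assert (Hh : forall y, c <= y <= d ->
    CInt (fun t => g (t, y) - (p + q * (t, y)))%C a b
    = (CInt (fun t => g (t, y)) a b
       + - (1) * CInt (fun t => p + q * (t, y))%C a b)%C).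
  { intros y Hy.
    assert (Ha : Cex_RInt (fun t => p + q * (t, y))%C a b).
    { apply (Cex_horizontal (fun w => p + q * w)%C a b c d); [| lra | lra | lra].
      intros w _. repeat first [apply Ccont_plus | apply Ccont_mult
                  | apply Ccont_const | apply Ccont_id]. }
    rewrite <- CInt_scal by exact Ha.
    rewrite <- CInt_plus; [apply CInt_ext; intros t; ring | |].
    - apply (Cex_horizontal g a b c d); [exact Hg | lra | lra | lra].
    - now apply Cex_RInt_scal. }
  assert (Hv : forall x, a <= x <= b ->
    CInt (fun t => g (x, t) - (p + q * (x, t)))%C c d
    = (CInt (fun t => g (x, t)) c d
       + - (1) * CInt (fun t => p + q * (x, t))%C c d)%C).
  { intros x Hx.
    assert (Ha : Cex_RInt (fun t => p + q * (x, t))%C c d).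
    { apply (Cex_vertical (fun w => p + q * w)%C a b c d); [| lra | lra | lra].
      intros w _. repeat first [apply Ccont_plus | apply Ccont_mult
                  | apply Ccont_const | apply Ccont_id]. }
    rewrite <- CInt_scal by exact Ha.
    rewrite <- CInt_plus; [apply CInt_ext; intros t; ring | |].
    - apply (Cex_vertical g a b c d); [exact Hg | lra | lra | lra].
    - now apply Cex_RInt_scal. }
  pose proof (rect_int_affine p q a b c d) as H0. unfold rect_int in *.
  rewrite !Hh, !Hv by lra.
  set (X1 := CInt (fun t => p + q * (t, c))%C a b) in *.
  set (X2 := CInt (fun t => p + q * (t, d))%C a b) in *.
  set (Y1 := CInt (fun t => p + q * (b, t))%C c d) in *.
  set (Y2 := CInt (fun t => p + q * (a, t))%C c d) in *.
  match goal with |- ?L = ?R =>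
    replace R with (L - (X1 - X2 + Ci * (Y1 - Y2)))%C by ring end.
  rewrite H0. ring.
Qed.

Lemma half_pow_small (w d : R) : 0 < d -> exists n, w / 2 ^ n < d.
Proof.
  intros Hd. destruct (Rle_dec w 0) as [Hw | Hw].
  { exists 0%nat. simpl. lra. }
  destruct (pow_lt_1_zero (/ 2) ltac:(rewrite Rabs_pos_eq; lra) (d / w)) as [n Hn].
  { apply Rdiv_lt_0_compat; lra. }
  exists n. specialize (Hn n (le_n n)).
  rewrite Rabs_pos_eq, pow_inv in Hn by (apply pow_le; lra).
  unfold Rdiv. rewrite Rmult_comm.
  apply Rmult_lt_reg_r with (/ w); [apply Rinv_0_lt_compat; lra |].
  rewrite Rmult_assoc, Rinv_r, Rmult_1_r by lra. exact Hn.
Qed.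

Lemma nested_halves (u : nat -> R) (w : R) :
  (forall n, u n <= u (S n)) ->
  (forall n, u (S n) + w / 2 ^ S n <= u n + w / 2 ^ n) ->
  exists X, forall n, u n <= X <= u n + w / 2 ^ n.
Proof.
  intros Hu Hv.
  destruct (ex_lim_seq_adj u (fun n => u n + w / 2 ^ n) Hu Hv)
    as (Hlu & Hlv & Heq).
  { apply is_lim_seq_ext with (fun n => w * (/ 2) ^ n).
    - intros n. rewrite pow_inv. unfold Rdiv. ring.
    - replace (Finite 0) with (Rbar_mult w 0) by (simpl; f_equal; ring).
      apply is_lim_seq_scal_l, is_lim_seq_geom. rewrite Rabs_pos_eq; lra. }
  exists (real (Lim_seq u)). intros n. split.
  - apply is_lim_seq_incr_compare; [now apply Lim_seq_correct' | exact Hu].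
  - rewrite Heq. apply (is_lim_seq_decr_compare (fun n => u n + w / 2 ^ n));
      [now apply Lim_seq_correct' | exact Hv].
Qed.

(** Compactness of a rectangle as an induction principle: if [Q] failed, it would
    fail on a nested sequence of quarters, which shrinks to a point.  The index
    [n] counts the halvings and [(x, y)] is the lower left corner, so that all
    rectangles are similar to the first one. *)
Lemma quartering (Q : nat -> R -> R -> Prop) (x0 y0 w h : R) :
  0 <= w -> 0 <= h ->
  (forall n x y, x0 <= x -> x + w / 2 ^ n <= x0 + w ->
     y0 <= y -> y + h / 2 ^ n <= y0 + h ->
     Q (S n) x y -> Q (S n) (x + w / 2 ^ S n) y ->
     Q (S n) x (y + h / 2 ^ S n) ->
     Q (S n) (x + w / 2 ^ S n) (y + h / 2 ^ S n) -> Q n x y) ->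
  (forall X Y, x0 <= X <= x0 + w -> y0 <= Y <= y0 + h ->
     exists del, 0 < del /\ forall n x y,
       x0 <= x -> x + w / 2 ^ n <= x0 + w -> y0 <= y -> y + h / 2 ^ n <= y0 + h ->
       x <= X <= x + w / 2 ^ n -> y <= Y <= y + h / 2 ^ n ->
       w / 2 ^ n < del -> h / 2 ^ n < del -> Q n x y) ->
  Q 0%nat x0 y0.
Proof.
  intros Hw Hh Hstep Hloc.
  destruct (excluded_middle_informative (Q 0%nat x0 y0)) as [H0 | H0]; [exact H0 |].
  exfalso.
  set (bad := fun n x y => if excluded_middle_informative (Q n x y)
                           then false else true).
  assert (Hbad : forall n x y, bad n x y = true <-> ~ Q n x y).
  { intros n x y. unfold bad.
    destruct (excluded_middle_informative (Q n x y)); split; easy. }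
  set (next := fun n (p : R * R) => let '(x, y) := p in
    let x' := x + w / 2 ^ S n in let y' := y + h / 2 ^ S n in
    if bad (S n) x y then (x, y) else if bad (S n) x' y then (x', y)
    else if bad (S n) x y' then (x, y') else (x', y')).
  set (p := fix p n := match n with O => (x0, y0) | S m => next m (p m) end).
  assert (Hpos : forall v n, 0 <= v -> 0 <= v / 2 ^ n).
  { intros v n Hv. apply Rmult_le_pos; [exact Hv |].
    left. apply Rinv_0_lt_compat, pow_lt. lra. }
  assert (Hhalf : forall v n, v / 2 ^ n = v / 2 ^ S n + v / 2 ^ S n).
  { intros v n. simpl. field. apply pow_nonzero. lra. }
  assert (Hstepx : forall n, (fst (p (S n)) = fst (p n) \/
                              fst (p (S n)) = fst (p n) + w / 2 ^ S n) /\
                             (snd (p (S n)) = snd (p n) \/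
                              snd (p (S n)) = snd (p n) + h / 2 ^ S n)).
  { intros n. change (p (S n)) with (next n (p n)).
    destruct (p n) as [x y]. unfold next.
    repeat match goal with |- context [if ?b then _ else _] => destruct b end;
      simpl; auto. }
  assert (Hinv : forall n, x0 <= fst (p n) /\ fst (p n) + w / 2 ^ n <= x0 + w /\
            y0 <= snd (p n) /\ snd (p n) + h / 2 ^ n <= y0 + h /\
            ~ Q n (fst (p n)) (snd (p n))).
  { induction n as [| n (I1 & I2 & I3 & I4 & I5)].
    - simpl. repeat split; [lra | lra | lra | lra | exact H0].
    - pose proof (Hstepx n) as [Hx Hy].
      pose proof (Hhalf w n). pose proof (Hhalf h n).
      pose proof (Hpos w (S n) Hw). pose proof (Hpos h (S n) Hh).
      repeat split; try (destruct Hx as [Hx | Hx], Hy as [Hy | Hy]; lra).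
      clear Hx Hy. change (p (S n)) with (next n (p n)).
      specialize (Hstep n (fst (p n)) (snd (p n)) I1 I2 I3 I4).
      destruct (p n) as [x y]. unfold next. cbn [fst snd] in *.
      repeat match goal with
        |- context [if ?b then _ else _] => destruct b eqn:?E end;
        cbn [fst snd];
        try match goal with E0 : bad ?m ?s ?t = true |- ~ Q ?m ?s ?t =>
          exact (proj1 (Hbad m s t) E0) end.
      assert (Hgood : forall n x y, bad n x y = false -> Q n x y).
      { intros m a b E'. unfold bad in E'.
        destruct (excluded_middle_informative (Q m a b)); easy. }
      intros HQ. apply I5, Hstep; auto. }
  destruct (nested_halves (fun n => fst (p n)) w) as [X HX].
  { intros n. pose proof (Hpos w (S n) Hw).
    destruct (Hstepx n) as [[Hx | Hx] _]; lra. }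
  { intros n. pose proof (Hpos w (S n) Hw). pose proof (Hhalf w n).
    destruct (Hstepx n) as [[Hx | Hx] _]; lra. }
  destruct (nested_halves (fun n => snd (p n)) h) as [Y HY].
  { intros n. pose proof (Hpos h (S n) Hh).
    destruct (Hstepx n) as [_ [Hx | Hx]]; lra. }
  { intros n. pose proof (Hpos h (S n) Hh). pose proof (Hhalf h n).
    destruct (Hstepx n) as [_ [Hx | Hx]]; lra. }
  destruct (Hloc X Y) as (d & Hd & Hn).
  { specialize (HX 0%nat). simpl in HX. lra. }
  { specialize (HY 0%nat). simpl in HY. lra. }
  destruct (half_pow_small (w + h) d Hd) as [n Hsmall].
  destruct (Hinv n) as (I1 & I2 & I3 & I4 & I5).
  apply I5, Hn; auto.
  - eapply Rle_lt_trans; [| exact Hsmall]. unfold Rdiv.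
    apply Rmult_le_compat_r; [left; apply Rinv_0_lt_compat, pow_lt; lra | lra].
  - eapply Rle_lt_trans; [| exact Hsmall]. unfold Rdiv.
    apply Rmult_le_compat_r; [left; apply Rinv_0_lt_compat, pow_lt; lra | lra].
Qed.

(** Goursat: near a point [g] is affine up to an error [eps * distance], and an
    affine function has integral zero, so that the integral over the boundary
    of a small rectangle is at most [eps] times a constant times its area.  This
    bound is additive over the four quarters of a rectangle. *)
Lemma rect_int_holo (g : C -> C) (a b c d : R) :
  a <= b -> c <= d -> (forall w, in_rect a b c d w -> holo g w) ->
  rect_int g a b c d = 0%C.
Proof.
  intros Hab Hcd Hg.
  assert (Hgc : forall w, in_rect a b c d w -> Ccont g w)
    by (intros w Hw; now apply holo_cont, Hg).
  set (w := b - a). set (h := d - c).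
  set (K := 4 * (w + h) * (w + h)).
  assert (HK : 0 <= K) by (unfold K, w, h; nra).
  assert (Hall : forall eps, 0 < eps -> Cmod (rect_int g a b c d) <= eps * K).
  { intros eps Heps.
    set (Q := fun n x y =>
      Cmod (rect_int g x (x + w / 2 ^ n) y (y + h / 2 ^ n))
      <= eps * K / (2 ^ n * 2 ^ n)).
    assert (HQ : Q 0%nat a c).
    { apply (quartering Q a c w h); [unfold w; lra | unfold h; lra | |].
      - intros n x y Hx Hx' Hy Hy' Q1 Q2 Q3 Q4. unfold Q in *.
        assert (Hp : 0 < 2 ^ n) by (apply pow_lt; lra).
        set (xm := x + w / 2 ^ S n) in *. set (ym := y + h / 2 ^ S n) in *.
        replace (xm + w / 2 ^ S n) with (x + w / 2 ^ n) in *
          by (unfold xm; simpl; field; lra).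
        replace (ym + h / 2 ^ S n) with (y + h / 2 ^ n) in *
          by (unfold ym; simpl; field; lra).
        set (x' := x + w / 2 ^ n) in *. set (y' := y + h / 2 ^ n) in *.
        assert (Hxm : x <= xm <= x').
        { unfold xm, x'. assert (0 <= w / 2 ^ n).
          { apply Rmult_le_pos; [unfold w; lra | left; now apply Rinv_0_lt_compat]. }
          replace (w / 2 ^ S n) with (w / 2 ^ n / 2) by (simpl; field; lra). lra. }
        assert (Hym : y <= ym <= y').
        { unfold ym, y'. assert (0 <= h / 2 ^ n).
          { apply Rmult_le_pos; [unfold h; lra | left; now apply Rinv_0_lt_compat]. }
          replace (h / 2 ^ S n) with (h / 2 ^ n / 2) by (simpl; field; lra). lra. }
        assert (Hb : a + w = b) by (unfold w; ring).
        assert (Hd : c + h = d) by (unfold h; ring).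
        rewrite (rect_int_split_x g a b c d x xm x') by (assumption || lra).
        rewrite (rect_int_split_y g a b c d x xm y ym y') by (assumption || lra).
        rewrite (rect_int_split_y g a b c d xm x' y ym y') by (assumption || lra).
        set (r1 := rect_int g x xm y ym) in *.
        set (r2 := rect_int g xm x' y ym) in *.
        set (r3 := rect_int g x xm ym y') in *.
        set (r4 := rect_int g xm x' ym y') in *.
        pose proof (Cmod_triangle (r1 + r3) (r2 + r4)).
        pose proof (Cmod_triangle r1 r3). pose proof (Cmod_triangle r2 r4).
        replace (eps * K / (2 ^ n * 2 ^ n))
          with (4 * (eps * K / (2 ^ S n * 2 ^ S n))) by (simpl; field; lra).
        lra.
      - intros X Y HX HY.
        destruct (Hg (X, Y)) as (D & HD & HgD).
        { unfold in_rect, w, h in *. simpl. lra. }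
        destruct (HD eps Heps) as (del & Hdel & H1).
        exists (del / 2). split; [lra |].
        intros n x y Hx Hx' Hy Hy' HXx HYy Hwn Hhn. unfold Q.
        set (q := D (X, Y)). set (p := (g (X, Y) - q * (X, Y))%C).
        assert (Hp : 0 < 2 ^ n) by (apply pow_lt; lra).
        set (x' := x + w / 2 ^ n) in *. set (y' := y + h / 2 ^ n) in *.
        assert (Hb : a + w = b) by (unfold w; ring).
        assert (Hd : c + h = d) by (unfold h; ring).
        rewrite (rect_int_sub_affine g p q);
          [| lra | lra | intros v [Hv1 Hv2]; apply Hgc; split; lra].
        eapply Rle_trans.
        + apply rect_int_bound with (M := eps * ((w + h) / 2 ^ n)).
          rewrite Rmin_left, Rmax_right, Rmin_left, Rmax_right by lra.
          intros v [Hv1 Hv2]. split.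
          * apply Ccont_plus; [apply Hgc; split; lra |].
            apply (Ccont_ext_loc (fun u => - (1) * (p + q * u))%C _ v 1 Rlt_0_1).
            { intros u _. ring. }
            repeat first [apply Ccont_plus | apply Ccont_mult
                  | apply Ccont_const | apply Ccont_id].
          * rewrite (HgD v). unfold p.
            match goal with |- Cmod ?e <= _ =>
              replace e with ((D v - q) * (v - (X, Y)))%C by ring end.
            rewrite Cmod_mult.
            assert (Hdist : Cmod (v - (X, Y)) <= (w + h) / 2 ^ n).
            { eapply Rle_trans; [apply Cmod_le_sum |].
              rewrite Re_sub, Im_sub. simpl.
              assert (Rabs (Re v - X) <= w / 2 ^ n)
                by (apply Rabs_le; unfold x' in *; lra).
              assert (Rabs (Im v - Y) <= h / 2 ^ n)
                by (apply Rabs_le; unfold y' in *; lra).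
              unfold Rdiv in *. lra. }
            apply Rmult_le_compat; [apply Cmod_ge_0 | apply Cmod_ge_0 | | exact Hdist].
            left. apply H1. unfold Rdiv in *. lra.
        + rewrite !Rabs_pos_eq by lra. right. unfold K, x', y'. field. lra. }
    unfold Q in HQ. simpl in HQ. unfold w, h in HQ.
    replace (a + (b - a) / 1) with b in HQ by field.
    replace (c + (d - c) / 1) with d in HQ by field.
    fold w h in HQ. lra. }
  apply Cmod_eq_0, Rle_antisym; [| apply Cmod_ge_0].
  apply le_epsilon. intros e He.
  specialize (Hall (e / (K + 1))).
  assert (e / (K + 1) * K <= e).
  { apply Rmult_le_reg_r with (K + 1); [lra |].
    replace (e / (K + 1) * K * (K + 1)) with (e * K) by (field; lra). nra. }
  assert (0 < e / (K + 1)) by (apply Rdiv_lt_0_compat; lra).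
  specialize (Hall ltac:(assumption)). lra.
Qed.

Lemma rect_int_degenerate_x (g : C -> C) (a c d : R) :
  rect_int g a a c d = 0%C.
Proof.
  unfold rect_int, CInt. rewrite !RInt_point. unfold zero; simpl.
  apply injective_projections; simpl; ring.
Qed.

Lemma rect_int_degenerate_y (g : C -> C) (a b c : R) :
  rect_int g a b c c = 0%C.
Proof.
  unfold rect_int, CInt. rewrite !RInt_point. unfold zero; simpl.
  apply injective_projections; simpl; ring.
Qed.

(** At an exceptional point continuity is enough: a rectangle with a corner at
    [p] is cut into a small rectangle at [p], over which the integral tends to
    zero with its size, and two rectangles that do not contain [p]. *)
Lemma rect_int_holo_except (g : C -> C) (p : C) (a b c d : R) :
  a <= b -> c <= d ->
  (forall w, in_rect a b c d w -> Ccont g w /\ (w <> p -> holo g w)) ->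
  rect_int g a b c d = 0%C.
Proof.
  intros Hab Hcd Hg.
  destruct (excluded_middle_informative (in_rect a b c d p)) as [Hp | Hp].
  2: { apply rect_int_holo; [exact Hab | exact Hcd |]. intros w Hw.
       apply (Hg w Hw). intros ->. contradiction. }
  assert (Hgc : forall w, in_rect a b c d w -> Ccont g w)
    by (intros w Hw; now apply Hg).
  assert (Hswap : forall x x' y y', a <= x <= b -> a <= x' <= b ->
            c <= y <= d -> c <= y' <= d ->
            (forall w, in_rect (Rmin x x') (Rmax x x') (Rmin y y') (Rmax y y') w ->
               w <> p) ->
            rect_int g x x' y y' = 0%C).
  { assert (Hord : forall x x' y y', x <= x' -> a <= x <= b -> a <= x' <= b ->
            c <= y <= d -> c <= y' <= d ->
            (forall w, in_rect (Rmin x x') (Rmax x x') (Rmin y y') (Rmax y y') w ->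
               w <> p) ->
            rect_int g x x' y y' = 0%C).
    { intros x x' y y' Hxx Hx Hx' Hy Hy' Hw.
      rewrite (Rmin_left x x'), (Rmax_right x x') in Hw by exact Hxx.
      destruct (Rle_dec y y') as [Hyy | Hyy].
      - rewrite (Rmin_left y y'), (Rmax_right y y') in Hw by exact Hyy.
        apply rect_int_holo; [exact Hxx | exact Hyy |].
        intros w Hin. apply Hg; [unfold in_rect in *; lra | now apply Hw].
      - rewrite (Rmin_right y y'), (Rmax_left y y') in Hw by lra.
        pose proof (rect_int_split_y g a b c d x x' y y' y Hgc Hx Hx' Hy Hy' Hy) as Hs.
        rewrite rect_int_degenerate_y in Hs.
        rewrite (rect_int_holo g x x' y' y) in Hs;
          [now rewrite Cplus_0_r in Hs | exact Hxx | lra |].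
        intros w Hin. apply Hg; [unfold in_rect in *; lra | now apply Hw]. }
    intros x x' y y' Hx Hx' Hy Hy' Hw.
    destruct (Rle_dec x x') as [Hxx | Hxx]; [now apply Hord |].
    pose proof (rect_int_split_x g a b c d x x' x y y' Hgc Hx Hx' Hx Hy Hy') as Hs.
    rewrite rect_int_degenerate_x in Hs.
    rewrite (Hord x' x y y') in Hs; [now rewrite Cplus_0_r in Hs | lra | assumption
      | assumption | assumption | assumption |].
    intros w Hin. apply Hw. now rewrite Rmin_comm, Rmax_comm. }
  destruct p as [p1 p2]. destruct Hp as [Hp1 Hp2]. simpl in Hp1, Hp2.
  assert (Hcorner : forall x y, a <= x <= b -> c <= y <= d ->
            rect_int g p1 x p2 y = 0%C).
  { intros x y Hx Hy.
    destruct (Req_dec x p1) as [-> | Hxp]; [apply rect_int_degenerate_x |].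
    destruct (Req_dec y p2) as [-> | Hyp]; [apply rect_int_degenerate_y |].
    destruct (Ccont_bounded g (p1, p2)) as (del & Hdel & HM).
    { apply Hgc. split; simpl; lra. }
    set (M := Cmod (g (p1, p2)) + 1) in *.
    set (s := Rabs (x - p1) + Rabs (y - p2)).
    assert (Hs : 0 < s).
    { unfold s. pose proof (Rabs_pos_lt (x - p1) ltac:(lra)).
      pose proof (Rabs_pos (y - p2)). lra. }
    assert (HMp : 0 < M) by (unfold M; pose proof (Cmod_ge_0 (g (p1, p2))); lra).
    assert (Heta : forall eta, 0 < eta -> eta <= 1 -> eta * s < del ->
              Cmod (rect_int g p1 x p2 y) <= 4 * M * (eta * s)).
    { intros eta He He1 Hed.
      set (x' := p1 + eta * (x - p1)). set (y' := p2 + eta * (y - p2)).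
      assert (Hx' : a <= x' <= b).
      { assert (x' = (1 - eta) * p1 + eta * x) by (unfold x'; ring).
        split; nra. }
      assert (Hy' : c <= y' <= d).
      { assert (y' = (1 - eta) * p2 + eta * y) by (unfold y'; ring).
        split; nra. }
      rewrite (rect_int_split_x g a b c d p1 x' x) by assumption.
      rewrite (rect_int_split_y g a b c d p1 x' p2 y' y) by assumption.
      rewrite (Hswap x' x p2 y), (Hswap p1 x' y' y), !Cplus_0_r; try assumption.
      - replace (eta * s) with (Rabs (x' - p1) + Rabs (y' - p2)).
        2: { unfold x', y', s. replace (p1 + eta * (x - p1) - p1)
               with (eta * (x - p1)) by ring.
             replace (p2 + eta * (y - p2) - p2) with (eta * (y - p2)) by ring.
             rewrite !Rabs_mult, (Rabs_pos_eq eta) by lra. ring. }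
        apply rect_int_bound. intros w [Hw1 Hw2].
        pose proof (between a b p1 x' _ Hp1 Hx' Hw1).
        pose proof (between c d p2 y' _ Hp2 Hy' Hw2).
        split; [apply Hgc; now split |]. apply HM.
        eapply Rle_lt_trans; [| exact Hed].
        eapply Rle_trans; [apply Cmod_le_sum |].
        rewrite Re_sub, Im_sub. simpl. unfold s.
        rewrite Rmult_plus_distr_l.
        rewrite <- (Rabs_pos_eq eta) by lra. rewrite <- !Rabs_mult.
        assert (Hseg : forall u v t, Rmin u v <= t <= Rmax u v ->
                  Rabs (t - u) <= Rabs (v - u)).
        { intros u v t. unfold Rmin, Rmax. destruct (Rle_dec u v); intros Ht.
          - rewrite !Rabs_pos_eq by lra. lra.
          - rewrite !Rabs_left1 by lra. lra. }
        apply Rplus_le_compat.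
        + eapply Rle_trans; [apply (Hseg _ _ _ Hw1) |]. right. f_equal.
          unfold x'. ring.
        + eapply Rle_trans; [apply (Hseg _ _ _ Hw2) |]. right. f_equal.
          unfold y'. ring.
      - intros [w1 w2] [Hw1 Hw2] Heq. injection Heq as -> ->. simpl in *.
        assert (p2 < y \/ y < p2) as [Hlt | Hlt] by lra.
        + assert (p2 < y') by (unfold y'; nra). assert (y' <= y) by (unfold y'; nra).
          rewrite Rmin_left in Hw2 by lra. lra.
        + assert (y' < p2) by (unfold y'; nra). assert (y <= y') by (unfold y'; nra).
          rewrite Rmax_left in Hw2 by lra. lra.
      - intros [w1 w2] [Hw1 Hw2] Heq. injection Heq as -> ->. simpl in *.
        assert (p1 < x \/ x < p1) as [Hlt | Hlt] by lra.
        + assert (p1 < x') by (unfold x'; nra). assert (x' <= x) by (unfold x'; nra).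
          rewrite Rmin_left in Hw1 by lra. lra.
        + assert (x' < p1) by (unfold x'; nra). assert (x <= x') by (unfold x'; nra).
          rewrite Rmax_left in Hw1 by lra. lra. }
    apply Cmod_eq_0, Rle_antisym; [| apply Cmod_ge_0].
    apply le_epsilon. intros e He. rewrite Rplus_0_l.
    set (m := Rmin s (Rmin (del / 2) (e / (4 * M)))).
    assert (Hm : 0 < m).
    { assert (0 < e / (4 * M)) by (apply Rdiv_lt_0_compat; lra).
      repeat apply Rmin_glb_lt; lra. }
    pose proof (Rmin_l s (Rmin (del / 2) (e / (4 * M)))).
    pose proof (Rmin_r s (Rmin (del / 2) (e / (4 * M)))).
    pose proof (Rmin_l (del / 2) (e / (4 * M))).
    pose proof (Rmin_r (del / 2) (e / (4 * M))).
    fold m in H, H0.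
    assert (Hms : m / s * s = m) by (field; lra).
    eapply Rle_trans; [apply (Heta (m / s)) |].
    - now apply Rdiv_lt_0_compat.
    - apply Rmult_le_reg_r with s; lra.
    - lra.
    - rewrite Hms. apply Rle_trans with (4 * M * (e / (4 * M))); [| right; field; lra].
      apply Rmult_le_compat_l; lra. }
  rewrite (rect_int_split_x g a b c d a p1 b) by (assumption || lra).
  assert (Hsx : forall y y', c <= y <= d -> c <= y' <= d ->
            rect_int g a p1 y y' = (- rect_int g p1 a y y')%C).
  { intros y y' Hy Hy'.
    pose proof (rect_int_split_x g a b c d a p1 a y y' Hgc
                  ltac:(lra) Hp1 ltac:(lra) Hy Hy') as Hs.
    rewrite rect_int_degenerate_x in Hs.
    replace (rect_int g a p1 y y')
      with ((rect_int g a p1 y y' + rect_int g p1 a y y') - rect_int g p1 a y y')%C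
      by ring.
    rewrite <- Hs. ring. }
  rewrite Hsx by lra.
  assert (Hfull : forall x, a <= x <= b -> rect_int g p1 x c d = 0%C).
  { intros x Hx.
    pose proof (rect_int_split_y g a b c d p1 x p2 c d Hgc
                  Hp1 Hx Hp2 ltac:(lra) ltac:(lra)) as Hs.
    rewrite !Hcorner in Hs by lra. rewrite Cplus_0_l in Hs. now symmetry. }
  rewrite !Hfull by lra. ring.
Qed.
(** * Taylor expansion of holomorphic functions *)

Definition cexp (w : C) : C := (exp (Re w) * cos (Im w), exp (Re w) * sin (Im w)).

Lemma cexp_plus (v w : C) : cexp (v + w) = (cexp v * cexp w)%C.
Proof.
  unfold cexp. rewrite re_plus, im_plus, exp_plus, cos_plus, sin_plus.
  unfold Cmult; simpl. f_equal; ring.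
Qed.

Lemma Cmod_cexp (w : C) : Cmod (cexp w) = exp (Re w).
Proof.
  pose proof (Cmod2_alt (cexp w)) as H2. pose proof (Cmod_ge_0 (cexp w)).
  pose proof (exp_pos (Re w)). pose proof (sin2_cos2 (Im w)) as Hsc.
  unfold Rsqr in Hsc.
  change (Re (cexp w)) with (exp (Re w) * cos (Im w)) in H2.
  change (Im (cexp w)) with (exp (Re w) * sin (Im w)) in H2.
  replace ((exp (Re w) * cos (Im w)) ^ 2 + (exp (Re w) * sin (Im w)) ^ 2)
    with (exp (Re w) ^ 2 * (sin (Im w) * sin (Im w) + cos (Im w) * cos (Im w)))
    in H2 by ring.
  rewrite Hsc in H2. nra.
Qed.

Lemma cexp_neq_0 (w : C) : cexp w <> 0%C.
Proof. apply Cmod_gt_0. rewrite Cmod_cexp. apply exp_pos. Qed.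

Lemma derivable_pt_lim_0_small (f : R -> R) (l : R) :
  derivable_pt_lim f 0 l ->
  forall e, 0 < e -> exists d, 0 < d /\
    forall h, Rabs h < d -> Rabs (f h - f 0 - l * h) <= e * Rabs h.
Proof.
  intros Hf e He. destruct (Hf e He) as [[d Hd] H1].
  exists d. split; [exact Hd |]. intros h Hh.
  destruct (Req_dec h 0) as [-> | Hn].
  - rewrite Rabs_R0. replace (f 0 - f 0 - l * 0) with 0 by ring.
    rewrite Rabs_R0. lra.
  - specialize (H1 h Hn Hh). rewrite Rplus_0_l in H1.
    replace (f h - f 0 - l * h) with (((f h - f 0) / h - l) * h) by (field; exact Hn).
    rewrite Rabs_mult. apply Rmult_le_compat_r; [apply Rabs_pos | lra].
Qed.

Lemma holo_cexp_0 : holo cexp 0%C.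
Proof.
  apply holo_slope with (RtoC 1). intros e He.
  assert (He8 : 0 < Rmin (e / 8) 1) by (apply Rmin_glb_lt; lra).
  set (e' := Rmin (e / 8) 1) in *.
  assert (He' : e' <= e / 8) by apply Rmin_l. assert (He1 : e' <= 1) by apply Rmin_r.
  assert (Hcos : derivable_pt_lim cos 0 0)
    by (replace 0 with (- sin 0) at 2 by (rewrite sin_0; ring);
        apply derivable_pt_lim_cos).
  assert (Hsin : derivable_pt_lim sin 0 1)
    by (replace 1 with (cos 0) by apply cos_0; apply derivable_pt_lim_sin).
  assert (Hexp : derivable_pt_lim exp 0 1)
    by (replace 1 with (exp 0) by apply exp_0; apply derivable_pt_lim_exp).
  destruct (derivable_pt_lim_0_small _ _ Hexp e' He8) as (d1 & Hd1 & H1).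
  destruct (derivable_pt_lim_0_small _ _ Hcos e' He8) as (d2 & Hd2 & H2).
  destruct (derivable_pt_lim_0_small _ _ Hsin e' He8) as (d3 & Hd3 & H3).
  exists (Rmin (Rmin d1 d2) (Rmin d3 (e' / 2))).
  split; [repeat apply Rmin_glb_lt; lra |]. intros w Hw.
  pose proof (Rmin_l (Rmin d1 d2) (Rmin d3 (e' / 2))).
  pose proof (Rmin_r (Rmin d1 d2) (Rmin d3 (e' / 2))).
  pose proof (Rmin_l d1 d2). pose proof (Rmin_r d1 d2).
  pose proof (Rmin_l d3 (e' / 2)). pose proof (Rmin_r d3 (e' / 2)).
  replace (w - 0)%C with w in * by ring.
  pose proof (re_le_Cmod w) as Hs. pose proof (im_le_Cmod w) as Ht.
  set (s := Re w) in *. set (t := Im w) in *. set (m := Cmod w) in *.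
  specialize (H1 s ltac:(lra)). specialize (H2 t ltac:(lra)).
  specialize (H3 t ltac:(lra)).
  rewrite exp_0 in H1. rewrite cos_0 in H2. rewrite sin_0 in H3.
  assert (Hr : Re (cexp w - cexp 0 - 1 * w) = exp s * cos t - 1 - s).
  { unfold cexp, Cminus, Cplus, Copp, Cmult, s, t, Re, Im; simpl.
    rewrite exp_0, cos_0. ring. }
  assert (Hi : Im (cexp w - cexp 0 - 1 * w) = exp s * sin t - t).
  { unfold cexp, Cminus, Cplus, Copp, Cmult, s, t, Re, Im; simpl.
    rewrite exp_0, sin_0. ring. }
  eapply Rle_trans; [apply Cmod_le_sum |]. rewrite Hr, Hi.
  assert (Hm : 0 <= m) by apply Cmod_ge_0.
  set (A := exp s - 1 - 1 * s) in *. set (B := cos t - 1 - 0 * t) in *.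
  set (D := sin t - 0 - 1 * t) in *.
  assert (HA : Rabs A <= e' * m) by nra.
  assert (HB : Rabs B <= e' * m) by nra.
  assert (HD : Rabs D <= e' * m) by nra.
  assert (HA1 : Rabs A <= Rabs s) by (pose proof (Rabs_pos s); nra).
  assert (Hes : Rabs (exp s - 1) <= e').
  { replace (exp s - 1) with (A + s) by (unfold A; ring).
    pose proof (Rabs_triang A s). lra. }
  assert (Hes2 : Rabs (exp s) <= 2).
  { replace (exp s) with (exp s - 1 + 1) by ring.
    pose proof (Rabs_triang (exp s - 1) 1). rewrite Rabs_R1 in *. lra. }
  replace (exp s * cos t - 1 - s) with (A + exp s * B) by (unfold A, B; ring).
  replace (exp s * sin t - t) with (exp s * D + (exp s - 1) * t)
    by (unfold D; ring).
  pose proof (Rabs_triang A (exp s * B)) as T1.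
  pose proof (Rabs_triang (exp s * D) ((exp s - 1) * t)) as T2.
  rewrite (Rabs_mult (exp s) B) in T1.
  rewrite (Rabs_mult (exp s) D), (Rabs_mult (exp s - 1) t) in T2.
  pose proof (Rabs_pos B). pose proof (Rabs_pos D). pose proof (Rabs_pos t).
  assert (Rabs (exp s) * Rabs B <= 2 * (e' * m)) by (apply Rmult_le_compat;
    [apply Rabs_pos | apply Rabs_pos | lra | lra]).
  assert (Rabs (exp s) * Rabs D <= 2 * (e' * m)) by (apply Rmult_le_compat;
    [apply Rabs_pos | apply Rabs_pos | lra | lra]).
  assert (Rabs (exp s - 1) * Rabs t <= e' * m) by (apply Rmult_le_compat;
    [apply Rabs_pos | apply Rabs_pos | lra | lra]).
  assert (e' * m <= e / 8 * m) by (apply Rmult_le_compat_r; assumption).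
  assert (0 <= e * m) by (apply Rmult_le_pos; lra). lra.
Qed.

Lemma holo_cexp (z : C) : holo cexp z.
Proof.
  apply (holo_ext_loc (fun w => cexp z * cexp (w - z))%C _ z 1 Rlt_0_1).
  - intros w _. rewrite <- cexp_plus. f_equal. ring.
  - apply holo_mult; [apply holo_const |].
    apply (holo_comp cexp (fun w => w - z)%C).
    + apply holo_minus; [apply holo_id | apply holo_const].
    + replace (z - z)%C with (RtoC 0) by ring. apply holo_cexp_0.
Qed.

(** In the coordinate [w] with [exp w] as the point of the plane, an annulus is
    a rectangle of height [2 PI] on which [G (exp w)] takes equal values on the
    horizontal sides.  The rectangle is cut at height zero: each of the halves
    contains at most one point that [exp] sends to [z]. *)
Lemma circle_int_const (G : C -> C) (z : C) (s t : R) :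
  s <= t ->
  (forall v, exp s <= Cmod v <= exp t -> Ccont G v /\ (v <> z -> holo G v)) ->
  CInt (fun y => G (cexp (s, y))) (- PI) PI = CInt (fun y => G (cexp (t, y))) (- PI) PI.
Proof.
  intros Hst HG. pose proof PI_RGT_0 as Hpi.
  set (g := fun w => G (cexp w)).
  assert (Hexp : forall x, s <= x <= t -> exp s <= exp x <= exp t).
  { assert (Hle : forall x y, x <= y -> exp x <= exp y).
    { intros x y [Hlt | ->]; [left; now apply exp_increasing | lra]. }
    intros x Hx. split; apply Hle; lra. }
  assert (Hg : forall w, s <= Re w <= t ->
            Ccont g w /\ (cexp w <> z -> holo g w)).
  { intros w Hw. destruct (HG (cexp w)) as [H1 H2].
    { rewrite Cmod_cexp. now apply Hexp. }
    split.
    - apply (Ccont_comp G cexp); [apply holo_cont, holo_cexp | exact H1].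
    - intros Hz. apply (holo_comp G cexp); [apply holo_cexp | now apply H2]. }
  assert (Hz : forall w, cexp w = z ->
            Re w = ln (Cmod z) /\ cos (Im w) = Re z / Cmod z).
  { intros w <-. rewrite Cmod_cexp, ln_exp. split; [reflexivity |].
    unfold cexp. simpl. field. apply Rgt_not_eq, exp_pos. }
  assert (Hup : rect_int g s t 0 PI = 0%C).
  { apply (rect_int_holo_except g (ln (Cmod z), acos (Re z / Cmod z)));
      [exact Hst | lra |].
    intros w [Hw1 Hw2]. destruct (Hg w Hw1) as [H1 H2]. split; [exact H1 |].
    intros Hne. apply H2. intros Heq. apply Hne. destruct (Hz w Heq) as [Hr Hc].
    rewrite <- Hr, <- Hc, acos_cos by exact Hw2. now destruct w. }
  assert (Hlow : rect_int g s t (- PI) 0 = 0%C).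
  { apply (rect_int_holo_except g (ln (Cmod z), - acos (Re z / Cmod z)));
      [exact Hst | lra |].
    intros w [Hw1 Hw2]. destruct (Hg w Hw1) as [H1 H2]. split; [exact H1 |].
    intros Hne. apply H2. intros Heq. apply Hne. destruct (Hz w Heq) as [Hr Hc].
    rewrite <- Hr, <- Hc, <- cos_neg, acos_cos by lra. rewrite Ropp_involutive.
    now destruct w. }
  assert (Hgc : forall w, in_rect s t (- PI) PI w -> Ccont g w)
    by (intros w [Hw _]; apply (Hg w Hw)).
  assert (Hfull : rect_int g s t (- PI) PI = 0%C).
  { rewrite (rect_int_split_y g s t (- PI) PI s t (- PI) 0 PI) by (assumption || lra).
    rewrite Hup, Hlow. ring. }
  unfold rect_int in Hfull.
  rewrite (CInt_ext (fun x => g (x, - PI)) (fun x => g (x, PI))) in Hfull.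
  2: { intros x. unfold g, cexp. cbn [Re Im fst snd].
       now rewrite cos_neg, sin_neg, sin_PI, Ropp_0. }
  unfold g in Hfull. symmetry. apply Cmod_sub_0.
  match goal with |- Cmod ?e = _ => replace e with (- Ci * (Ci * e))%C end.
  - match type of Hfull with ?X = _ =>
      match goal with |- Cmod (- Ci * ?Y) = _ => replace Y with X by ring end end.
    rewrite Hfull, Cmult_0_r. apply Cmod_0.
  - match goal with |- (- Ci * (Ci * ?e) = ?e)%C =>
      transitivity (- (Ci * Ci) * e)%C; [ring |];
      replace (Ci * Ci)%C with (- (1))%C; [ring |] end.
    unfold Ci, Cmult, Copp; simpl. f_equal; ring.
Qed.

(** Sums of the first [n] terms, where [n] may be 0, unlike [sum_n]. *)
Fixpoint csum (f : nat -> C) (n : nat) : C :=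
  match n with O => 0%C | S m => (csum f m + f m)%C end.

Lemma csum_ext (f g : nat -> C) (n : nat) :
  (forall k, f k = g k) -> csum f n = csum g n.
Proof. intros Hfg. induction n as [| n IH]; simpl; [| rewrite IH, Hfg]; reflexivity. Qed.

Lemma csum_plus (f g : nat -> C) (n : nat) :
  csum (fun k => f k + g k)%C n = (csum f n + csum g n)%C.
Proof. induction n as [| n IH]; simpl; [| rewrite IH]; ring. Qed.

Lemma csum_scal (c : C) (f : nat -> C) (n : nat) :
  csum (fun k => c * f k)%C n = (c * csum f n)%C.
Proof. induction n as [| n IH]; simpl; [| rewrite IH]; ring. Qed.

Lemma CInt_csum (f : nat -> R -> C) (a b : R) (n : nat) :
  (forall k, Cex_RInt (f k) a b) ->
  Cex_RInt (fun y => csum (fun k => f k y) n) a b /\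
  CInt (fun y => csum (fun k => f k y) n) a b = csum (fun k => CInt (f k) a b) n.
Proof.
  intros Hf. induction n as [| n [IH1 IH2]]; simpl.
  - split.
    + apply Pcont_ex_RInt. intros x _. split; apply continuous_const.
    + rewrite CInt_const. ring.
  - split.
    + now apply Cex_RInt_plus.
    + now rewrite CInt_plus, IH2.
Qed.

Lemma Cex_circle (G : C -> C) (t a b : R) :
  (forall v, Cmod v = exp t -> Ccont G v) ->
  Cex_RInt (fun y => G (cexp (t, y))) a b.
Proof.
  intros HG. apply Pcont_ex_RInt. intros y _.
  apply (Pcont_comp G (fun y => cexp (t, y))).
  - apply HG. now rewrite Cmod_cexp.
  - apply (Pcont_comp cexp (fun y => (t, y))); [apply holo_cont, holo_cexp |].
    apply Pcont_vertical.
Qed.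

Lemma circle_int_inv_pow (t : R) (n : nat) :
  CInt (fun y => (/ cexp (t, y)) ^ n)%C (- PI) PI
  = (match n with O => RtoC (2 * PI) | S _ => 0 end)%C.
Proof.
  destruct n as [| n].
  - simpl. rewrite CInt_const. rewrite Cmult_1_r. f_equal. ring.
  - set (f := fun v : C => ((/ v) ^ S n)%C).
    assert (Hf : forall v, 0 < Cmod v -> holo f v).
    { intros v Hv. apply holo_pow, holo_inv. now apply Cmod_gt_0. }
    assert (Hln : 0 < ln 2) by (rewrite <- ln_1; apply ln_increasing; lra).
    (* doubling the radius divides the integrand by a power of 2 *)
    assert (Hscale : CInt (fun y => f (cexp (t + ln 2, y)%R)) (- PI) PI
                     = (RtoC ((/ 2) ^ S n) * CInt (fun y => f (cexp (t, y))) (- PI) PI)%C).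
    { rewrite <- CInt_scal.
      - apply CInt_ext. intros y. unfold f.
        replace (cexp (t + ln 2, y)%R) with (RtoC 2 * cexp (t, y))%C.
        + rewrite RtoC_pow, RtoC_inv by lra. rewrite <- Cpow_mult_l. f_equal.
          pose proof (cexp_neq_0 (t, y)). field. auto.
        + unfold cexp, Cmult. cbn [Re Im fst snd RtoC].
          rewrite exp_plus, exp_ln by lra. f_equal; ring.
      - apply (Cex_circle f t). intros v Hv. apply holo_cont, Hf. rewrite Hv.
        apply exp_pos. }
    rewrite <- (circle_int_const f 0%C t (t + ln 2)) in Hscale; [| lra |].
    2: { intros v Hv. assert (holo f v).
         { apply Hf. pose proof (exp_pos t). lra. }
         split; [now apply holo_cont | trivial]. }
    set (J := CInt (fun y => f (cexp (t, y))) (- PI) PI) in *.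
    change (J = 0%C). apply Cmod_eq_0.
    pose proof (f_equal Cmod Hscale) as Hm. rewrite Cmod_mult, Cmod_R in Hm.
    assert (Hq : Rabs ((/ 2) ^ S n) <= / 2).
    { rewrite Rabs_pos_eq by (apply pow_le; lra). simpl.
      assert ((/ 2) ^ n <= 1 ^ n) by (apply pow_incr; lra).
      rewrite pow1 in *. lra. }
    pose proof (Cmod_ge_0 J). nra.
Qed.
Lemma Ccont_bounded_circle (G : C -> C) (t : R) :
  (forall v, Cmod v = exp t -> Ccont G v) ->
  exists M, 0 <= M /\ forall y, - PI <= y <= PI -> Cmod (G (cexp (t, y))) <= M.
Proof.
  intros HG.
  destruct (continuity_ab_maj (fun y => Cmod (G (cexp (t, y)))) (- PI) PI) as (y0 & H1 & _).
  - pose proof PI_RGT_0. lra.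
  - intros y _. apply continuity_pt_filterlim. apply continuous_eps. intros e He.
    assert (Hc : Pcont (fun y => G (cexp (t, y))) y).
    { apply (Pcont_comp G (fun y => cexp (t, y))).
      - apply HG. now rewrite Cmod_cexp.
      - apply (Pcont_comp cexp (fun y => (t, y))); [apply holo_cont, holo_cexp |].
        apply Pcont_vertical. }
    destruct (proj1 (Pcont_eps _ _) Hc e He) as (d & Hd & H2).
    exists d. split; [exact Hd |]. intros u Hu. eapply Rle_lt_trans; [| exact (H2 u Hu)].
    set (a := G (cexp (t, u))). set (b := G (cexp (t, y))).
    pose proof (Cmod_le_sub a b). pose proof (Cmod_le_sub b a) as H3.
    rewrite (Cmod_sub_sym b a) in H3. apply Rabs_le. lra.
  - exists (Cmod (G (cexp (t, y0)))). split; [apply Cmod_ge_0 | exact H1].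
Qed.

(** Cauchy's theorem for the slope [D] of [F] at [z]: the integral of
    [D v * v] over circles about the origin does not depend on the radius, and
    tends to zero with it. *)
Lemma circle_int_slope (D : C -> C) (z : C) (t : R) :
  (forall v, Cmod v <= exp t -> Ccont D v /\ (v <> z -> holo D v)) ->
  CInt (fun y => D (cexp (t, y)) * cexp (t, y))%C (- PI) PI = 0%C.
Proof.
  intros HD. set (G := fun v => (D v * v)%C).
  pose proof PI_RGT_0 as Hpi.
  assert (HG : forall v, Cmod v <= exp t -> Ccont G v /\ (v <> z -> holo G v)).
  { intros v Hv. destruct (HD v Hv) as [H1 H2]. split.
    - apply Ccont_mult; [exact H1 | apply Ccont_id].
    - intros Hz. apply holo_mult; [now apply H2 | apply holo_id]. }
  destruct (Ccont_bounded D 0%C) as (d & Hd & HM).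
  { apply HD. rewrite Cmod_0. left. apply exp_pos. }
  set (M := Cmod (D 0%C) + 1) in *.
  assert (HM0 : 0 < M) by (unfold M; pose proof (Cmod_ge_0 (D 0%C)); lra).
  apply Cmod_eq_0, Rle_antisym; [| apply Cmod_ge_0].
  apply le_epsilon. intros e He. rewrite Rplus_0_l.
  set (rho := Rmin (exp t) (Rmin (d / 2) (e / (4 * M * PI)))).
  assert (Hrho : 0 < rho).
  { repeat apply Rmin_glb_lt; [apply exp_pos | lra |].
    apply Rdiv_lt_0_compat; [lra |]. apply Rmult_lt_0_compat; lra. }
  pose proof (Rmin_l (exp t) (Rmin (d / 2) (e / (4 * M * PI)))) as B1.
  pose proof (Rmin_r (exp t) (Rmin (d / 2) (e / (4 * M * PI)))) as B2.
  pose proof (Rmin_l (d / 2) (e / (4 * M * PI))) as B3.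
  pose proof (Rmin_r (d / 2) (e / (4 * M * PI))) as B4.
  fold rho in B1, B2.
  change (Cmod (CInt (fun y => G (cexp (t, y))) (- PI) PI) <= e).
  rewrite <- (circle_int_const G z (ln rho) t).
  - apply Rle_trans with (2 * (M * rho) * Rabs (PI - - PI)).
    + apply CInt_bound.
      * apply Cex_circle. intros v Hv. apply HG. rewrite Hv, exp_ln by exact Hrho.
        exact B1.
      * intros y _. unfold G. rewrite Cmod_mult.
        assert (Hc : Cmod (cexp (ln rho, y)) = rho)
          by (rewrite Cmod_cexp; apply exp_ln, Hrho).
        rewrite Hc. apply Rmult_le_compat_r; [lra |]. apply HM.
        replace (cexp (ln rho, y) - 0)%C with (cexp (ln rho, y)) by ring.
        rewrite Hc. lra.
    + rewrite Rabs_pos_eq by lra.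
      apply Rle_trans with (2 * (M * (e / (4 * M * PI))) * (PI - - PI)).
      * apply Rmult_le_compat_r; [lra |]. apply Rmult_le_compat_l; [lra |].
        apply Rmult_le_compat_l; lra.
      * right. field. lra.
  - rewrite <- (ln_exp t). destruct B1 as [B1 | B1].
    + left. now apply ln_increasing.
    + right. now f_equal.
  - intros v Hv. apply HG. lra.
Qed.

Lemma csum_geometric (a z v q : C) (n : nat) :
  v <> 0%C -> a = (q * (v - z))%C ->
  csum (fun k => z ^ k * (a * (/ v) ^ k))%C n
  = (q * v + - z ^ n * ((/ v) ^ n * (q * v)))%C.
Proof.
  intros Hv ->. induction n as [| n IH]; cbn [csum Cpow]; [ring |].
  rewrite IH. set (p := ((/ v) ^ n)%C). set (s := (z ^ n)%C).
  transitivity (q * v - s * p * q * z * 1)%C; [ring |].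
  rewrite <- (Cinv_r v Hv). ring.
Qed.

Lemma csum_first (f : nat -> C) (n : nat) :
  (forall k, f (S k) = 0%C) -> csum f (S n) = f O.
Proof.
  intros Hf. induction n as [| n IH]; [simpl; ring |].
  change (csum f (S (S n))) with (csum f (S n) + f (S n))%C. rewrite IH, Hf. ring.
Qed.

(** Taylor's theorem.  The coefficients are the Fourier coefficients of [F] on a
    circle, of any radius; on a circle that encloses [z] the Cauchy kernel is
    expanded as a geometric series with remainder. *)
Lemma holo_taylor (F : C -> C) (r : R) :
  0 < r -> (forall z, Cmod z < r -> holo F z) ->
  exists c : nat -> C, forall z, Cmod z < r ->
    exists K q, 0 <= q < 1 /\
      forall n, Cmod (csum (fun k => c k * z ^ k)%C (S n) - F z) <= K * q ^ n.
Proof.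
  intros Hr HF. pose proof PI_RGT_0 as Hpi.
  set (Co := fun t n => CInt (fun y => F (cexp (t, y)) * (/ cexp (t, y)) ^ n)%C (- PI) PI).
  assert (Hpow : forall (v : C) (n : nat), v <> 0%C -> holo (fun v => (/ v) ^ n)%C v).
  { intros v n Hv. apply (holo_pow Cinv). exact (holo_inv v Hv). }
  assert (Hco : forall n v, 0 < Cmod v < r -> holo (fun v => F v * (/ v) ^ n)%C v).
  { intros n v Hv. apply holo_mult; [apply HF; lra |].
    apply Hpow, Cmod_gt_0. lra. }
  assert (Hindep : forall t s n, t <= s -> exp s < r -> Co t n = Co s n).
  { intros t s n Hts Hs. apply (circle_int_const (fun v => F v * (/ v) ^ n)%C 0%C t s Hts).
    intros v Hv. assert (holo (fun v => F v * (/ v) ^ n)%C v).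
    { apply Hco. pose proof (exp_pos t). lra. }
    split; [now apply holo_cont | trivial]. }
  set (t0 := ln (r / 2)).
  exists (fun n => / RtoC (2 * PI) * Co t0 n)%C. intros z Hz.
  set (rho := (Rmax (Cmod z) (r / 2) + r) / 2).
  pose proof (Rmax_l (Cmod z) (r / 2)) as M1. pose proof (Rmax_r (Cmod z) (r / 2)) as M2.
  assert (M3 : Rmax (Cmod z) (r / 2) < r) by (apply Rmax_lub_lt; lra).
  set (t := ln rho).
  assert (Hrho : exp t = rho) by (apply exp_ln; unfold rho; lra).
  assert (Hrr : rho < r) by (unfold rho; lra).
  assert (Hzr : Cmod z < rho) by (unfold rho; lra).
  assert (Hrho0 : 0 < rho) by (unfold rho; lra).
  assert (Hco_t : forall n, Co t0 n = Co t n).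
  { intros n. apply Hindep; [| lra]. unfold t0, t. left. apply ln_increasing; [lra |].
    unfold rho. lra. }
  destruct (HF z Hz) as (D & HDz & HD).
  assert (HDh : forall v, Cmod v < r -> v <> z -> holo D v).
  { intros v Hv Hvz.
    apply (holo_ext_loc (fun w => (F w - F z) * / (w - z))%C D v (Cmod (v - z))).
    - now apply Cmod_sub_pos.
    - intros w Hw. rewrite (HD w). field. apply Csub_neq_0. intros ->.
      rewrite Cmod_sub_sym in Hw. lra.
    - apply holo_mult.
      + apply holo_minus; [now apply HF | apply holo_const].
      + apply (holo_comp Cinv (fun w => w - z)%C).
        * apply holo_minus; [apply holo_id | apply holo_const].
        * now apply holo_inv, Csub_neq_0. }
  assert (HDc : forall v, Cmod v < r -> Ccont D v).
  { intros v Hv. destruct (excluded_middle_informative (v = z)) as [-> | n];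
      [exact HDz | now apply holo_cont, HDh]. }
  assert (Hslope : CInt (fun y => D (cexp (t, y)) * cexp (t, y))%C (- PI) PI = 0%C).
  { apply circle_int_slope with z. intros v Hv. split; [apply HDc; lra |].
    apply HDh. lra. }
  assert (Hrem : forall n v, Cmod v = exp t ->
            Ccont (fun v => (/ v) ^ n * (D v * v))%C v).
  { intros n v Hv. apply Ccont_mult.
    - apply holo_cont, Hpow, Cmod_gt_0. rewrite Hv. apply exp_pos.
    - apply Ccont_mult; [apply HDc; lra | apply Ccont_id]. }
  destruct (Ccont_bounded_circle (fun v => D v * v)%C t) as (M & HM0 & HM).
  { intros v Hv. apply Ccont_mult; [apply HDc; lra | apply Ccont_id]. }
  exists (2 * M * (Cmod z / rho)), (Cmod z / rho).
  assert (Hq : 0 <= Cmod z / rho < 1).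
  { split.
    - apply Rmult_le_pos; [apply Cmod_ge_0 | left; now apply Rinv_0_lt_compat].
    - apply Rmult_lt_reg_r with rho; [exact Hrho0 |]. field_simplify; lra. }
  split; [exact Hq |]. intros n.
  set (E := CInt (fun y => (/ cexp (t, y)) ^ S n * (D (cexp (t, y)) * cexp (t, y)))%C
              (- PI) PI).
  assert (HexF : forall k, Cex_RInt (fun y => F (cexp (t, y)) * (/ cexp (t, y)) ^ k)%C
                             (- PI) PI).
  { intros k. apply (Cex_circle (fun v => F v * (/ v) ^ k)%C). intros v Hv.
    apply holo_cont, Hco. pose proof (exp_pos t). lra. }
  assert (Hex1 : forall k, Cex_RInt (fun y => (/ cexp (t, y)) ^ k)%C (- PI) PI).
  { intros k. apply (Cex_circle (fun v => (/ v) ^ k)%C). intros v Hv.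
    apply holo_cont, Hpow, Cmod_gt_0. rewrite Hv. apply exp_pos. }
  assert (HexE : Cex_RInt (fun y => (/ cexp (t, y)) ^ S n
                             * (D (cexp (t, y)) * cexp (t, y)))%C (- PI) PI).
  { apply (Cex_circle (fun v => (/ v) ^ S n * (D v * v))%C). intros v Hv. now apply Hrem. }
  assert (Hmain : (csum (fun k => z ^ k * Co t k)%C (S n) - RtoC (2 * PI) * F z
                   = - z ^ S n * E)%C).
  { set (h := fun k y => (z ^ k * ((F (cexp (t, y)) - F z) * (/ cexp (t, y)) ^ k))%C).
    assert (Hh : forall k, Cex_RInt (h k) (- PI) PI /\ CInt (h k) (- PI) PI
      = (z ^ k * Co t k + (- F z) * (z ^ k * CInt (fun y => (/ cexp (t, y)) ^ k) (- PI) PI))%C).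
    { intros k.
      assert (Heq : h k = fun y => (z ^ k * (F (cexp (t, y)) * (/ cexp (t, y)) ^ k)
                                    + (- F z) * (z ^ k * (/ cexp (t, y)) ^ k))%C)
        by (apply functional_extensionality; intros y; unfold h; ring).
      rewrite Heq. split.
      - apply Cex_RInt_plus; [now apply Cex_RInt_scal |].
        now apply Cex_RInt_scal, Cex_RInt_scal.
      - rewrite CInt_plus, !CInt_scal; auto using Cex_RInt_scal. }
    assert (Hsum : CInt (fun y => csum (fun k => h k y) (S n)) (- PI) PI
                   = (- z ^ S n * E)%C).
    { rewrite (CInt_ext _ (fun y => D (cexp (t, y)) * cexp (t, y) + - z ^ S n *
        ((/ cexp (t, y)) ^ S n * (D (cexp (t, y)) * cexp (t, y))))%C).
      - rewrite CInt_plus, CInt_scal, Hslope.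
        + unfold E. ring.
        + exact HexE.
        + apply (Cex_circle (fun v => D v * v)%C). intros v Hv.
          apply Ccont_mult; [apply HDc; lra | apply Ccont_id].
        + now apply Cex_RInt_scal.
      - intros y. unfold h. apply csum_geometric; [apply cexp_neq_0 |].
        rewrite (HD (cexp (t, y))). ring. }
    rewrite <- Hsum.
    rewrite (proj2 (CInt_csum h (- PI) PI (S n) (fun k => proj1 (Hh k)))).
    rewrite (csum_ext _ _ (S n) (fun k => proj2 (Hh k))).
    rewrite csum_plus, (csum_scal (- F z)%C).
    rewrite (csum_first (fun k => z ^ k * CInt (fun y => (/ cexp (t, y)) ^ k) (- PI) PI)%C).
    - rewrite circle_int_inv_pow. simpl. ring.
    - intros k. rewrite circle_int_inv_pow. ring. }
  assert (H2pi : RtoC (2 * PI) <> 0%C) by (intros H0; injection H0; lra).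
  replace (csum (fun k => / RtoC (2 * PI) * Co t0 k * z ^ k)%C (S n) - F z)%C
    with (/ RtoC (2 * PI) * (- z ^ S n * E))%C.
  2: { rewrite <- Hmain.
       rewrite (csum_ext (fun k => / RtoC (2 * PI) * Co t0 k * z ^ k)%C
                  (fun k => / RtoC (2 * PI) * (z ^ k * Co t k))%C)
         by (intros k; rewrite Hco_t; ring).
       rewrite csum_scal. field. exact H2pi. }
  assert (HE : Cmod E <= 2 * (/ rho ^ S n * M) * (2 * PI)).
  { replace (2 * PI) with (Rabs (PI - - PI)) by (rewrite Rabs_pos_eq; lra).
    apply CInt_bound; [exact HexE |]. intros y Hy.
    rewrite Rmin_left, Rmax_right in Hy by lra.
    rewrite Cmod_mult, Cmod_pow, Cmod_inv, Cmod_cexp by apply cexp_neq_0.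
    cbn [Re fst]. rewrite Hrho, pow_inv.
    apply Rmult_le_compat_l; [| now apply HM].
    left. now apply Rinv_0_lt_compat, pow_lt. }
  rewrite !Cmod_mult, Cmod_inv, Cmod_R, Cmod_opp, Cmod_pow by exact H2pi.
  rewrite (Rabs_pos_eq (2 * PI)) by lra.
  apply Rle_trans with (/ (2 * PI) * (Cmod z ^ S n * (2 * (/ rho ^ S n * M) * (2 * PI)))).
  - apply Rmult_le_compat_l; [left; apply Rinv_0_lt_compat; lra |].
    apply Rmult_le_compat_l; [apply pow_le, Cmod_ge_0 | exact HE].
  - right. unfold Rdiv. rewrite Rpow_mult_distr, pow_inv. simpl.
    assert (rho ^ n <> 0) by (apply pow_nonzero; lra). field. repeat split; lra.
Qed.

Lemma geometric_bound_is_series (a : nat -> R) (l K q : R) :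
  0 <= q < 1 -> (forall n, Rabs (sum_n a n - l) <= K * q ^ n) -> is_series a l.
Proof.
  intros Hq Hb.
  assert (H0 : is_lim_seq (fun n => sum_n a n - l) 0).
  { apply is_lim_seq_abs_0.
    apply (is_lim_seq_le_le (fun _ => 0) _ (fun n => K * q ^ n)).
    - intros n. split; [apply Rabs_pos | apply Hb].
    - apply is_lim_seq_const.
    - replace (Finite 0) with (Rbar_mult K 0) by (simpl; f_equal; ring).
      apply is_lim_seq_scal_l, is_lim_seq_geom. rewrite Rabs_pos_eq; lra. }
  change (is_lim_seq (sum_n a) l).
  apply is_lim_seq_ext with (fun n => (sum_n a n - l) + l);
    [intros n; generalize (sum_n a n : R); intros s; simpl in s; ring |].
  replace (Finite l) with (Finite (0 + l)) by (f_equal; ring).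
  apply is_lim_seq_plus'; [exact H0 | apply is_lim_seq_const].
Qed.

Lemma is_series_const_0 : is_series (fun _ => 0) 0.
Proof.
  apply geometric_bound_is_series with 0 0; [lra |].
  intros n. rewrite sum_n_const, Rmult_0_r, Rminus_0_r, Rabs_R0, Rmult_0_l. lra.
Qed.

Lemma Re_csum (f : nat -> C) (n : nat) :
  Re (csum f (S n)) = sum_n (fun k => Re (f k)) n.
Proof.
  induction n as [| n IH].
  - rewrite sum_O. apply Rplus_0_l.
  - rewrite sum_Sn, <- IH. reflexivity.
Qed.

Lemma Im_csum (f : nat -> C) (n : nat) :
  Im (csum f (S n)) = sum_n (fun k => Im (f k)) n.
Proof.
  induction n as [| n IH].
  - rewrite sum_O. apply Rplus_0_l.
  - rewrite sum_Sn, <- IH. reflexivity.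
Qed.

Lemma is_pseries_0_coef (a : nat -> R) (r : R) :
  0 < r -> (forall x, Rabs x < r -> is_series (fun n => a n * x ^ n) 0) ->
  forall n, a n = 0.
Proof.
  intros Hr Ha n.
  assert (Hp : forall x, Rabs x < r -> PSeries a x = 0).
  { intros x Hx. apply is_series_unique, Ha, Hx. }
  apply (PSeries_ext_recip a (fun _ => 0) n).
  - apply Rbar_lt_le_trans with (Finite (r / 2)); [simpl; lra |].
    apply (proj1 (CV_radius_bounded a)).
    assert (Hs : ex_series (fun k => a k * (r / 2) ^ k))
      by (exists 0; apply Ha; rewrite Rabs_pos_eq; lra).
    apply ex_series_lim_0 in Hs.
    destruct (filterlim_bounded _ (ex_intro _ 0 Hs)) as [M HM].
    exists M. exact HM.
  - rewrite CV_radius_const_0. exact I.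
  - exists (mkposreal r Hr). intros x Hx. rewrite Hp.
    + symmetry. apply PSeries_const_0.
    + replace x with (x - 0) by ring. exact Hx.
Qed.

(** The Taylor coefficients are determined by the values on the real diameter. *)
Lemma holo_identity (F : C -> C) (r : R) :
  0 < r -> (forall z, Cmod z < r -> holo F z) ->
  (forall x, Rabs x < r -> F (RtoC x) = 0%C) ->
  forall z, Cmod z < r -> F z = 0%C.
Proof.
  intros Hr HF H0. destruct (holo_taylor F r Hr HF) as [c Hc].
  assert (Hre : forall k x, (c k * RtoC x ^ k)%C = (Re (c k) * x ^ k, Im (c k) * x ^ k)).
  { intros k x. rewrite <- RtoC_pow. unfold Cmult, Re, Im. simpl. f_equal; ring. }
  assert (Hr0 : forall n, Re (c n) = 0).
  { apply is_pseries_0_coef with r; [exact Hr |]. intros x Hx.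
    destruct (Hc (RtoC x)) as (K & q & Hq & Hb); [now rewrite Cmod_R |].
    apply geometric_bound_is_series with K q; [exact Hq |]. intros n.
    eapply Rle_trans; [| apply (Hb n)]. rewrite H0 by exact Hx.
    eapply Rle_trans; [| apply re_le_Cmod]. right. f_equal.
    rewrite Re_sub, Re_csum. f_equal. apply sum_n_ext. intros k. now rewrite Hre. }
  assert (Hi0 : forall n, Im (c n) = 0).
  { apply is_pseries_0_coef with r; [exact Hr |]. intros x Hx.
    destruct (Hc (RtoC x)) as (K & q & Hq & Hb); [now rewrite Cmod_R |].
    apply geometric_bound_is_series with K q; [exact Hq |]. intros n.
    eapply Rle_trans; [| apply (Hb n)]. rewrite H0 by exact Hx.
    eapply Rle_trans; [| apply im_le_Cmod]. right. f_equal.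
    rewrite Im_sub, Im_csum. f_equal. apply sum_n_ext. intros k. now rewrite Hre. }
  intros z Hz. destruct (Hc z Hz) as (K & q & Hq & Hb).
  assert (Hs : forall n, csum (fun k => c k * z ^ k)%C n = 0%C).
  { induction n as [| n IH]; [reflexivity |]. simpl. rewrite IH.
    replace (c n) with (RtoC 0); [ring |].
    apply injective_projections; [symmetry; apply Hr0 | symmetry; apply Hi0]. }
  assert (Hl : is_series (fun _ => 0) (Cmod (F z))).
  { apply geometric_bound_is_series with K q; [exact Hq |]. intros n.
    replace (sum_n (fun _ => 0) n) with 0.
    - rewrite Rminus_0_l, Rabs_Ropp, Rabs_pos_eq by apply Cmod_ge_0.
      specialize (Hb n). rewrite Hs in Hb. replace (0 - F z)%C with (- F z)%C in Hb by ring.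
      now rewrite Cmod_opp in Hb.
    - rewrite sum_n_const. ring. }
  apply Cmod_eq_0. apply is_series_unique in Hl. rewrite <- Hl.
  apply is_series_unique, is_series_const_0.
Qed.
(** * Quaternions and their slices *)

(** Variables of type [H_Ring] are also expanded into coordinates. *)
Ltac H_ring_all :=
  intros;
  repeat match goal with
  | x : ?T |- _ => unify T H; destruct x as [[[? ?] ?] ?]
  end;
  H_ring.

Definition Hre (h : H) : R := fst (fst (fst h)).

Definition emb (J : H) (z : C) : H := slice J (Re z) (Im z).

(** For an imaginary unit [J] this map is complex linear from the quaternions,
    with complex numbers acting on the left through [L J], to the complex
    numbers: it is the coordinate on [L J] in the splitting of the quaternions
    along [L J].  Composed with right multiplications, which are complex linear
    too, it gives enough scalar coordinates to reduce statements on
    quaternionic functions on [L J] to complex functions. *)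
Definition lam (J h : H) : C := (Hre h, (- Hre (J * h)%H)%R).

Lemma imag_unit_coords (J : H) :
  imag_unit J -> exists b c d, J = (0, b, c, d) /\ b ^ 2 + c ^ 2 + d ^ 2 = 1.
Proof.
  destruct J as [[[a b] c] d]. unfold imag_unit. intros HJ.
  cbv -[Rplus Rmult Rminus Ropp IZR pow] in HJ. injection HJ as H1 H2 H3 H4.
  exists b, c, d.
  assert (Ha : a = 0).
  { destruct (Req_dec a 0) as [| Hn]; [assumption | exfalso].
    assert (b = 0) by (apply (Rmult_eq_reg_l (2 * a)); lra).
    assert (c = 0) by (apply (Rmult_eq_reg_l (2 * a)); lra).
    assert (d = 0) by (apply (Rmult_eq_reg_l (2 * a)); lra).
    subst. nra. }
  subst a. split; [reflexivity |]. nra.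
Qed.

Lemma emb_mult (J : H) (v w : C) :
  imag_unit J -> emb J (v * w)%C = (emb J v * emb J w)%H.
Proof.
  intros HJ. destruct (imag_unit_coords J HJ) as (b & c & d & -> & Hn).
  destruct v as [v1 v2], w as [w1 w2].
  assert (Hb : b ^ 2 = 1 - c ^ 2 - d ^ 2) by lra.
  cbv -[Rplus Rmult Rminus Ropp IZR].
  repeat apply (f_equal2 pair); try ring.
  ring_simplify. rewrite Hb. ring.
Qed.

Lemma emb_plus (J : H) (v w : C) : emb J (v + w)%C = (emb J v + emb J w)%H.
Proof. destruct v, w. H_ring. Qed.

Lemma emb_minus (J : H) (v w : C) : emb J (v - w)%C = (emb J v - emb J w)%H.
Proof. destruct v, w. H_ring. Qed.

Lemma emb_RtoC (J : H) (x : R) : emb J (RtoC x) = RtoH x.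
Proof. H_ring. Qed.

Lemma lam_mult (J : H) (z : C) (h : H) :
  imag_unit J -> lam J (emb J z * h)%H = (z * lam J h)%C.
Proof.
  intros HJ. destruct (imag_unit_coords J HJ) as (b & c & d & -> & Hn).
  destruct z as [x y]. destruct h as [[[h0 h1] h2] h3].
  assert (Hb : b ^ 2 = 1 - c ^ 2 - d ^ 2) by lra.
  cbv -[Rplus Rmult Rminus Ropp IZR].
  apply (f_equal2 pair); [ring |].
  ring_simplify. rewrite Hb. ring.
Qed.

Lemma lam_minus (J g h : H) : lam J (g - h)%H = (lam J g - lam J h)%C.
Proof. H_ring. Qed.

Lemma Hmult_minus_l (p q h : H) : ((p - q) * h = p * h - q * h)%H.
Proof. H_ring. Qed.

Lemma Hmult_minus_r (p q h : H) : (p * (q - h) = p * q - p * h)%H.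
Proof. H_ring. Qed.

Lemma Hminus_eq_0 (p q : H) : (p - q = 0)%H -> p = q.
Proof.
  intros H0. replace p with ((p - q) + q)%H by H_ring. rewrite H0. H_ring.
Qed.

Lemma Hnormsq_pos (h : H) : 0 <= Hnormsq h.
Proof. destruct h as [[[a b] c] d]. simpl. nra. Qed.

Lemma Hnormsq_eq_0 (h : H) : Hnormsq h = 0 -> h = 0%H.
Proof.
  destruct h as [[[a b] c] d]. simpl. intros H0.
  assert (a = 0 /\ b = 0 /\ c = 0 /\ d = 0) as (-> & -> & -> & ->)
    by (repeat split; nra).
  reflexivity.
Qed.

(** Right multiplication by its conjugate turns [h] into its squared norm, so
    that the coordinates [lam J (h * u)] separate quaternions. *)
Lemma lam_separates (J p q : H) :
  (forall u, lam J (p * u)%H = lam J (q * u)%H) -> p = q.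
Proof.
  intros Hu. apply Hminus_eq_0, Hnormsq_eq_0.
  assert (H0 : lam J ((p - q) * Hconj (p - q))%H = 0%C).
  { rewrite Hmult_minus_l, lam_minus, Hu. ring. }
  apply (f_equal Re) in H0. etransitivity; [| exact H0]. clear H0 Hu.
  generalize (p - q)%H. intros h. destruct h as [[[a b] c] d].
  cbv -[Rplus Rmult Rminus Ropp IZR]. ring.
Qed.

Lemma Hnormsq_mult (p q : H) : Hnormsq (p * q)%H = Hnormsq p * Hnormsq q.
Proof.
  destruct p as [[[? ?] ?] ?], q as [[[? ?] ?] ?].
  cbv -[Rplus Rmult Rminus Ropp IZR]. ring.
Qed.

Lemma Hnorm_mult (p q : H) : Hnorm (p * q)%H = Hnorm p * Hnorm q.
Proof. unfold Hnorm. rewrite Hnormsq_mult. apply sqrt_mult; apply Hnormsq_pos. Qed.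

Lemma Hnorm_norm (h : H) : Hnorm h = @norm R_AbsRing H_NormedModule h.
Proof.
  destruct h as [[[a b] c] d]. unfold Hnorm.
  change (@norm R_AbsRing H_NormedModule (a, b, c, d))
    with (sqrt ((sqrt ((sqrt (Rabs a ^ 2 + Rabs b ^ 2)) ^ 2 + Rabs c ^ 2)) ^ 2
                + Rabs d ^ 2)).
  rewrite !pow2_abs.
  assert (Hs : forall x, 0 <= x -> sqrt x ^ 2 = x)
    by (intros x Hx; simpl; rewrite Rmult_1_r; now apply sqrt_sqrt).
  pose proof (pow2_ge_0 a). pose proof (pow2_ge_0 b). pose proof (pow2_ge_0 c).
  rewrite !Hs; [reflexivity | lra |]. rewrite Hs; lra.
Qed.

Lemma Hnorm_pos (h : H) : 0 <= Hnorm h.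
Proof. apply sqrt_pos. Qed.

Lemma Hnorm_triangle (p q : H) : Hnorm (p + q)%H <= Hnorm p + Hnorm q.
Proof. rewrite !Hnorm_norm. apply (@norm_triangle R_AbsRing H_NormedModule). Qed.

Lemma Hnorm_minus_sym (p q : H) : Hnorm (p - q)%H = Hnorm (q - p)%H.
Proof.
  unfold Hnorm. f_equal. destruct p as [[[? ?] ?] ?], q as [[[? ?] ?] ?].
  cbv -[Rplus Rmult Rminus Ropp IZR]. ring.
Qed.

Lemma Hnorm_eq_0 (h : H) : Hnorm h = 0 -> h = 0%H.
Proof.
  intros H0. apply Hnormsq_eq_0. apply sqrt_eq_0; [apply Hnormsq_pos | exact H0].
Qed.

Lemma Hnorm_RtoH (x : R) : Hnorm (RtoH x) = Rabs x.
Proof.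
  unfold Hnorm, RtoH, Hnormsq.
  replace (x ^ 2 + 0 ^ 2 + 0 ^ 2 + 0 ^ 2) with (Rsqr x) by (unfold Rsqr; ring).
  apply sqrt_Rsqr_abs.
Qed.

Lemma Hnorm_emb (J : H) (z : C) : imag_unit J -> Hnorm (emb J z) = Cmod z.
Proof.
  intros HJ. destruct (imag_unit_coords J HJ) as (b & c & d & -> & Hn).
  destruct z as [x y]. unfold Hnorm, Cmod. f_equal.
  transitivity (x ^ 2 + (b ^ 2 + c ^ 2 + d ^ 2) * y ^ 2).
  - cbv -[Rplus Rmult Rminus Ropp IZR]. ring.
  - rewrite Hn. simpl. ring.
Qed.

Lemma Hnorm_imag_unit (J : H) : imag_unit J -> Hnorm J = 1.
Proof.
  intros HJ. replace J with (emb J Ci) by H_ring.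
  rewrite Hnorm_emb by exact HJ. apply Cmod_Ci.
Qed.

Lemma Hnorm_one : Hnorm 1%H = 1.
Proof. change (Hnorm (RtoH 1) = 1). rewrite Hnorm_RtoH. apply Rabs_R1. Qed.

Lemma Hnorm_pow (q : H) (n : nat) : Hnorm (q ^ n)%H = Hnorm q ^ n.
Proof.
  induction n as [| n IH]; simpl; [apply Hnorm_one |].
  now rewrite Hnorm_mult, IH.
Qed.

Lemma Rabs_le_sqrt (x y : R) : x ^ 2 <= y -> Rabs x <= sqrt y.
Proof.
  intros Hx. rewrite <- sqrt_Rsqr_abs. apply sqrt_le_1_alt. unfold Rsqr. nra.
Qed.

Lemma Rabs_coords_le_Hnorm (a b c d : R) :
  Rabs a <= Hnorm (a, b, c, d) /\ Rabs b <= Hnorm (a, b, c, d) /\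
  Rabs c <= Hnorm (a, b, c, d) /\ Rabs d <= Hnorm (a, b, c, d).
Proof. repeat split; apply Rabs_le_sqrt; simpl; nra. Qed.

Lemma Hnorm_le_coords (a b c d : R) :
  Hnorm (a, b, c, d) <= Rabs a + Rabs b + Rabs c + Rabs d.
Proof.
  replace (a, b, c, d)
    with (RtoH a + RtoH b * (0, 1, 0, 0)%R + RtoH c * (0, 0, 1, 0)%R
          + RtoH d * (0, 0, 0, 1)%R)%H by H_ring.
  assert (H1 : forall i, Hnormsq i = 1 -> Hnorm i = 1)
    by (intros i Hi; unfold Hnorm; rewrite Hi; apply sqrt_1).
  repeat (eapply Rle_trans; [apply Hnorm_triangle | apply Rplus_le_compat]);
    rewrite ?Hnorm_mult, ?Hnorm_RtoH; try lra;
    rewrite H1; try (simpl; ring); lra.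
Qed.

Lemma Rabs_Hre_le (h : H) : Rabs (Hre h) <= Hnorm h.
Proof. destruct h as [[[a b] c] d]. apply Rabs_coords_le_Hnorm. Qed.

Lemma Cmod_lam_le (J h : H) : imag_unit J -> Cmod (lam J h) <= 2 * Hnorm h.
Proof.
  intros HJ. eapply Rle_trans; [apply Cmod_le_sum |]. unfold lam; cbn [Re Im fst snd].
  rewrite Rabs_Ropp. pose proof (Rabs_Hre_le h). pose proof (Rabs_Hre_le (J * h)%H) as H1.
  rewrite Hnorm_mult, (Hnorm_imag_unit J HJ) in H1. lra.
Qed.

Lemma Hinv_mult (x : H) : x <> 0%H -> (Hinv x * x = 1)%H.
Proof.
  intros Hx. assert (Hn : Hnormsq x <> 0) by (intros H0; apply Hx, Hnormsq_eq_0, H0).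
  unfold Hinv.
  transitivity (RtoH (/ Hnormsq x) * RtoH (Hnormsq x))%H.
  - generalize (/ Hnormsq x). intros y. H_ring.
  - transitivity (RtoH (/ Hnormsq x * Hnormsq x)).
    + generalize (/ Hnormsq x) (Hnormsq x). intros. H_ring.
    + rewrite Rinv_l by exact Hn. reflexivity.
Qed.

Lemma Hnorm_Hinv (x : H) : x <> 0%H -> Hnorm (Hinv x) = / Hnorm x.
Proof.
  intros Hx. pose proof (f_equal Hnorm (Hinv_mult x Hx)) as H1.
  rewrite Hnorm_mult, Hnorm_one in H1.
  apply Rmult_eq_reg_r with (Hnorm x).
  - rewrite H1. symmetry. apply Rinv_l. intros H0. apply Hx, Hnorm_eq_0, H0.
  - intros H0. apply Hx, Hnorm_eq_0, H0.
Qed.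

Lemma exists_slice (q : H) : exists J z, imag_unit J /\ q = emb J z.
Proof.
  destruct q as [[[a b] c] d]. set (n := b ^ 2 + c ^ 2 + d ^ 2).
  assert (Hn : 0 <= n) by (unfold n; nra).
  destruct (Req_dec n 0) as [H0 | H0].
  - exists (0, 1, 0, 0), (a, 0). split.
    + unfold imag_unit. H_ring.
    + assert (b = 0 /\ c = 0 /\ d = 0) as (-> & -> & ->)
        by (unfold n in H0; repeat split; nra).
      H_ring.
  - pose proof (sqrt_lt_R0 n ltac:(lra)) as Hs.
    set (s := sqrt n) in *. assert (Hss : s * s = n) by now apply sqrt_sqrt.
    exists (0, b / s, c / s, d / s), (a, s). split.
    + assert (Hu : (b / s) ^ 2 + (c / s) ^ 2 + (d / s) ^ 2 = 1).
      { transitivity (n / (s * s)); [unfold n; field; lra |].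
        rewrite <- Hss. field. lra. }
      unfold imag_unit. set (x := b / s) in *. set (y := c / s) in *.
      set (t := d / s) in *.
      cbv -[Rplus Rmult Rminus Ropp IZR x y t].
      repeat apply (f_equal2 pair); [| ring | ring | ring]. nra.
    + cbv -[Rplus Rmult Rminus Ropp Rdiv IZR s].
      repeat apply (f_equal2 pair); field; lra.
Qed.

(** * Series of quaternions *)

Lemma sum_n_fst {U V : NormedModule R_AbsRing} (u : nat -> U * V) (n : nat) :
  fst (@sum_n (prod_NormedModule R_AbsRing U V) u n) = sum_n (fun k => fst (u k)) n.
Proof.
  induction n as [| n IH]; [now rewrite !sum_O |]. rewrite !sum_Sn, <- IH. reflexivity.
Qed.

Lemma sum_n_snd {U V : NormedModule R_AbsRing} (u : nat -> U * V) (n : nat) :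
  snd (@sum_n (prod_NormedModule R_AbsRing U V) u n) = sum_n (fun k => snd (u k)) n.
Proof.
  induction n as [| n IH]; [now rewrite !sum_O |]. rewrite !sum_Sn, <- IH. reflexivity.
Qed.

Lemma is_series_pair {U V : NormedModule R_AbsRing} (u : nat -> U * V) (l : U * V) :
  @is_series R_AbsRing (prod_NormedModule R_AbsRing U V) u l <->
  is_series (fun n => fst (u n)) (fst l) /\ is_series (fun n => snd (u n)) (snd l).
Proof.
  split.
  - intros Hu. split.
    + apply filterlim_ext with (fun n => fst (@sum_n (prod_NormedModule R_AbsRing U V) u n)).
      * intros n. apply sum_n_fst.
      * eapply filterlim_comp; [exact Hu |]. apply (@continuous_fst U V).
    + apply filterlim_ext with (fun n => snd (@sum_n (prod_NormedModule R_AbsRing U V) u n)).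
      * intros n. apply sum_n_snd.
      * eapply filterlim_comp; [exact Hu |]. apply (@continuous_snd U V).
  - intros [H1 H2].
    apply (filterlim_locally (U := prod_UniformSpace U V)). intros eps.
    pose proof (proj1 (filterlim_locally _ _) H1 eps) as E1.
    pose proof (proj1 (filterlim_locally _ _) H2 eps) as E2.
    generalize (filter_and _ _ E1 E2). apply filter_imp. intros n [B1 B2].
    split.
    + rewrite <- sum_n_fst in B1. exact B1.
    + rewrite <- sum_n_snd in B2. exact B2.
Qed.

Definition Hc1 (h : H) : R := snd (fst (fst h)).
Definition Hc2 (h : H) : R := snd (fst h).
Definition Hc3 (h : H) : R := snd h.

Lemma is_Hseries_coords (u : nat -> H) (l : H) :
  is_Hseries u l <->
  is_series (fun n => Hre (u n)) (Hre l) /\ is_series (fun n => Hc1 (u n)) (Hc1 l) /\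
  is_series (fun n => Hc2 (u n)) (Hc2 l) /\ is_series (fun n => Hc3 (u n)) (Hc3 l).
Proof.
  unfold is_Hseries, H_NormedModule.
  rewrite is_series_pair. rewrite is_series_pair. rewrite is_series_pair.
  unfold Hre, Hc1, Hc2, Hc3. tauto.
Qed.

Lemma is_Hseries_HSeries (u : nat -> H) (l : H) : is_Hseries u l -> HSeries u = l.
Proof.
  intros Hu. apply is_Hseries_coords in Hu as (H0 & H1 & H2 & H3).
  apply is_series_unique in H0, H1, H2, H3.
  unfold HSeries. unfold Hre, Hc1, Hc2, Hc3 in *. rewrite H0, H1, H2, H3.
  now destruct l as [[[? ?] ?] ?].
Qed.

Lemma is_Hseries_unique (u : nat -> H) (l l' : H) :
  is_Hseries u l -> is_Hseries u l' -> l = l'.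
Proof.
  intros H1 H2. apply is_Hseries_HSeries in H1, H2. congruence.
Qed.

Lemma is_Hseries_plus (u v : nat -> H) (l m : H) :
  is_Hseries u l -> is_Hseries v m -> is_Hseries (fun n => u n + v n)%H (l + m)%H.
Proof. apply (@is_series_plus R_AbsRing H_NormedModule). Qed.

Lemma is_Hseries_minus (u v : nat -> H) (l m : H) :
  is_Hseries u l -> is_Hseries v m -> is_Hseries (fun n => u n - v n)%H (l - m)%H.
Proof. apply (@is_series_minus R_AbsRing H_NormedModule). Qed.

Lemma is_series_ext_eq (a b : nat -> R) (l m : R) :
  is_series a l -> (forall n, a n = b n) -> l = m -> is_series b m.
Proof. intros Ha Hab <-. now apply is_series_ext with a. Qed.

Lemma is_series_lincomb (a b c d : nat -> R) (la lb lc ld x y z t : R) :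
  is_series a la -> is_series b lb -> is_series c lc -> is_series d ld ->
  is_series (fun n => x * a n + y * b n + z * c n + t * d n)
            (x * la + y * lb + z * lc + t * ld).
Proof.
  intros Ha Hb Hc Hd.
  pose proof (is_series_scal x a la Ha) as Ha'.
  pose proof (is_series_scal y b lb Hb) as Hb'.
  pose proof (is_series_scal z c lc Hc) as Hc'.
  pose proof (is_series_scal t d ld Hd) as Hd'.
  exact (is_series_plus _ _ _ _ (is_series_plus _ _ _ _
          (is_series_plus _ _ _ _ Ha' Hb') Hc') Hd').
Qed.

Lemma is_Hseries_mult_l (q : H) (u : nat -> H) (l : H) :
  is_Hseries u l -> is_Hseries (fun n => q * u n)%H (q * l)%H.
Proof.
  intros Hu. apply is_Hseries_coords in Hu as (H0 & H1 & H2 & H3).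
  destruct q as [[[a b] c] d]. destruct l as [[[l0 l1] l2] l3].
  apply is_Hseries_coords. repeat split.
  - eapply is_series_ext_eq; [apply (is_series_lincomb _ _ _ _ _ _ _ _ a (- b) (- c) (- d)
      H0 H1 H2 H3) | |].
    + intros n. cbv beta. generalize (u n). intros [[[u0 u1] u2] u3].
      cbv -[Rplus Rmult Rminus Ropp IZR]. ring.
    + cbv -[Rplus Rmult Rminus Ropp IZR]. ring.
  - eapply is_series_ext_eq; [apply (is_series_lincomb _ _ _ _ _ _ _ _ b a (- d) c
      H0 H1 H2 H3) | |].
    + intros n. cbv beta. generalize (u n). intros [[[u0 u1] u2] u3].
      cbv -[Rplus Rmult Rminus Ropp IZR]. ring.
    + cbv -[Rplus Rmult Rminus Ropp IZR]. ring.
  - eapply is_series_ext_eq; [apply (is_series_lincomb _ _ _ _ _ _ _ _ c d a (- b)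
      H0 H1 H2 H3) | |].
    + intros n. cbv beta. generalize (u n). intros [[[u0 u1] u2] u3].
      cbv -[Rplus Rmult Rminus Ropp IZR]. ring.
    + cbv -[Rplus Rmult Rminus Ropp IZR]. ring.
  - eapply is_series_ext_eq; [apply (is_series_lincomb _ _ _ _ _ _ _ _ d (- c) b a
      H0 H1 H2 H3) | |].
    + intros n. cbv beta. generalize (u n). intros [[[u0 u1] u2] u3].
      cbv -[Rplus Rmult Rminus Ropp IZR]. ring.
    + cbv -[Rplus Rmult Rminus Ropp IZR]. ring.
Qed.

Lemma is_Hseries_ext (u v : nat -> H) (l : H) :
  (forall n, u n = v n) -> is_Hseries u l -> is_Hseries v l.
Proof. apply (@is_series_ext R_AbsRing H_NormedModule). Qed.

(** The constant 4 comes from bounding each of the coordinates. *)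
Lemma is_Hseries_norm_le (u : nat -> H) (l : H) (B : nat -> R) (S : R) :
  is_Hseries u l -> (forall n, Hnorm (u n) <= B n) -> is_series B S ->
  Hnorm l <= 4 * S.
Proof.
  intros Hu HB HS. apply is_Hseries_coords in Hu as (H0 & H1 & H2 & H3).
  assert (Hc : forall (pr : H -> R), (forall h, Rabs (pr h) <= Hnorm h) ->
            is_series (fun n => pr (u n)) (pr l) -> Rabs (pr l) <= S).
  { intros pr Hpr Hs. rewrite <- (is_series_unique _ _ Hs), <- (is_series_unique _ _ HS).
    assert (Hle : forall n, 0 <= Rabs (pr (u n)) <= B n).
    { intros n. split; [apply Rabs_pos |]. eapply Rle_trans; [apply Hpr | apply HB]. }
    eapply Rle_trans; [apply Series_Rabs |].
    - apply (ex_series_le (V := R_CompleteNormedModule)) with B; [| now exists S]. intros n.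
      change (Rabs (Rabs (pr (u n))) <= B n). rewrite Rabs_Rabsolu. apply Hle.
    - apply Series_le; [exact Hle | now exists S]. }
  pose proof (Hc Hre Rabs_Hre_le H0).
  assert (Rabs (Hc1 l) <= S /\ Rabs (Hc2 l) <= S /\ Rabs (Hc3 l) <= S) as (? & ? & ?).
  { repeat split; apply Hc; try assumption;
      intros [[[a b] c] d]; apply Rabs_coords_le_Hnorm. }
  destruct l as [[[a b] c] d]. pose proof (Hnorm_le_coords a b c d).
  unfold Hre, Hc1, Hc2, Hc3 in *. cbn [fst snd] in *. lra.
Qed.

Lemma is_Hseries_of_norm (u : nat -> H) (B : nat -> R) :
  (forall n, Hnorm (u n) <= B n) -> ex_series B -> is_Hseries u (HSeries u).
Proof.
  intros HB Hex.
  assert (Hc : forall (pr : H -> R), (forall h, Rabs (pr h) <= Hnorm h) ->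
            is_series (fun n => pr (u n)) (Series (fun n => pr (u n)))).
  { intros pr Hpr. apply Series_correct. apply (ex_series_le (V := R_CompleteNormedModule)) with B; [| exact Hex].
    intros n. eapply Rle_trans; [apply Hpr | apply HB]. }
  apply is_Hseries_coords.
  repeat split; apply Hc; intros [[[a b] c] d]; apply Rabs_coords_le_Hnorm.
Qed.

Lemma is_series_scal_geom (K q : R) :
  0 <= q < 1 -> is_series (fun n => K * q ^ n) (K * / (1 - q)).
Proof.
  intros Hq. apply (is_series_scal K (fun n => q ^ n)). apply is_series_geom.
  rewrite Rabs_pos_eq; lra.
Qed.

Lemma is_series_bounded (a : nat -> R) (l : R) :
  is_series a l -> exists M, forall n, Rabs (a n) <= M.
Proof.
  intros Ha. pose proof (ex_series_lim_0 a (ex_intro _ l Ha)) as H0.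
  destruct (filterlim_bounded (V := R_NormedModule) a (ex_intro _ 0 H0)) as [M HM].
  exists M. exact HM.
Qed.

Lemma is_Hseries_bounded (u : nat -> H) (l : H) :
  is_Hseries u l -> exists M, forall n, Hnorm (u n) <= M.
Proof.
  intros Hu. apply is_Hseries_coords in Hu as (H0 & H1 & H2 & H3).
  apply is_series_bounded in H0 as [M0 B0], H1 as [M1 B1], H2 as [M2 B2], H3 as [M3 B3].
  exists (M0 + M1 + M2 + M3). intros n.
  specialize (B0 n). specialize (B1 n). specialize (B2 n). specialize (B3 n).
  destruct (u n) as [[[a b] c] d]. pose proof (Hnorm_le_coords a b c d).
  unfold Hre, Hc1, Hc2, Hc3 in *. cbn [fst snd] in *. lra.
Qed.
(** * Power series are regular *)

Lemma INR_pow_bound (x : R) (n : nat) : 0 <= x < 1 -> INR (S n) * x ^ n <= / (1 - x).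
Proof.
  intros Hx.
  assert (Hs : INR (S n) * x ^ n * (1 - x) <= 1 - x ^ S n).
  { induction n as [| n IH].
    - simpl. lra.
    - rewrite S_INR. change (x ^ S n) with (x * x ^ n) in *.
      change (x ^ S (S n)) with (x * (x * x ^ n)).
      assert (0 <= x ^ n) by (apply pow_le; lra).
      assert (x * (INR (S n) * x ^ n * (1 - x)) <= x * (1 - x * x ^ n))
        by (apply Rmult_le_compat_l; lra).
      assert (x * x ^ n <= 1).
      { change (x ^ S n <= 1). rewrite <- (pow1 (S n)). apply pow_incr. lra. }
      nra. }
  assert (0 <= x ^ S n) by (apply pow_le; lra).
  apply Rmult_le_reg_r with (1 - x); [lra |]. rewrite Rinv_l; lra.
Qed.

(** Radius of convergence at least [r], as a bound on the coefficients. *)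
Definition rapid (r : R) (b : nat -> H) : Prop :=
  forall rho, 0 < rho < r -> exists M, forall n, Hnorm (b n) * rho ^ n <= M.

(** The two linear factors are absorbed by two increases of the radius. *)
Lemma rapid_weighted (r s : R) (b : nat -> H) :
  rapid r b -> 0 < s < r ->
  exists K q, 0 <= q < 1 /\ 0 <= K /\
    forall n, INR (S n) ^ 2 * s ^ n * Hnorm (b n) <= K * q ^ n.
Proof.
  intros Hb Hs. set (d := (r - s) / 4).
  set (r1 := s + d). set (r2 := s + 2 * d). set (r3 := s + 3 * d).
  assert (Hd : 0 < d) by (unfold d; lra).
  destruct (Hb r3) as [M HM]; [unfold r3, d; lra |].
  assert (HM0 : 0 <= M).
  { eapply Rle_trans; [| apply (HM O)]. simpl. rewrite Rmult_1_r. apply Hnorm_pos. }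
  assert (Hq : forall x y, 0 < x -> x < y -> 0 <= x / y < 1).
  { intros x y Hx Hy. split.
    - left. apply Rdiv_lt_0_compat; lra.
    - apply Rmult_lt_reg_r with y; [lra |]. unfold Rdiv.
      rewrite Rmult_assoc, Rinv_l; lra. }
  pose proof (Hq s r1 ltac:(lra) ltac:(unfold r1; lra)) as Q1.
  pose proof (Hq r1 r2 ltac:(unfold r1; lra) ltac:(unfold r1, r2; lra)) as Q2.
  pose proof (Hq r2 r3 ltac:(unfold r2; lra) ltac:(unfold r2, r3; lra)) as Q3.
  set (K1 := / (1 - s / r1)). set (K2 := / (1 - r1 / r2)).
  assert (HK1 : 0 < K1) by (apply Rinv_0_lt_compat; lra).
  assert (HK2 : 0 < K2) by (apply Rinv_0_lt_compat; lra).
  exists (K1 * K2 * M), (r2 / r3). split; [exact Q3 |].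
  split; [repeat apply Rmult_le_pos; lra |].
  intros n.
  pose proof (INR_pow_bound (s / r1) n Q1) as B1. fold K1 in B1.
  pose proof (INR_pow_bound (r1 / r2) n Q2) as B2. fold K2 in B2.
  assert (P1 : r1 ^ n <> 0) by (apply pow_nonzero; unfold r1; lra).
  assert (P2 : r2 ^ n <> 0) by (apply pow_nonzero; unfold r2; lra).
  assert (P3 : r3 ^ n <> 0) by (apply pow_nonzero; unfold r3; lra).
  replace (INR (S n) ^ 2 * s ^ n * Hnorm (b n))
    with ((INR (S n) * (s / r1) ^ n) * (INR (S n) * (r1 / r2) ^ n)
          * (Hnorm (b n) * r3 ^ n) * (r2 / r3) ^ n).
  2: { unfold Rdiv. rewrite !Rpow_mult_distr, !pow_inv. field. auto. }
  assert (N0 : 0 <= INR (S n)) by apply pos_INR.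
  assert (N1 : 0 <= (s / r1) ^ n) by (apply pow_le; lra).
  assert (N2 : 0 <= (r1 / r2) ^ n) by (apply pow_le; lra).
  apply Rmult_le_compat_r; [apply pow_le; lra |].
  apply Rmult_le_compat; [| | | apply HM].
  - repeat apply Rmult_le_pos; assumption.
  - apply Rmult_le_pos; [apply Hnorm_pos |]. apply pow_le. unfold r3. lra.
  - apply Rmult_le_compat; try assumption; now apply Rmult_le_pos.
Qed.

Definition Hpseries (b : nat -> H) (q : H) : H := HSeries (fun n => q ^ n * b n)%H.

Lemma rapid_is_Hseries (r : R) (b : nat -> H) (q : H) :
  rapid r b -> Hnorm q < r -> is_Hseries (fun n => q ^ n * b n)%H (Hpseries b q).
Proof.
  intros Hb Hq. set (s := (Rmax (Hnorm q) 0 + r) / 2).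
  pose proof (Rmax_l (Hnorm q) 0). pose proof (Rmax_r (Hnorm q) 0).
  pose proof (Hnorm_pos q).
  assert (Rmax (Hnorm q) 0 < r) by (apply Rmax_lub_lt; lra).
  destruct (rapid_weighted r s b Hb) as (K & x & Hx & HK & HB); [unfold s; lra |].
  apply is_Hseries_of_norm with (fun n => K * x ^ n).
  - intros n. rewrite Hnorm_mult, Hnorm_pow. eapply Rle_trans; [| apply HB].
    apply Rmult_le_compat_r; [apply Hnorm_pos |].
    assert (Hnorm q ^ n <= s ^ n) by (apply pow_incr; unfold s; lra).
    assert (0 <= s ^ n) by (apply pow_le; unfold s; lra).
    assert (1 <= INR (S n)) by (rewrite S_INR; pose proof (pos_INR n); lra).
    assert (1 * s ^ n <= INR (S n) ^ 2 * s ^ n) by (apply Rmult_le_compat_r; nra).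
    lra.
  - exists (K * / (1 - x)). now apply is_series_scal_geom.
Qed.

(** The differential at [q] of the [n]-th power. *)
Fixpoint dpow (q : H) (n : nat) (h : H) : H :=
  match n with O => 0 | S m => h * q ^ m + q * dpow q m h end%H.

Lemma dpow_plus (q : H) (n : nat) (g h : H) :
  dpow q n (g + h)%H = (dpow q n g + dpow q n h)%H.
Proof.
  induction n as [| n IH]; cbn [dpow]; [H_ring |]. rewrite IH.
  generalize (dpow q n g) (dpow q n h) (q ^ n)%H. H_ring_all.
Qed.

Lemma dpow_scal (q : H) (n : nat) (x : R) (h : H) :
  dpow q n (RtoH x * h)%H = (RtoH x * dpow q n h)%H.
Proof.
  induction n as [| n IH]; cbn [dpow]; [H_ring |]. rewrite IH.
  generalize (dpow q n h) (q ^ n)%H. H_ring_all.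
Qed.

Lemma dpow_commute (q J : H) (n : nat) :
  (q * J = J * q)%H -> dpow q n J = (J * dpow q n 1)%H.
Proof.
  intros Hc. induction n as [| n IH]; cbn [dpow]; [H_ring |]. rewrite IH.
  rewrite mult_distr_l, !(@mult_assoc H_Ring), Hc, mult_one_r. reflexivity.
Qed.

(** The powers of [s] on the left of this and the next two bounds avoid the
    exponents [n - 1] and [n - 2]. *)
Lemma Hnorm_dpow (q h : H) (s : R) (n : nat) :
  Hnorm q <= s -> Hnorm (dpow q n h) * s <= INR n * Hnorm h * s ^ n.
Proof.
  intros Hq. pose proof (Hnorm_pos q). pose proof (Hnorm_pos h).
  induction n as [| n IH]; cbn [dpow].
  - replace (Hnorm 0%H) with 0; [simpl; lra |].
    change (0 = Hnorm (RtoH 0)). rewrite Hnorm_RtoH, Rabs_R0. reflexivity.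
  - pose proof (Hnorm_triangle (h * q ^ n)%H (q * dpow q n h)%H) as Ht.
    rewrite !Hnorm_mult, Hnorm_pow in Ht. rewrite S_INR.
    assert (Hnorm q ^ n <= s ^ n) by (apply pow_incr; lra).
    assert (0 <= Hnorm (dpow q n h)) by apply Hnorm_pos.
    change (s ^ S n) with (s * s ^ n).
    assert (Hnorm h * Hnorm q ^ n * s <= Hnorm h * s ^ n * s)
      by (apply Rmult_le_compat_r; [lra |]; apply Rmult_le_compat_l; lra).
    assert (Hnorm q * (Hnorm (dpow q n h) * s) <= s * (INR n * Hnorm h * s ^ n)).
    { apply Rmult_le_compat; try lra. apply Rmult_le_pos; lra. }
    nra.
Qed.

Lemma Hnorm_pow_diff (q h : H) (s : R) (n : nat) :
  Hnorm q + Hnorm h <= s ->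
  Hnorm ((q + h) ^ n - q ^ n)%H * s <= INR n * Hnorm h * s ^ n.
Proof.
  intros Hq. pose proof (Hnorm_pos q). pose proof (Hnorm_pos h).
  pose proof (Hnorm_triangle q h).
  induction n as [| n IH].
  - replace ((q + h) ^ 0 - q ^ 0)%H with (RtoH 0) by H_ring.
    rewrite Hnorm_RtoH, Rabs_R0. simpl. lra.
  - replace ((q + h) ^ S n - q ^ S n)%H
      with ((q + h) * ((q + h) ^ n - q ^ n) + h * q ^ n)%H.
    2: { cbn [pow_n]. generalize ((q + h) ^ n)%H (q ^ n)%H. H_ring_all. }
    pose proof (Hnorm_triangle ((q + h) * ((q + h) ^ n - q ^ n)) (h * q ^ n))%H as Ht.
    rewrite !Hnorm_mult, Hnorm_pow in Ht. rewrite S_INR.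
    set (D := Hnorm ((q + h) ^ n - q ^ n)%H) in *.
    assert (0 <= D) by apply Hnorm_pos.
    assert (Hnorm q ^ n <= s ^ n) by (apply pow_incr; lra).
    change (s ^ S n) with (s * s ^ n).
    assert (Hnorm h * Hnorm q ^ n * s <= Hnorm h * s ^ n * s)
      by (apply Rmult_le_compat_r; [lra |]; apply Rmult_le_compat_l; lra).
    assert (Hnorm (q + h)%H * (D * s) <= s * (INR n * Hnorm h * s ^ n)).
    { apply Rmult_le_compat; try lra; [apply Hnorm_pos | apply Rmult_le_pos; lra]. }
    nra.
Qed.

Lemma Hnorm_pow_taylor (q h : H) (s : R) (n : nat) :
  Hnorm q + Hnorm h <= s ->
  Hnorm ((q + h) ^ n - q ^ n - dpow q n h)%H * s ^ 2
  <= INR n ^ 2 * Hnorm h ^ 2 * s ^ n.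
Proof.
  intros Hq. pose proof (Hnorm_pos q). pose proof (Hnorm_pos h).
  induction n as [| n IH].
  - replace ((q + h) ^ 0 - q ^ 0 - dpow q 0 h)%H with (RtoH 0) by H_ring.
    rewrite Hnorm_RtoH, Rabs_R0. simpl. lra.
  - replace ((q + h) ^ S n - q ^ S n - dpow q (S n) h)%H
      with (q * ((q + h) ^ n - q ^ n - dpow q n h) + h * ((q + h) ^ n - q ^ n))%H.
    2: { cbn [pow_n dpow]. generalize ((q + h) ^ n)%H (q ^ n)%H (dpow q n h).
         H_ring_all. }
    pose proof (Hnorm_pow_diff q h s n Hq) as Hdiff.
    pose proof (Hnorm_triangle (q * ((q + h) ^ n - q ^ n - dpow q n h))
                  (h * ((q + h) ^ n - q ^ n)))%H as Ht.
    rewrite !Hnorm_mult in Ht. rewrite S_INR.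
    set (D := Hnorm ((q + h) ^ n - q ^ n)%H) in *.
    set (E := Hnorm ((q + h) ^ n - q ^ n - dpow q n h)%H) in *.
    assert (0 <= D) by apply Hnorm_pos. assert (0 <= E) by apply Hnorm_pos.
    assert (0 <= s ^ n) by (apply pow_le; lra). pose proof (pos_INR n).
    change (s ^ S n) with (s * s ^ n).
    assert (Hnorm q * (E * s ^ 2) <= s * (INR n ^ 2 * Hnorm h ^ 2 * s ^ n)).
    { apply Rmult_le_compat; try lra. apply Rmult_le_pos; [lra | apply pow2_ge_0]. }
    assert (Hnorm h * s * (D * s) <= Hnorm h * s * (INR n * Hnorm h * s ^ n)).
    { apply Rmult_le_compat_l; [apply Rmult_le_pos; lra | exact Hdiff]. }
    assert (0 <= (INR n + 1) * (Hnorm h ^ 2 * (s * s ^ n))).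
    { repeat apply Rmult_le_pos; try lra; apply pow2_ge_0. }
    apply Rle_trans with (Hnorm q * (E * s ^ 2) + Hnorm h * s * (D * s)); [nra |].
    apply Rle_trans with (s * (INR n ^ 2 * Hnorm h ^ 2 * s ^ n)
                          + Hnorm h * s * (INR n * Hnorm h * s ^ n)); [lra |].
    assert (0 <= Hnorm h ^ 2 * (s * s ^ n)).
    { repeat apply Rmult_le_pos; try lra; apply pow2_ge_0. }
    nra.
Qed.

Lemma Hplus_minus (p q : H) : p = (q + (p - q))%H.
Proof. H_ring. Qed.

Lemma Hminus_plus (p q : H) : p = ((p - q) + q)%H.
Proof. H_ring. Qed.

Lemma locally_Hnorm (q : H) (P : H -> Prop) :
  @locally H_NormedModule q P <->
  exists d, 0 < d /\ forall p, Hnorm (p - q)%H < d -> P p.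
Proof.
  split.
  - intros HP. apply (locally_norm_le_locally (V := H_NormedModule)) in HP.
    destruct HP as [[d Hd] H1]. exists d. split; [exact Hd |]. intros p Hp.
    apply H1. unfold ball_norm. rewrite <- Hnorm_norm. exact Hp.
  - intros (d & Hd & H1). apply (locally_le_locally_norm (V := H_NormedModule)).
    exists (mkposreal d Hd). intros p Hp. apply H1. unfold ball_norm in Hp.
    rewrite <- Hnorm_norm in Hp. exact Hp.
Qed.

Lemma scal_RtoH (x : R) (h : H) : @scal R_AbsRing H_NormedModule x h = (RtoH x * h)%H.
Proof. H_ring. Qed.

Lemma is_derive_Hnorm (phi : R -> H) (x : R) (dl : H) :
  @is_derive R_AbsRing H_NormedModule phi x dl <->
  forall e, 0 < e -> exists d, 0 < d /\ forall t, Rabs (t - x) < d ->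
    Hnorm (phi t - phi x - RtoH (t - x) * dl)%H <= e * Rabs (t - x).
Proof.
  split.
  - intros [_ Hd] e He. specialize (Hd x (fun P HP => HP) (mkposreal e He)).
    destruct Hd as [[d Hd0] H1]. exists d. split; [exact Hd0 |]. intros t Ht.
    specialize (H1 t Ht). rewrite scal_RtoH in H1.
    rewrite Hnorm_norm. exact H1.
  - intros Hd. split.
    + apply is_linear_scal_l.
    + intros y Hy. apply (is_filter_lim_locally_unique (V := R_NormedModule)) in Hy. subst y.
      intros [e He]. destruct (Hd e He) as (d & Hd0 & H1).
      exists (mkposreal d Hd0). intros t Ht. rewrite scal_RtoH.
      specialize (H1 t Ht). rewrite Hnorm_norm in H1. exact H1.
Qed.

Lemma slice_diff_x (J : H) (x y t : R) : (slice J t y - slice J x y)%H = RtoH (t - x).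
Proof. H_ring. Qed.

Lemma slice_diff_y (J : H) (x y t : R) :
  (slice J x t - slice J x y)%H = (RtoH (t - y) * J)%H.
Proof. H_ring. Qed.

Lemma imag_unit_mult_twice (J h : H) : imag_unit J -> (J * (J * h))%H = (- h)%H.
Proof.
  intros HJ. rewrite (@mult_assoc H_Ring), HJ. destruct h as [[[? ?] ?] ?]. H_ring.
Qed.

(** Differentiation of the series term by term.  On the slice [L J] the
    differential of a power maps [J] to [J] times the image of 1, which is the
    Cauchy-Riemann equation. *)
Lemma Hpseries_regular (r : R) (b : nat -> H) :
  rapid r b -> regular (Ball r) (Hpseries b).
Proof.
  intros Hb. set (l := fun q h => HSeries (fun n => dpow q n h * b n)%H).
  assert (Hs : forall q, Hnorm q < r -> exists s, Hnorm q < s /\ 0 < s < r).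
  { intros q Hq. exists ((Hnorm q + r) / 2). pose proof (Hnorm_pos q). lra. }
  assert (Hl : forall q h, Hnorm q < r ->
            is_Hseries (fun n => dpow q n h * b n)%H (l q h) /\
            exists C0, 0 <= C0 /\ forall h, Hnorm (l q h) <= C0 * Hnorm h).
  { intros q h0 Hq. destruct (Hs q Hq) as (s & Hqs & Hs0).
    destruct (rapid_weighted r s b Hb Hs0) as (K & x & Hx & HK & HB).
    assert (Hterm : forall h n, Hnorm (dpow q n h * b n)%H <= (Hnorm h * / s * K) * x ^ n).
    { intros h n. rewrite Hnorm_mult.
      pose proof (Hnorm_dpow q h s n ltac:(lra)) as Hd.
      pose proof (Hnorm_pos h). pose proof (Hnorm_pos (b n)). pose proof (pos_INR n).
      apply Rmult_le_reg_r with s; [lra |].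
      replace (Hnorm h * / s * K * x ^ n * s) with (Hnorm h * (K * x ^ n)) by (field; lra).
      apply Rle_trans with (INR n * Hnorm h * s ^ n * Hnorm (b n)).
      { replace (Hnorm (dpow q n h) * Hnorm (b n) * s)
          with (Hnorm (dpow q n h) * s * Hnorm (b n)) by ring.
        now apply Rmult_le_compat_r. }
      apply Rle_trans with (Hnorm h * (INR (S n) ^ 2 * s ^ n * Hnorm (b n))).
      - replace (INR n * Hnorm h * s ^ n * Hnorm (b n))
          with (Hnorm h * (INR n * s ^ n * Hnorm (b n))) by ring.
        apply Rmult_le_compat_l; [lra |]. apply Rmult_le_compat_r; [lra |].
        apply Rmult_le_compat_r; [apply pow_le; lra |]. rewrite S_INR. nra.
      - now apply Rmult_le_compat_l. }
    assert (Hsum : forall h, is_Hseries (fun n => dpow q n h * b n)%H (l q h)).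
    { intros h. eapply is_Hseries_of_norm; [apply (Hterm h) |].
      eexists. now apply is_series_scal_geom. }
    split; [apply Hsum |].
    exists (4 * (/ s * K * / (1 - x))). split.
    - repeat apply Rmult_le_pos; try lra; left; apply Rinv_0_lt_compat; lra.
    - intros h. eapply Rle_trans.
      + eapply is_Hseries_norm_le; [apply (Hsum h) | apply (Hterm h) |].
        now apply is_series_scal_geom.
      + right. ring. }
  assert (Hdiff : forall q, Hnorm q < r -> forall e, 0 < e -> exists d, 0 < d /\
            forall p, Hnorm (p - q)%H < d ->
              Hnorm (Hpseries b p - Hpseries b q - l q (p - q))%H <= e * Hnorm (p - q)%H).
  { intros q Hq e He. destruct (Hs q Hq) as (s & Hqs & Hs0).
    destruct (rapid_weighted r s b Hb Hs0) as (K & x & Hx & HK & HB).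
    set (C0 := 4 * (/ s ^ 2 * K * / (1 - x))).
    assert (HC0 : 0 <= C0).
    { unfold C0. repeat apply Rmult_le_pos; try lra; left; apply Rinv_0_lt_compat;
        try apply pow_lt; lra. }
    assert (Hed : 0 < e / (C0 + 1)) by (apply Rdiv_lt_0_compat; lra).
    exists (Rmin (s - Hnorm q) (e / (C0 + 1))). split; [apply Rmin_glb_lt; lra |].
    intros p Hp. pose proof (Rmin_l (s - Hnorm q) (e / (C0 + 1))).
    pose proof (Rmin_r (s - Hnorm q) (e / (C0 + 1))).
    set (h := (p - q)%H) in *.
    assert (Hph : p = (q + h)%H) by apply Hplus_minus. clearbody h. subst p.
    pose proof (Hnorm_pos h). pose proof (Hnorm_pos q).
    pose proof (Hnorm_triangle q h).
    assert (Hsum : is_Hseries (fun n => ((q + h) ^ n - q ^ n - dpow q n h) * b n)%H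
                     (Hpseries b (q + h) - Hpseries b q - l q h)%H).
    { eapply is_Hseries_ext; [| apply is_Hseries_minus; [apply is_Hseries_minus |]].
      2: { apply (rapid_is_Hseries r b (q + h)%H Hb). lra. }
      2: { now apply (rapid_is_Hseries r b q Hb). }
      2: { apply (Hl q h Hq). }
      intros n. cbv beta. now rewrite !Hmult_minus_l. }
    apply Rle_trans with (C0 * Hnorm h * Hnorm h).
    - apply Rle_trans with (4 * ((Hnorm h ^ 2 * / s ^ 2 * K) * / (1 - x)));
        [| right; unfold C0; ring].
      eapply is_Hseries_norm_le; [exact Hsum | | now apply is_series_scal_geom].
      intros n. cbv beta. rewrite Hnorm_mult.
      pose proof (Hnorm_pow_taylor q h s n ltac:(lra)) as Ht.
      pose proof (Hnorm_pos (b n)). pose proof (pos_INR n).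
      assert (Hs2 : 0 < s ^ 2) by (apply pow_lt; lra).
      apply Rmult_le_reg_r with (s ^ 2); [exact Hs2 |].
      replace (Hnorm h ^ 2 * / s ^ 2 * K * x ^ n * s ^ 2)
        with (Hnorm h ^ 2 * (K * x ^ n)) by (field; lra).
      apply Rle_trans with (INR n ^ 2 * Hnorm h ^ 2 * s ^ n * Hnorm (b n)).
      { match goal with |- ?a * ?c * ?d <= _ =>
          replace (a * c * d) with (a * d * c) by ring end.
        now apply Rmult_le_compat_r. }
      apply Rle_trans with (Hnorm h ^ 2 * (INR (S n) ^ 2 * s ^ n * Hnorm (b n))).
      + replace (INR n ^ 2 * Hnorm h ^ 2 * s ^ n * Hnorm (b n))
          with (Hnorm h ^ 2 * (INR n ^ 2 * s ^ n * Hnorm (b n))) by ring.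
        apply Rmult_le_compat_l; [apply pow2_ge_0 |]. apply Rmult_le_compat_r; [lra |].
        apply Rmult_le_compat_r; [apply pow_le; lra |]. rewrite S_INR. nra.
      + apply Rmult_le_compat_l; [apply pow2_ge_0 | apply HB].
    - apply Rmult_le_compat_r; [lra |].
      apply Rle_trans with (C0 * (e / (C0 + 1))).
      + apply Rmult_le_compat_l; lra.
      + apply Rmult_le_reg_r with (C0 + 1); [lra |].
        replace (C0 * (e / (C0 + 1)) * (C0 + 1)) with (C0 * e) by (field; lra). nra. }
  assert (Hscal : forall q x h, Hnorm q < r -> l q (RtoH x * h)%H = (RtoH x * l q h)%H).
  { intros q x h Hq. eapply is_Hseries_unique; [apply (Hl q _ Hq) |].
    eapply is_Hseries_ext; [| apply (is_Hseries_mult_l (RtoH x)), (Hl q h Hq)].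
    intros n. cbv beta. now rewrite dpow_scal, (@mult_assoc H_Ring). }
  split.
  - intros q Hq. exists (l q). split; [split |].
    + intros g h. eapply is_Hseries_unique; [apply (Hl q _ Hq) |].
      eapply is_Hseries_ext; [| apply is_Hseries_plus; apply (Hl q _ Hq)].
      intros n. cbv beta. change (@plus H_NormedModule g h) with (g + h)%H.
      now rewrite dpow_plus, (@mult_distr_r H_Ring).
    + intros x h. rewrite !scal_RtoH. now apply Hscal.
    + destruct (Hl q q Hq) as [_ (C0 & HC0 & Hbd)]. exists (C0 + 1). split; [lra |].
      intros h. rewrite <- !Hnorm_norm. eapply Rle_trans; [apply Hbd |].
      pose proof (Hnorm_pos h). nra.
    + intros q' Hq'.
      assert (q' = q) as ->.
      { symmetry. apply (is_filter_lim_locally_unique (V := H_NormedModule)).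
        intros P HP.
        assert (Hw : within (Ball r) (@locally H_NormedModule q) P) by apply Hq', HP.
        assert (Hin : @locally H_NormedModule q (Ball r)).
        { apply locally_Hnorm. exists (r - Hnorm q). change (Hnorm q < r) in Hq. split; [lra |].
          intros p Hp. change (Hnorm p < r). pose proof (Hnorm_triangle (p - q)%H q) as Ht.
          rewrite <- Hminus_plus in Ht. lra. }
        generalize (filter_and (F := @locally H_NormedModule q) _ _ Hw Hin).
        apply filter_imp. intros p [F1 F2]. auto. }
      intros [e He]. destruct (Hdiff q Hq e He) as (d & Hd & H1).
      apply filter_le_within. apply locally_Hnorm. exists d. split; [exact Hd |].
      intros p Hp. rewrite <- !Hnorm_norm. now apply H1.
  - intros J x y HJ Hq. set (q := slice J x y) in *.
    exists (l q 1%H), (l q J).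
    assert (HJ1 : Hnorm J = 1) by now apply Hnorm_imag_unit.
    assert (HlJ : l q J = (J * l q 1)%H).
    { eapply is_Hseries_unique; [apply (Hl q _ Hq) |].
      eapply is_Hseries_ext; [| apply (is_Hseries_mult_l J), (Hl q 1%H Hq)].
      intros n. cbv beta. rewrite (dpow_commute q J n), (@mult_assoc H_Ring);
        [reflexivity |]. unfold q. H_ring. }
    split; [| split].
    + apply is_derive_Hnorm. intros e He. destruct (Hdiff q Hq e He) as (d & Hd & H1).
      exists d. split; [exact Hd |]. intros t Ht. specialize (H1 (slice J t y)).
      unfold q in H1. rewrite slice_diff_x in H1. fold q in H1.
      rewrite Hnorm_RtoH in H1. specialize (H1 Ht).
      rewrite <- (Hscal q (t - x) 1%H Hq), mult_one_r. exact H1.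
    + apply is_derive_Hnorm. intros e He. destruct (Hdiff q Hq e He) as (d & Hd & H1).
      exists d. split; [exact Hd |]. intros t Ht. specialize (H1 (slice J x t)).
      unfold q in H1. rewrite slice_diff_y in H1. fold q in H1.
      rewrite Hnorm_mult, Hnorm_RtoH, HJ1, Rmult_1_r in H1. specialize (H1 Ht).
      rewrite <- (Hscal q (t - y) J Hq). exact H1.
    + rewrite HlJ, (imag_unit_mult_twice J (l q 1%H) HJ). generalize (l q 1%H). H_ring_all.
Qed.
(** * Coefficients and real polynomials *)

Lemma RtoH_pow (x : R) (n : nat) : (RtoH x ^ n)%H = RtoH (x ^ n).
Proof. induction n as [| n IH]; simpl; [reflexivity |]. rewrite IH. H_ring. Qed.

Lemma is_Hseries_real_coords (b : nat -> H) (x : R) (l : H) :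
  is_Hseries (fun n => RtoH x ^ n * b n)%H l <->
  is_series (fun n => Hre (b n) * x ^ n) (Hre l) /\
  is_series (fun n => Hc1 (b n) * x ^ n) (Hc1 l) /\
  is_series (fun n => Hc2 (b n) * x ^ n) (Hc2 l) /\
  is_series (fun n => Hc3 (b n) * x ^ n) (Hc3 l).
Proof.
  assert (Hiff : forall (pr : H -> R), (forall y h, pr (RtoH y * h)%H = pr h * y) ->
            is_series (fun n => pr (RtoH x ^ n * b n)%H) (pr l) <->
            is_series (fun n => pr (b n) * x ^ n) (pr l)).
  { intros pr Hpr. split; apply is_series_ext; intros n; now rewrite RtoH_pow, Hpr. }
  rewrite is_Hseries_coords.
  rewrite (Hiff Hre), (Hiff Hc1), (Hiff Hc2), (Hiff Hc3); [reflexivity | ..];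
    intros y h; destruct h as [[[h0 h1] h2] h3];
    cbv -[Rplus Rmult Rminus Ropp IZR]; ring.
Qed.

(** On the real axis a quaternionic power series is a quadruple of real power
    series. *)
Lemma coef_unique (r : R) (f : H -> H) (a : nat -> H) :
  0 < r -> is_expansion r f a -> coef r f = a.
Proof.
  intros Hr Ha.
  assert (Hc : is_expansion r f (coef r f))
    by (exact (epsilon_spec _ (is_expansion r f) (ex_intro _ a Ha))).
  set (c := coef r f) in *. clearbody c.
  assert (Hd : forall x, Rabs x < r ->
            is_Hseries (fun n => RtoH x ^ n * (c n - a n))%H (f (RtoH x) - f (RtoH x))%H).
  { intros x Hx. assert (HB : Ball r (RtoH x)) by (unfold Ball; now rewrite Hnorm_RtoH).
    eapply is_Hseries_ext; [| apply is_Hseries_minus; [apply (Hc _ HB) | apply (Ha _ HB)]].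
    intros n. cbv beta. now rewrite Hmult_minus_r. }
  assert (H0 : forall (pr : H -> R), (forall h, pr (h - h)%H = 0) ->
            (forall x, Rabs x < r -> is_series (fun n => pr (c n - a n)%H * x ^ n)
                                       (pr (f (RtoH x) - f (RtoH x))%H)) ->
            forall n, pr (c n - a n)%H = 0).
  { intros pr Hpr Hs. apply is_pseries_0_coef with r; [exact Hr |]. intros x Hx.
    specialize (Hs x Hx). now rewrite Hpr in Hs. }
  apply functional_extensionality. intros n. apply Hminus_eq_0.
  assert (E0 : Hre (c n - a n)%H = 0).
  { apply (H0 Hre); [intros [[[? ?] ?] ?]; unfold Hre; simpl; apply Rplus_opp_r |].
    intros x Hx.
    apply (proj1 (is_Hseries_real_coords (fun n => c n - a n)%H x _) (Hd x Hx)). }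
  assert (E1 : Hc1 (c n - a n)%H = 0).
  { apply (H0 Hc1); [intros [[[? ?] ?] ?]; unfold Hc1; simpl; apply Rplus_opp_r |].
    intros x Hx.
    apply (proj1 (is_Hseries_real_coords (fun n => c n - a n)%H x _) (Hd x Hx)). }
  assert (E2 : Hc2 (c n - a n)%H = 0).
  { apply (H0 Hc2); [intros [[[? ?] ?] ?]; unfold Hc2; simpl; apply Rplus_opp_r |].
    intros x Hx.
    apply (proj1 (is_Hseries_real_coords (fun n => c n - a n)%H x _) (Hd x Hx)). }
  assert (E3 : Hc3 (c n - a n)%H = 0).
  { apply (H0 Hc3); [intros [[[? ?] ?] ?]; unfold Hc3; simpl; apply Rplus_opp_r |].
    intros x Hx.
    apply (proj1 (is_Hseries_real_coords (fun n => c n - a n)%H x _) (Hd x Hx)). }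
  revert E0 E1 E2 E3. generalize (c n - a n)%H. intros [[[d0 d1] d2] d3].
  unfold Hre, Hc1, Hc2, Hc3. cbn [fst snd]. now intros -> -> -> ->.
Qed.

(** Real polynomials, given by the list of their coefficients and evaluated by
    Horner's rule, so that products can be computed by induction on the list. *)
Fixpoint evalC (l : list R) (z : C) : C :=
  match l with nil => 0 | cons c l' => RtoC c + z * evalC l' z end%C.

Fixpoint evalH (l : list R) (q : H) : H :=
  match l with nil => 0 | cons c l' => RtoH c + q * evalH l' q end%H.

Lemma evalH_emb (l : list R) (J : H) (z : C) :
  imag_unit J -> evalH l (emb J z) = emb J (evalC l z).
Proof.
  intros HJ. induction l as [| c l IH]; cbn [evalC evalH].
  - H_ring.
  - now rewrite IH, emb_plus, emb_mult, emb_RtoC.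
Qed.

Lemma holo_evalC (l : list R) (z : C) : holo (evalC l) z.
Proof.
  induction l as [| c l IH]; cbn [evalC]; [apply holo_const |].
  apply holo_plus; [apply holo_const |]. apply holo_mult; [apply holo_id | exact IH].
Qed.

Lemma evalC_mul_quadratic (l : list R) (b c : R) :
  exists l', forall z, evalC l' z = ((z * z + RtoC b * z + RtoC c) * evalC l z)%C.
Proof.
  assert (Hlin : forall l1 l2 (u v : R), exists l', forall z,
            evalC l' z = (RtoC u * evalC l1 z + RtoC v * evalC l2 z)%C).
  { induction l1 as [| a1 l1 IH]; intros l2 u v.
    - exists (map (Rmult v) l2). intros z. cbn [evalC].
      induction l2 as [| a2 l2 IH2]; cbn [evalC map]; [ring |].
      rewrite RtoC_mult. transitivity (RtoC v * RtoC a2 + z * evalC (map (Rmult v) l2) z)%C;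
        [reflexivity |]. rewrite IH2. ring.
    - destruct l2 as [| a2 l2].
      + exists (map (Rmult u) (a1 :: l1)). intros z. generalize (a1 :: l1)%list. intros l0.
        induction l0 as [| a0 l0 IH2]; cbn [evalC map]; [ring |].
        cbn [evalC] in IH2. rewrite IH2, RtoC_mult. ring.
      + destruct (IH l2 u v) as [l' Hl']. exists ((u * a1 + v * a2) :: l')%list.
        intros z. cbn [evalC]. rewrite Hl', RtoC_plus, !RtoC_mult. ring. }
  destruct (Hlin (0 :: l)%list l 1 b) as [l1 H1].
  destruct (Hlin (0 :: l1)%list l 1 c) as [l2 H2].
  exists l2. intros z. rewrite H2. cbn [evalC]. rewrite H1. cbn [evalC]. ring.
Qed.

Lemma sum_n_shift {G : AbelianMonoid} (a : nat -> G) (n : nat) :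
  sum_n a (S n) = plus (a O) (sum_n (fun k => a (S k)) n).
Proof.
  unfold sum_n. rewrite sum_Sn_m by lia. f_equal. symmetry. apply sum_n_m_S.
Qed.

Lemma sum_n_mult_l (q : H) (u : nat -> H) (n : nat) :
  @sum_n H_Ring (fun k => q * u k)%H n = (q * @sum_n H_Ring u n)%H.
Proof.
  induction n as [| n IH]; [now rewrite !sum_O |].
  rewrite !sum_Sn, IH, mult_distr_l. reflexivity.
Qed.

Lemma evalH_sum_n (l : list R) (q : H) (n : nat) :
  (length l <= n)%nat ->
  evalH l q = @sum_n H_Ring (fun k => q ^ k * RtoH (nth k l 0%R))%H n.
Proof.
  revert n. induction l as [| c l IH]; intros n Hn.
  - cbn [evalH]. symmetry. induction n as [| n IHn].
    + rewrite sum_O. H_ring.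
    + rewrite sum_Sn, IHn by (simpl; lia). simpl nth.
      generalize (q ^ S n)%H. H_ring_all.
  - destruct n as [| n]; [simpl in Hn; lia |].
    rewrite sum_n_shift. cbn [evalH nth pow_n].
    rewrite (IH n) by (simpl in Hn; lia). rewrite <- sum_n_mult_l.
    f_equal; [H_ring |]. apply sum_n_ext. intros k. apply (@mult_assoc H_Ring).
Qed.

Lemma is_Hseries_decr_1 (u : nat -> H) (l : H) :
  is_Hseries (fun n => u (S n)) l -> is_Hseries u (u O + l)%H.
Proof.
  intros Hu. apply (@is_series_decr_1 R_AbsRing H_NormedModule).
  assert (Hl : plus (u O + l)%H (opp (u O)) = l).
  { generalize (u O). clear Hu. H_ring_all. }
  exact (eq_ind_r (fun m => is_Hseries (fun n => u (S n)) m) Hu Hl).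
Qed.

Lemma RtoH_pow_commute (x : R) (q : H) (n : nat) (h : H) :
  (q ^ n * (RtoH x * h) = RtoH x * (q ^ n * h))%H.
Proof. generalize (q ^ n)%H. H_ring_all. Qed.

(** Real coefficients commute with everything, and therefore the regular product
    by a real polynomial is the pointwise product. *)
Lemma evalH_conv (l : list R) (q : H) (v : nat -> H) (V : H) :
  is_Hseries (fun n => q ^ n * v n)%H V ->
  is_Hseries (fun n => q ^ n *
    @sum_n H_Ring (fun k => RtoH (nth k l 0%R) * v (n - k)%nat) n)%H (evalH l q * V)%H.
Proof.
  intros HV. induction l as [| c l IH].
  - apply is_Hseries_ext with (fun n => RtoH 0 * (q ^ n * v n))%H.
    2: { cbn [evalH]. apply (is_Hseries_mult_l (RtoH 0) _ _ HV). }
    intros n. rewrite (sum_n_ext _ (fun k => RtoH 0 * v (n - k)%nat)%H).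
    + rewrite sum_n_mult_l. generalize (q ^ n)%H (v n).
      generalize (@sum_n H_Ring (fun k => v (n - k)%nat) n). clear. H_ring_all.
    + intros k. now destruct k.
  - set (w := fun n => @sum_n H_Ring (fun k => RtoH (nth k l 0%R) * v (n - k)%nat)%H n) in *.
    set (u := fun n => match n with O => 0%H | S m => (q * (q ^ m * w m))%H end).
    assert (Hu : is_Hseries u (q * (evalH l q * V))%H).
    { replace (q * (evalH l q * V))%H with (u O + q * (evalH l q * V))%H.
      - apply is_Hseries_decr_1. apply (is_Hseries_mult_l q _ _ IH).
      - cbn [u]. apply (@plus_zero_l H_Ring). }
    replace (evalH (c :: l) q * V)%H with (RtoH c * V + q * (evalH l q * V))%H.
    2: { cbn [evalH]. now rewrite (@mult_distr_r H_Ring), (@mult_assoc H_Ring). }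
    eapply is_Hseries_ext;
      [| apply (is_Hseries_plus _ _ _ _ (is_Hseries_mult_l (RtoH c) _ _ HV) Hu)].
    intros n. cbv beta. destruct n as [| n].
    + rewrite sum_O. cbn [u nth Nat.sub pow_n]. rewrite !mult_one_l.
      apply (@plus_zero_r H_Ring).
    + rewrite sum_n_shift. cbn [u nth Nat.sub].
      change (@sum_n H_Ring _ n) with (w n).
      rewrite (@mult_distr_l H_Ring (q ^ S n)%H), RtoH_pow_commute.
      f_equal. cbn [pow_n]. apply (@mult_assoc H_Ring).
Qed.

Lemma evalH_expansion (l : list R) (q : H) :
  is_Hseries (fun n => q ^ n * RtoH (nth n l 0%R))%H (evalH l q).
Proof.
  induction l as [| c l IH].
  - cbn [evalH]. apply is_Hseries_ext with (fun _ => 0%H).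
    + intros n. replace (nth n nil 0%R) with 0%R by now destruct n.
      generalize (q ^ n)%H. H_ring_all.
    + apply is_Hseries_coords. repeat split; apply is_series_const_0.
  - cbn [evalH].
    replace (RtoH c) with (q ^ 0 * RtoH (nth 0 (c :: l) 0%R))%H by (destruct q; H_ring).
    apply (is_Hseries_decr_1 (fun n => q ^ n * RtoH (nth n (c :: l) 0%R))%H).
    apply is_Hseries_ext with (fun n => q * (q ^ n * RtoH (nth n l 0%R)))%H.
    + intros n. cbn [nth pow_n]. apply (@mult_assoc H_Ring).
    + now apply is_Hseries_mult_l.
Qed.

Lemma reg_conj_evalH (r : R) (l : list R) (q : H) :
  0 < r -> reg_conj r (evalH l) q = evalH l q.
Proof.
  intros Hr. unfold reg_conj.
  rewrite (coef_unique r (evalH l) (fun n => RtoH (nth n l 0%R)) Hr).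
  - apply is_Hseries_HSeries. eapply is_Hseries_ext; [| apply evalH_expansion].
    intros n. cbv beta. f_equal. H_ring.
  - intros p _. apply evalH_expansion.
Qed.

Lemma reg_mul_evalH (r : R) (l : list R) (P g : H -> H) (b : nat -> H) (q : H) :
  0 < r -> (forall p, P p = evalH l p) -> is_expansion r g b -> Ball r q ->
  reg_mul r P g q = (evalH l q * g q)%H.
Proof.
  intros Hr HP Hg Hq. unfold reg_mul.
  rewrite (coef_unique r P (fun n => RtoH (nth n l 0%R)) Hr).
  - rewrite (coef_unique r g b Hr Hg). apply is_Hseries_HSeries.
    apply evalH_conv, Hg, Hq.
  - intros p _. rewrite HP. apply evalH_expansion.
Qed.

Lemma left_quotient_evalH (r : R) (l : list R) (g : H -> H) (b : nat -> H) (q f : H) :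
  0 < r -> is_expansion r g b -> Ball r q ->
  reg_sym r (evalH l) q <> 0%H -> (evalH l q * f)%H = g q ->
  f = left_quotient r (evalH l) g q.
Proof.
  intros Hr Hg Hq Hs Hf. unfold left_quotient.
  assert (Hsym : reg_sym r (evalH l) q = (evalH l q * evalH l q)%H).
  { unfold reg_sym.
    rewrite (reg_mul_evalH r l (evalH l) (reg_conj r (evalH l)) (fun n => RtoH (nth n l 0%R)) q Hr);
      [| reflexivity | | exact Hq].
    - now rewrite reg_conj_evalH.
    - intros p _. rewrite reg_conj_evalH by exact Hr. apply evalH_expansion. }
  rewrite (reg_mul_evalH r l (reg_conj r (evalH l)) g b q Hr); [| | exact Hg | exact Hq].
  2: { intros p. now apply reg_conj_evalH. }
  rewrite <- Hf, (@mult_assoc H_Ring (evalH l q)), <- Hsym, (@mult_assoc H_Ring).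
  rewrite Hinv_mult by exact Hs. symmetry. apply (@mult_one_l H_Ring).
Qed.
(** * Semiregular functions on a slice *)

Lemma eq_of_Hnorm_small (p q : H) :
  (forall e, 0 < e -> Hnorm (p - q)%H <= e) -> p = q.
Proof.
  intros He. apply Hminus_eq_0, Hnorm_eq_0, Rle_antisym; [| apply Hnorm_pos].
  apply le_epsilon. intros e He0. rewrite Rplus_0_l. now apply He.
Qed.

Lemma Hnorm_emb_sub (J : H) (v w : C) :
  imag_unit J -> Hnorm (emb J v - emb J w)%H = Cmod (v - w).
Proof. intros HJ. now rewrite <- emb_minus, Hnorm_emb. Qed.

Lemma emb_inj (J : H) (v w : C) : imag_unit J -> emb J v = emb J w -> v = w.
Proof.
  intros HJ Heq. apply Cmod_sub_0. rewrite <- (Hnorm_emb_sub J v w HJ), Heq.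
  rewrite (Hnorm_emb_sub J w w HJ). apply Cmod_self_0.
Qed.

Lemma Hminus_triangle (p q h : H) :
  Hnorm (p - h)%H <= Hnorm (p - q)%H + Hnorm (q - h)%H.
Proof.
  replace (p - h)%H with ((p - q) + (q - h))%H by H_ring. apply Hnorm_triangle.
Qed.

(** The differential along the slice is a complex number times the partial
    derivative along the real axis, by the Cauchy-Riemann equation. *)
Lemma regular_holo (U : H -> Prop) (f : H -> H) (J : H) (z : C) (r : R) (u : H) :
  regular U f -> imag_unit J -> 0 < r ->
  (forall w, Cmod (w - z) < r -> U (emb J w)) ->
  holo (fun w => lam J (f (emb J w) * u)%H) z.
Proof.
  intros [Hdiff Hcr] HJ Hr HU.
  assert (HUz : U (emb J z)) by (apply HU; now rewrite Cmod_self_0).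
  set (q := emb J z) in *.
  destruct (Hdiff q HUz) as (l & [Hlp Hls _] & Hdom).
  destruct (Hcr J (Re z) (Im z) HJ HUz) as (dx & dy & Hdx & Hdy & Heq).
  assert (Hl : forall e, 0 < e -> exists d, 0 < d /\ forall w, Cmod (w - z) < d ->
            Hnorm (f (emb J w) - f q - l (emb J w - q))%H <= e * Cmod (w - z)).
  { intros e He.
    assert (Hlim : is_filter_lim (within U (@locally H_NormedModule q)) q).
    { intros P HP. now apply filter_le_within. }
    specialize (Hdom q Hlim (mkposreal e He)).
    apply locally_Hnorm in Hdom. destruct Hdom as (d & Hd & H1).
    exists (Rmin d r). split; [now apply Rmin_glb_lt |]. intros w Hw.
    pose proof (Rmin_l d r). pose proof (Rmin_r d r).
    assert (Hww : Hnorm (emb J w - q)%H = Cmod (w - z)) by now apply Hnorm_emb_sub.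
    specialize (H1 (emb J w)). rewrite Hww in H1.
    specialize (H1 ltac:(lra) (HU w ltac:(lra))).
    rewrite <- !Hnorm_norm in H1. rewrite <- Hww. exact H1. }
  assert (Hscal : forall x h, l (RtoH x * h)%H = (RtoH x * l h)%H).
  { intros x h. rewrite <- !scal_RtoH. apply Hls. }
  assert (Hlx : l 1%H = dx).
  { apply eq_of_Hnorm_small. intros e He.
    destruct (Hl (e / 2)) as (d & Hd & H1); [lra |].
    destruct (proj1 (is_derive_Hnorm _ _ _) Hdx (e / 2)) as (d' & Hd' & H2); [lra |].
    set (s := Rmin d d' / 2). assert (0 < Rmin d d') by now apply Rmin_glb_lt.
    pose proof (Rmin_l d d'). pose proof (Rmin_r d d').
    assert (Hs : 0 < s) by (unfold s; lra).
    specialize (H1 (z + RtoC s)%C). specialize (H2 (Re z + s)).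
    replace (z + RtoC s - z)%C with (RtoC s) in H1 by ring.
    rewrite Cmod_R, (Rabs_pos_eq s) in H1 by lra.
    replace (Re z + s - Re z) with s in H2 by ring.
    rewrite (Rabs_pos_eq s) in H2 by lra.
    specialize (H1 ltac:(unfold s in *; lra)). specialize (H2 ltac:(unfold s in *; lra)).
    assert (Hq : (emb J (z + RtoC s) - q)%H = (RtoH s * 1)%H).
    { unfold q. rewrite <- emb_minus. replace (z + RtoC s - z)%C with (RtoC s) by ring.
      rewrite emb_RtoC. symmetry. apply (@mult_one_r H_Ring). }
    rewrite Hq, Hscal in H1.
    assert (Hp : slice J (Re z + s) (Im z) = emb J (z + RtoC s)%C).
    { unfold emb. rewrite re_plus, im_plus. simpl. now rewrite Rplus_0_r. }
    rewrite Hp in H2. change (slice J (Re z) (Im z)) with q in H2.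
    set (F := (f (emb J (z + RtoC s)) - f q)%H) in *.
    pose proof (Hminus_triangle (RtoH s * l 1) F (RtoH s * dx))%H as Ht.
    rewrite (Hnorm_minus_sym (RtoH s * l 1)%H F) in Ht.
    rewrite <- Hmult_minus_r, Hnorm_mult, Hnorm_RtoH, Rabs_pos_eq in Ht by lra.
    apply Rmult_le_reg_l with s; [exact Hs |]. lra. }
  assert (Hly : l J = dy).
  { apply eq_of_Hnorm_small. intros e He.
    destruct (Hl (e / 2)) as (d & Hd & H1); [lra |].
    destruct (proj1 (is_derive_Hnorm _ _ _) Hdy (e / 2)) as (d' & Hd' & H2); [lra |].
    set (s := Rmin d d' / 2). assert (0 < Rmin d d') by now apply Rmin_glb_lt.
    pose proof (Rmin_l d d'). pose proof (Rmin_r d d').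
    assert (Hs : 0 < s) by (unfold s; lra).
    specialize (H1 (z + RtoC s * Ci)%C). specialize (H2 (Im z + s)).
    replace (z + RtoC s * Ci - z)%C with (RtoC s * Ci)%C in H1 by ring.
    rewrite Cmod_mult, Cmod_Ci, Rmult_1_r, Cmod_R, (Rabs_pos_eq s) in H1 by lra.
    replace (Im z + s - Im z) with s in H2 by ring.
    rewrite (Rabs_pos_eq s) in H2 by lra.
    specialize (H1 ltac:(unfold s in *; lra)). specialize (H2 ltac:(unfold s in *; lra)).
    assert (Hq : (emb J (z + RtoC s * Ci) - q)%H = (RtoH s * J)%H).
    { unfold q. rewrite <- emb_minus.
      replace (z + RtoC s * Ci - z)%C with (RtoC s * Ci)%C by ring.
      rewrite emb_mult, emb_RtoC by exact HJ. f_equal. clear. H_ring. }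
    rewrite Hq, Hscal in H1.
    assert (Hp : slice J (Re z) (Im z + s) = emb J (z + RtoC s * Ci)%C).
    { unfold emb. rewrite re_plus, im_plus. f_equal; simpl; ring. }
    rewrite Hp in H2. change (slice J (Re z) (Im z)) with q in H2.
    set (F := (f (emb J (z + RtoC s * Ci)) - f q)%H) in *.
    pose proof (Hminus_triangle (RtoH s * l J) F (RtoH s * dy))%H as Ht.
    rewrite (Hnorm_minus_sym (RtoH s * l J)%H F) in Ht.
    rewrite <- Hmult_minus_r, Hnorm_mult, Hnorm_RtoH, Rabs_pos_eq in Ht by lra.
    apply Rmult_le_reg_l with s; [exact Hs |]. lra. }
  assert (Hdxy : dy = (J * dx)%H).
  { assert (H0 : (dx + J * dy)%H = 0%H).
    { apply (f_equal (fun h => RtoH 2 * h)%H) in Heq.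
      transitivity (RtoH 2 * (RtoH (1 / 2) * (dx + J * dy)))%H.
      - rewrite (@mult_assoc H_Ring).
        replace (RtoH 2 * RtoH (1 / 2))%H with 1%H; [symmetry; apply (@mult_one_l H_Ring) |].
        unfold RtoH. cbv -[Rplus Rmult Rminus Ropp Rdiv IZR].
        repeat apply (f_equal2 pair); field.
      - etransitivity; [exact Heq |]. clear. H_ring. }
    apply (f_equal (fun h => J * h)%H) in H0.
    rewrite (@mult_distr_l H_Ring), imag_unit_mult_twice in H0 by exact HJ.
    symmetry. apply Hminus_eq_0. etransitivity; [exact H0 |]. clear. H_ring. }
  assert (Hlw : forall w, l (emb J w - q)%H = (emb J (w - z) * dx)%H).
  { intros w. unfold q. rewrite <- emb_minus. generalize (w - z)%C. intros [x y].
    replace (emb J (x, y)) with (RtoH x * 1 + RtoH y * J)%H by H_ring.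
    etransitivity; [apply Hlp |]. change (l (RtoH x * 1) + l (RtoH y * J) =
      (RtoH x * 1 + RtoH y * J) * dx)%H.
    rewrite !Hscal, Hlx, Hly, Hdxy, (@mult_distr_r H_Ring), !(@mult_assoc H_Ring).
    now rewrite (@mult_one_r H_Ring). }
  apply holo_slope with (lam J (dx * u)%H). intros e He.
  assert (Hu : 0 < 2 * (Hnorm u + 1)) by (pose proof (Hnorm_pos u); lra).
  destruct (Hl (e / (2 * (Hnorm u + 1)))) as (d & Hd & H1);
    [now apply Rdiv_lt_0_compat |].
  exists d. split; [exact Hd |]. intros w Hw. specialize (H1 w Hw).
  rewrite Hlw in H1. fold q.
  assert (Hexp : (lam J (f (emb J w) * u) - lam J (f q * u)
                  - lam J (dx * u) * (w - z))%C
    = lam J ((f (emb J w) - f q - emb J (w - z) * dx) * u)%H).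
  { rewrite !Hmult_minus_l, !lam_minus, <- (@mult_assoc H_Ring), lam_mult by exact HJ.
    ring. }
  rewrite Hexp. eapply Rle_trans; [now apply Cmod_lam_le |]. rewrite Hnorm_mult.
  apply Rle_trans with (2 * (e / (2 * (Hnorm u + 1)) * Cmod (w - z) * (Hnorm u + 1))).
  - apply Rmult_le_compat_l; [lra |].
    apply Rmult_le_compat; [apply Hnorm_pos | apply Hnorm_pos | exact H1 | lra].
  - right. field. lra.
Qed.

Lemma finite_support_bound (c : nat -> R) (n : nat) :
  (forall m, (n < m)%nat -> c m = 0) -> exists A, 0 <= A /\ forall m, c m <= A.
Proof.
  revert c. induction n as [| n IH]; intros c Hc.
  - exists (Rmax (c O) 0). split; [apply Rmax_r |]. intros m.
    destruct m as [| m]; [apply Rmax_l |]. rewrite Hc by lia. apply Rmax_r.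
  - destruct (IH (fun m => if Nat.eqb m (S n) then 0 else c m)) as (A & HA & Hm).
    + intros m Hm. destruct (Nat.eqb_spec m (S n)); [reflexivity |]. apply Hc. lia.
    + exists (Rmax A (c (S n))). split.
      * eapply Rle_trans; [exact HA | apply Rmax_l].
      * intros m. specialize (Hm m). cbv beta in Hm.
        destruct (Nat.eqb_spec m (S n)) as [Heq |].
        -- rewrite Heq. apply Rmax_r.
        -- eapply Rle_trans; [exact Hm | apply Rmax_l].
Qed.

Definition pole_order_bound (N : C -> R) (p : C) : Prop :=
  exists (n : nat) (M d : R), 0 < d /\
    forall w, 0 < Cmod (w - p) < d -> N w * Cmod (w - p) ^ n <= M.

(** The principal part is a finite sum, of the order of its last term, and the
    regular part is bounded. *)
Lemma pole_bound (U : H -> Prop) (f : H -> H) (J : H) (p : C) :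
  imag_unit J -> pole U f J (emb J p) ->
  pole_order_bound (fun w => Hnorm (f (emb J w))) p.
Proof.
  intros HJ (r & a & Hr & Hsum & n & Hn).
  assert (Hlau : forall w, 0 < Cmod (w - p) < r ->
            is_laurent_sum a (emb J (w - p)) (f (emb J w))).
  { intros w Hw. rewrite emb_minus. apply Hsum.
    - now exists (Re w), (Im w).
    - now rewrite Hnorm_emb_sub. }
  set (rho := r / 2).
  (* the regular part converges at distance [rho] from [p] *)
  assert (HM : exists M, forall m, Hnorm (a (Z.of_nat m)) * rho ^ m <= M).
  { destruct (Hlau (p + RtoC rho)%C) as (v1 & _ & H1 & _).
    { replace (p + RtoC rho - p)%C with (RtoC rho) by ring.
      rewrite Cmod_R, Rabs_pos_eq by (unfold rho; lra). unfold rho; lra. }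
    replace (p + RtoC rho - p)%C with (RtoC rho) in H1 by ring.
    apply is_Hseries_bounded in H1 as [M HM]. exists M. intros m. specialize (HM m).
    rewrite Hnorm_mult, Hnorm_pow, Hnorm_emb, Cmod_R, Rabs_pos_eq in HM
      by (exact HJ || (unfold rho; lra)).
    lra. }
  destruct HM as [M HM].
  destruct (finite_support_bound (fun m => Hnorm (a (- Z.of_nat m)%Z) * 2 ^ m) n)
    as (A & HA & HAm).
  { intros m Hm. rewrite (Hn m Hm). change 0%H with (RtoH 0).
    rewrite Hnorm_RtoH, Rabs_R0. ring. }
  exists n, (8 * M + 8 * A), (Rmin (rho / 2) 1).
  split; [apply Rmin_glb_lt; unfold rho; lra |]. intros w Hw.
  pose proof (Rmin_l (rho / 2) 1). pose proof (Rmin_r (rho / 2) 1).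
  destruct (Hlau w) as (v1 & v2 & H1 & H2 & ->); [unfold rho in *; lra |].
  set (t := Cmod (w - p)) in *.
  assert (Ht : 0 < t /\ t <= rho / 2 /\ t < 1) by lra.
  assert (Hz : Hnorm (emb J (w - p)) = t) by now apply Hnorm_emb.
  assert (HM0 : 0 <= M).
  { eapply Rle_trans; [| apply (HM O)]. simpl. rewrite Rmult_1_r. apply Hnorm_pos. }
  assert (B1 : Hnorm v1 <= 4 * (M * / (1 - / 2))).
  { eapply is_Hseries_norm_le; [exact H1 | | apply is_series_scal_geom; lra].
    intros m. cbv beta. rewrite Hnorm_mult, Hnorm_pow, Hz.
    apply Rle_trans with ((/ 2 * rho) ^ m * Hnorm (a (Z.of_nat m))).
    - apply Rmult_le_compat_r; [apply Hnorm_pos |]. apply pow_incr. lra.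
    - rewrite Rpow_mult_distr. specialize (HM m).
      assert (0 <= (/ 2) ^ m) by (apply pow_le; lra). nra. }
  assert (Hinv : Hnorm (Hinv (emb J (w - p))) = / t).
  { rewrite Hnorm_Hinv, Hz; [reflexivity |]. intros Hz0. rewrite Hz0 in Hz.
    change 0%H with (RtoH 0) in Hz. rewrite Hnorm_RtoH, Rabs_R0 in Hz. lra. }
  assert (Ht1 : 1 <= / t) by (rewrite <- Rinv_1; apply Rinv_le_contravar; lra).
  assert (Htn : 0 < (/ t) ^ n) by (apply pow_lt; lra).
  assert (B2 : Hnorm v2 <= 4 * (((/ t) ^ n * A) * / (1 - / 2))).
  { eapply is_Hseries_norm_le; [exact H2 | | apply is_series_scal_geom; lra].
    intros m. cbv beta. rewrite Hnorm_mult, Hnorm_pow, Hinv.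
    assert (0 < (/ 2) ^ m) by (apply pow_lt; lra).
    destruct (Nat.le_gt_cases (S m) n) as [Hle | Hgt].
    - apply Rle_trans with ((/ t) ^ n * Hnorm (a (- Z.of_nat (S m))%Z)).
      + apply Rmult_le_compat_r; [apply Hnorm_pos |]. now apply Rle_pow.
      + rewrite Rmult_assoc. apply Rmult_le_compat_l; [lra |].
        specialize (HAm (S m)). cbv beta in HAm.
        set (x := Hnorm (a (- Z.of_nat (S m))%Z)) in *.
        assert (0 <= x) by apply Hnorm_pos. rewrite pow_inv.
        apply Rmult_le_reg_r with (2 ^ m); [apply pow_lt; lra |].
        rewrite Rmult_assoc, Rinv_l by (apply pow_nonzero; lra).
        assert (0 < 2 ^ m) by (apply pow_lt; lra).
        change (2 ^ S m) with (2 * 2 ^ m) in HAm. nra.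
    - rewrite (Hn (S m) Hgt). change 0%H with (RtoH 0).
      rewrite Hnorm_RtoH, Rabs_R0, Rmult_0_r.
      apply Rmult_le_pos; [apply Rmult_le_pos; lra | lra]. }
  pose proof (Hnorm_triangle v1 v2).
  replace (/ (1 - / 2)) with 2 in * by field.
  assert (Hp1 : 0 <= t ^ n <= 1).
  { split; [apply pow_le; lra |]. rewrite <- (pow1 n). apply pow_incr. lra. }
  apply Rle_trans with ((8 * M + 8 * ((/ t) ^ n * A)) * t ^ n).
  - apply Rmult_le_compat_r; lra.
  - rewrite pow_inv.
    replace ((8 * M + 8 * (/ t ^ n * A)) * t ^ n) with (8 * M * t ^ n + 8 * A)
      by (field; apply pow_nonzero; lra).
    nra.
Qed.

(** A compactness argument, on a square that contains the disc. *)
Lemma discrete_finite (S : C -> Prop) (r : R) :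
  (forall z, Cmod z <= r -> exists d, 0 < d /\
     forall w, Cmod (w - z) < d -> S w -> w = z) ->
  exists l : list C, forall z, Cmod z <= r -> S z -> In z l.
Proof.
  intros HS.
  destruct (Rle_dec 0 r) as [Hr | Hr].
  2: { exists nil. intros z Hz. pose proof (Cmod_ge_0 z). lra. }
  set (Q := fun n x y => exists l : list C, forall z,
    x <= Re z <= x + 2 * r / 2 ^ n -> y <= Im z <= y + 2 * r / 2 ^ n ->
    Cmod z <= r -> S z -> In z l).
  assert (HQ : Q O (- r) (- r)).
  { apply (quartering Q (- r) (- r) (2 * r) (2 * r)); [lra | lra | |].
    - intros n x y _ _ _ _ [l1 H1] [l2 H2] [l3 H3] [l4 H4].
      exists ((l1 ++ l2) ++ (l3 ++ l4))%list. intros z Hx Hy Hz HSz.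
      assert (Hhalf : 2 * r / 2 ^ n = 2 * r / 2 ^ Datatypes.S n + 2 * r / 2 ^ Datatypes.S n)
        by (simpl; field; apply pow_nonzero; lra).
      apply in_or_app.
      destruct (Rle_dec (Im z) (y + 2 * r / 2 ^ Datatypes.S n)) as [Hy1 | Hy1];
        destruct (Rle_dec (Re z) (x + 2 * r / 2 ^ Datatypes.S n)) as [Hx1 | Hx1].
      + left. apply in_or_app. left. apply H1; auto; lra.
      + left. apply in_or_app. right. apply H2; auto; lra.
      + right. apply in_or_app. left. apply H3; auto; lra.
      + right. apply in_or_app. right. apply H4; auto; lra.
    - intros X Y _ _.
      assert (Hnear : forall n x y d, x <= X <= x + 2 * r / 2 ^ n ->
                y <= Y <= y + 2 * r / 2 ^ n -> 2 * r / 2 ^ n < d / 2 -> forall z,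
                x <= Re z <= x + 2 * r / 2 ^ n -> y <= Im z <= y + 2 * r / 2 ^ n ->
                Cmod (z - (X, Y)) < d).
      { intros n x y d HX HY Hd z Hx Hy. eapply Rle_lt_trans; [apply Cmod_le_sum |].
        rewrite Re_sub, Im_sub. simpl.
        assert (Rabs (Re z - X) <= 2 * r / 2 ^ n) by (apply Rabs_le; lra).
        assert (Rabs (Im z - Y) <= 2 * r / 2 ^ n) by (apply Rabs_le; lra). lra. }
      destruct (Rle_dec (Cmod (X, Y)) r) as [Hin | Hout].
      + destruct (HS (X, Y) Hin) as (d & Hd & H1).
        exists (d / 2). split; [lra |]. intros n x y _ _ _ _ HX HY Hn _.
        exists ((X, Y) :: nil)%list. intros z Hx Hy _ HSz. left. symmetry.
        apply H1; [| exact HSz]. exact (Hnear n x y d HX HY Hn z Hx Hy).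
      + exists ((Cmod (X, Y) - r) / 2). split; [lra |].
        intros n x y _ _ _ _ HX HY Hn _.
        exists nil. intros z Hx Hy Hz _.
        pose proof (Hnear n x y _ HX HY Hn z Hx Hy) as Hlt.
        pose proof (Cmod_le_sub (X, Y) z) as Ht. rewrite Cmod_sub_sym in Ht. lra. }
  destruct HQ as [l Hl]. exists l. intros z Hz HSz.
  pose proof (re_le_Cmod z) as Hre. pose proof (im_le_Cmod z) as Him.
  apply Rabs_le_between in Hre, Him. simpl in Hl.
  apply Hl; [lra | lra | exact Hz | exact HSz].
Qed.

(** * Clearing the poles on a slice *)

Fixpoint prodw (omega : C -> C -> C) (m : list C) (z : C) : C :=
  match m with nil => 1 | cons p m' => omega p z * prodw omega m' z end%C.

Lemma holo_prodw (omega : C -> C -> C) (m : list C) (z : C) :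
  (forall p z, holo (omega p) z) -> holo (prodw omega m) z.
Proof.
  intros Ho. induction m as [| p m IH]; cbn [prodw]; [apply holo_const |].
  now apply holo_mult.
Qed.

Lemma prodw_app (omega : C -> C -> C) (m1 m2 : list C) (z : C) :
  prodw omega (m1 ++ m2)%list z = (prodw omega m1 z * prodw omega m2 z)%C.
Proof. induction m1 as [| p m IH]; cbn [prodw app]; [ring |]. rewrite IH. ring. Qed.

Lemma prodw_repeat (omega : C -> C -> C) (p z : C) (n : nat) :
  prodw omega (repeat p n) z = (omega p z ^ n)%C.
Proof. induction n as [| n IH]; cbn [prodw repeat Cpow]; [reflexivity |]. now rewrite IH. Qed.

Lemma prodw_neq_0 (omega : C -> C -> C) (m : list C) (z : C) :
  (forall p, In p m -> omega p z <> 0%C) -> prodw omega m z <> 0%C.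
Proof.
  intros Hm. induction m as [| p m IH]; cbn [prodw].
  - intros H0. injection H0. lra.
  - apply Cmult_neq_0; [apply Hm; now left |]. apply IH. intros p' Hp'. apply Hm. now right.
Qed.

Lemma prodw_eq_0 (omega : C -> C -> C) (m : list C) (z : C) :
  omega z z = 0%C -> In z m -> prodw omega m z = 0%C.
Proof.
  intros Ho. induction m as [| p m IH]; intros Hz; [easy |]. cbn [prodw].
  destruct Hz as [-> | Hz]; [rewrite Ho | rewrite IH by exact Hz]; ring.
Qed.

Lemma holo_zero_bound (F : C -> C) (p : C) :
  holo F p -> F p = 0%C -> exists A d, 0 < A /\ 0 < d /\
    forall w, Cmod (w - p) < d -> Cmod (F w) <= A * Cmod (w - p).
Proof.
  intros (D & HD & HF) H0. destruct (Ccont_bounded D p HD) as (d & Hd & H1).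
  exists (Cmod (D p) + 1), d. split; [pose proof (Cmod_ge_0 (D p)); lra |].
  split; [exact Hd |]. intros w Hw. rewrite (HF w), H0, Cplus_0_l, Cmod_mult.
  apply Rmult_le_compat_r; [apply Cmod_ge_0 | now apply H1].
Qed.

Definition double_zero_bound (F : C -> R) (p : C) : Prop :=
  exists M d, 0 < d /\ forall w, 0 < Cmod (w - p) < d -> F w <= M * Cmod (w - p) ^ 2.

(** A factor vanishing at the pole is taken with two powers more than the order
    of the pole, so that the product extended by zero is differentiable at the
    pole, with derivative zero. *)
Lemma clear_poles (omega : C -> C -> C) (S : C -> Prop) (N : C -> R) (l : list C) :
  (forall p z, holo (omega p) z) -> (forall p, omega p p = 0%C) ->
  (forall w, 0 <= N w) ->
  (forall p, In p l -> S p -> pole_order_bound N p) ->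
  exists m, (forall p, In p m -> S p) /\
    forall p, In p l -> S p -> In p m /\
      double_zero_bound (fun w => Cmod (prodw omega m w) * N w) p.
Proof.
  intros Ho Ho0 HN. induction l as [| p l IH]; intros Hl.
  { exists nil. split; easy. }
  destruct IH as (m & Hm1 & Hm2). { intros q Hq. apply Hl. now right. }
  destruct (excluded_middle_informative (S p)) as [HSp | HSp].
  2: { exists m. split; [exact Hm1 |]. intros q [<- | Hq] HSq; [easy | now apply Hm2]. }
  destruct (Hl p (or_introl eq_refl) HSp) as (n & M & d & Hd & HM).
  exists (repeat p (n + 2) ++ m)%list. split.
  { intros q Hq. apply in_app_or in Hq as [Hq | Hq]; [| now apply Hm1].
    apply repeat_spec in Hq. now subst. }
  intros q Hq HSq.
  destruct (excluded_middle_informative (q = p)) as [-> | Hqp].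
  - split.
    { apply in_or_app. left. rewrite Nat.add_comm. now left. }
    destruct (holo_zero_bound (omega p) p (Ho p p) (Ho0 p)) as (A & d1 & HA & Hd1 & H1).
    destruct (Ccont_bounded (prodw omega m) p) as (d2 & Hd2 & H2).
    { now apply holo_cont, holo_prodw. }
    set (B := Cmod (prodw omega m p) + 1) in *.
    exists (A ^ (n + 2) * B * M), (Rmin d (Rmin d1 d2)).
    split; [repeat apply Rmin_glb_lt; assumption |]. intros w Hw.
    pose proof (Rmin_l d (Rmin d1 d2)). pose proof (Rmin_r d (Rmin d1 d2)).
    pose proof (Rmin_l d1 d2). pose proof (Rmin_r d1 d2).
    specialize (HM w ltac:(lra)). specialize (H1 w ltac:(lra)). specialize (H2 w ltac:(lra)).
    rewrite prodw_app, prodw_repeat, Cmod_mult, Cmod_pow.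
    set (t := Cmod (w - p)) in *.
    assert (P1 : Cmod (omega p w) ^ (n + 2) <= (A * t) ^ (n + 2))
      by (apply pow_incr; split; [apply Cmod_ge_0 | exact H1]).
    assert (P0 : 0 <= Cmod (omega p w) ^ (n + 2)) by (apply pow_le, Cmod_ge_0).
    assert (HB : 0 <= Cmod (prodw omega m w)) by apply Cmod_ge_0.
    apply Rle_trans with ((A * t) ^ (n + 2) * B * N w).
    + apply Rmult_le_compat_r; [apply HN |]. now apply Rmult_le_compat.
    + rewrite Rpow_mult_distr, (pow_add t).
      replace (A ^ (n + 2) * (t ^ n * t ^ 2) * B * N w)
        with (A ^ (n + 2) * B * t ^ 2 * (N w * t ^ n)) by ring.
      replace (A ^ (n + 2) * B * M * t ^ 2) with (A ^ (n + 2) * B * t ^ 2 * M) by ring.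
      apply Rmult_le_compat_l; [| exact HM].
      apply Rmult_le_pos; [| apply pow2_ge_0].
      apply Rmult_le_pos; [apply pow_le; lra | lra].
  - destruct Hq as [Hq | Hq]; [now symmetry in Hq |].
    destruct (Hm2 q Hq HSq) as [Hin (K & d1 & Hd1 & H1)]. split.
    { apply in_or_app. now right. }
    destruct (Ccont_bounded (prodw omega (repeat p (n + 2))) q) as (d2 & Hd2 & H2).
    { now apply holo_cont, holo_prodw. }
    set (B := Cmod (prodw omega (repeat p (n + 2)) q) + 1) in *.
    assert (HB : 0 <= B)
      by (unfold B; pose proof (Cmod_ge_0 (prodw omega (repeat p (n + 2)) q)); lra).
    exists (B * K), (Rmin d1 d2). split; [now apply Rmin_glb_lt |]. intros w Hw.
    pose proof (Rmin_l d1 d2). pose proof (Rmin_r d1 d2).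
    specialize (H1 w ltac:(lra)). specialize (H2 w ltac:(lra)).
    rewrite prodw_app, Cmod_mult, !Rmult_assoc.
    apply Rmult_le_compat; [apply Cmod_ge_0 | | exact H2 | exact H1].
    apply Rmult_le_pos; [apply Cmod_ge_0 | apply HN].
Qed.

(** A coordinate of [f] on [L J], multiplied by a polynomial and extended by 0 to
    the singularities. *)
Definition cleared (Sg : H -> Prop) (f : H -> H) (omega : C -> C -> C)
    (J : H) (m : list C) (u : H) (w : C) : C :=
  if excluded_middle_informative (Sg (emb J w)) then 0%C
  else (prodw omega m w * lam J (f (emb J w) * u)%H)%C.

(** Only the finitely many singularities in the closed disc need a factor.  Since
    they are isolated in the slice, the extended product is locally a product of
    holomorphic functions at the other points. *)
Lemma semiregular_cleared (R0 : Rbar) (Sg : H -> Prop) (f : H -> H) (r : R) (J : H)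
    (omega : C -> C -> C) :
  semiregular (Ball R0) Sg f -> Rbar_lt r R0 -> imag_unit J ->
  (forall p z, holo (omega p) z) -> (forall p, omega p p = 0%C) ->
  exists m, (forall p, In p m -> Sg (emb J p)) /\
    (forall p, Cmod p < r -> Sg (emb J p) -> prodw omega m p = 0%C) /\
    forall u z, Cmod z < r -> holo (cleared Sg f omega J m u) z.
Proof.
  intros (HSg & Hdisc & Hreg & Hpole) Hr HJ Ho Ho0.
  set (S := fun z => Sg (emb J z)).
  assert (HB : forall z, Cmod z <= r -> Ball R0 (emb J z)).
  { intros z Hz. unfold Ball. rewrite Hnorm_emb by exact HJ.
    eapply Rbar_le_lt_trans; [| exact Hr]. exact Hz. }
  assert (Hd : forall z, Cmod z <= r -> exists d, 0 < d /\
             forall w, Cmod (w - z) < d -> S w -> w = z).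
  { intros z Hz.
    assert (HL : forall w, L J (emb J w)) by (intros w; now exists (Re w), (Im w)).
    pose proof (Hdisc J (emb J z) HJ (HB z Hz) (HL z)) as Hloc.
    apply locally_Hnorm in Hloc as (d & Hd & H1). exists d. split; [exact Hd |].
    intros w Hw HSw. apply (emb_inj J w z HJ). apply H1; [| exact HSw | apply HL].
    now rewrite Hnorm_emb_sub. }
  destruct (discrete_finite S r Hd) as [l Hl].
  destruct (clear_poles omega S (fun w => Hnorm (f (emb J w))) l Ho Ho0) as (m & Hm1 & Hm2).
  { intros w. apply Hnorm_pos. }
  { intros p _ HSp. apply pole_bound with (fun q => Ball R0 q /\ ~ Sg q); [exact HJ |].
    apply NNPP. apply (Hpole J (emb J p) HJ HSp). now exists (Re p), (Im p). }
  exists m. split; [exact Hm1 |]. split.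
  { intros p Hp HSp. apply prodw_eq_0; [apply Ho0 |]. apply Hm2; [| exact HSp].
    apply Hl; [lra | exact HSp]. }
  intros u z Hz. destruct (Hd z) as (d & Hd0 & H1); [lra |].
  destruct (excluded_middle_informative (S z)) as [HSz | HSz].
  - destruct (Hm2 z (Hl z ltac:(lra) HSz) HSz) as [_ (K & d1 & Hd1 & H2)].
    set (Q := 2 * Hnorm u * Rabs K).
    assert (HQ : 0 <= Q).
    { unfold Q. pose proof (Hnorm_pos u). pose proof (Rabs_pos K).
      repeat apply Rmult_le_pos; lra. }
    apply holo_slope with (RtoC 0). intros e He.
    assert (Hq : 0 < e / (Q + 1)) by (apply Rdiv_lt_0_compat; lra).
    exists (Rmin d1 (e / (Q + 1))). split; [now apply Rmin_glb_lt |]. intros w Hw.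
    pose proof (Rmin_l d1 (e / (Q + 1))). pose proof (Rmin_r d1 (e / (Q + 1))).
    unfold cleared. fold (S z). fold (S w).
    destruct (excluded_middle_informative (S z)) as [_ |]; [| easy].
    destruct (excluded_middle_informative (S w)) as [HSw | HSw].
    + replace (0 - 0 - 0 * (w - z))%C with (RtoC 0) by ring. rewrite Cmod_0.
      apply Rmult_le_pos; [lra | apply Cmod_ge_0].
    + assert (Hpos : 0 < Cmod (w - z)) by (apply Cmod_sub_pos; intros ->; easy).
      specialize (H2 w ltac:(lra)). set (t := Cmod (w - z)) in *.
      set (a := (prodw omega m w * lam J (f (emb J w) * u)%H)%C).
      replace (a - 0 - 0 * (w - z))%C with a by ring.
      unfold a. rewrite Cmod_mult.
      apply Rle_trans with (Q * t ^ 2).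
      * pose proof (Cmod_lam_le J (f (emb J w) * u)%H HJ) as Hlam.
        rewrite Hnorm_mult in Hlam.
        pose proof (Cmod_ge_0 (prodw omega m w)) as P0. pose proof (Hnorm_pos u) as P1.
        assert (H3 : Cmod (prodw omega m w) * Hnorm (f (emb J w)) <= Rabs K * t ^ 2).
        { eapply Rle_trans; [exact H2 |]. apply Rmult_le_compat_r; [apply pow2_ge_0 |].
          apply RRle_abs. }
        apply Rle_trans with
          (2 * Hnorm u * (Cmod (prodw omega m w) * Hnorm (f (emb J w)))).
        -- apply Rle_trans with
             (Cmod (prodw omega m w) * (2 * (Hnorm (f (emb J w)) * Hnorm u)));
             [now apply Rmult_le_compat_l | right; ring].
        -- unfold Q. rewrite (Rmult_assoc (2 * Hnorm u)).
           apply Rmult_le_compat_l; [lra | exact H3].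
      * replace (Q * t ^ 2) with (Q * t * t) by ring.
        apply Rmult_le_compat_r; [lra |].
        apply Rle_trans with (Q * (e / (Q + 1))); [apply Rmult_le_compat_l; lra |].
        apply Rmult_le_reg_r with (Q + 1); [lra |].
        replace (Q * (e / (Q + 1)) * (Q + 1)) with (Q * e) by (field; lra). nra.
  - set (d' := Rmin d (r - Cmod z)).
    assert (Hd' : 0 < d') by (apply Rmin_glb_lt; lra).
    assert (Hnear : forall w, Cmod (w - z) < d' -> Ball R0 (emb J w) /\ ~ S w).
    { intros w Hw. assert (d' <= d) by apply Rmin_l.
      assert (d' <= r - Cmod z) by apply Rmin_r. split.
      - apply HB. pose proof (Cmod_le_sub w z). lra.
      - intros HSw. rewrite (H1 w ltac:(lra) HSw) in HSw. easy. }
    apply (holo_ext_loc (fun w => prodw omega m w * lam J (f (emb J w) * u)%H)%C _ z d' Hd').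
    + intros w Hw. unfold cleared. fold (S w).
      destruct (excluded_middle_informative (S w)); [| reflexivity].
      exfalso. now apply (Hnear w Hw).
    + apply holo_mult; [now apply holo_prodw |].
      now apply (regular_holo _ f J z d' u Hreg HJ Hd').
Qed.
(** * The denominator and the comparison on all slices *)

(** The conjugate zero makes the coefficients real. *)
Definition omega_conj (p z : C) : C := ((z - p) * (z - Cconj p))%C.

Lemma holo_omega_conj (p z : C) : holo (omega_conj p) z.
Proof.
  apply holo_mult; (apply holo_minus; [apply holo_id | apply holo_const]).
Qed.

Lemma omega_conj_self (p : C) : omega_conj p p = 0%C.
Proof. unfold omega_conj. ring. Qed.

Lemma omega_conj_real_neq_0 (p : C) (x : R) :
  RtoC x <> p -> omega_conj p (RtoC x) <> 0%C.
Proof.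
  intros Hp. unfold omega_conj. apply Cmult_neq_0; apply Csub_neq_0; [exact Hp |].
  intros Heq. apply Hp. destruct p as [p1 p2]. unfold Cconj, RtoC in *. simpl in Heq.
  injection Heq as H1 H2. f_equal; lra.
Qed.

Lemma prodw_conj_real (m : list C) :
  exists l : list R, forall z, prodw omega_conj m z = evalC l z.
Proof.
  induction m as [| p m [l Hl]]; cbn [prodw].
  - exists (1 :: nil)%list. intros z. cbn [evalC]. ring.
  - destruct (evalC_mul_quadratic l (- 2 * Re p) (Re p ^ 2 + Im p ^ 2)) as [l' Hl'].
    exists l'. intros z. rewrite Hl', Hl. f_equal.
    destruct p as [p1 p2], z as [z1 z2]. unfold omega_conj, Cconj.
    unfold Cminus, Cmult, Cplus, Copp, RtoC, Re, Im. simpl. f_equal; ring.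
Qed.

Lemma list_avoid (m : list C) : exists d, 0 < d /\
  forall x, 0 < x < d -> forall p, In p m -> RtoC x <> p.
Proof.
  induction m as [| p m (d & Hd & H1)].
  - exists 1. split; [lra |]. easy.
  - destruct (Rlt_dec 0 (Re p)) as [Hp | Hp].
    + exists (Rmin d (Re p)). split; [now apply Rmin_glb_lt |]. intros x Hx.
      pose proof (Rmin_l d (Re p)). pose proof (Rmin_r d (Re p)).
      intros q [<- | Hq]; [| apply H1; [lra | exact Hq]].
      intros Heq. rewrite <- Heq in *. simpl in *. lra.
    + exists d. split; [exact Hd |]. intros x Hx q [<- | Hq]; [| now apply H1].
      intros Heq. rewrite <- Heq in Hp. simpl in Hp. lra.
Qed.

(** Both sides are determined on every slice [L J] by their common values on the
    real axis: after multiplication by a polynomial that clears the poles of [f]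
    on [L J], their difference is holomorphic on a disc. *)
Lemma semiregular_eq_regular (R0 : Rbar) (Sg : H -> Prop) (f g : H -> H) (r : R)
    (l : list R) :
  semiregular (Ball R0) Sg f -> 0 < r -> Rbar_lt r R0 ->
  regular (Ball r) g ->
  (forall x, Rabs x < r -> ~ Sg (RtoH x) ->
     (evalH l (RtoH x) * f (RtoH x))%H = g (RtoH x)) ->
  forall q, Ball r q -> ~ Sg q -> (evalH l q * f q)%H = g q.
Proof.
  intros Hf Hr HrR Hg Hreal q Hq HSq.
  destruct (exists_slice q) as (J & z & HJ & ->).
  assert (Hz : Cmod z < r) by (rewrite <- (Hnorm_emb J z HJ); exact Hq).
  destruct (semiregular_cleared R0 Sg f r J (fun p z => z - p)%C Hf HrR HJ)
    as (m & Hm1 & Hm2 & Hm3).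
  { intros p w. apply holo_minus; [apply holo_id | apply holo_const]. }
  { intros p. ring. }
  set (W := prodw (fun p z => z - p)%C m) in *.
  apply (lam_separates J). intros u.
  assert (HG : forall w, Cmod w < r ->
    (evalC l w * cleared Sg f (fun p z => z - p)%C J m u w
     - W w * lam J (g (emb J w) * u)%H)%C = 0%C).
  { apply holo_identity; [exact Hr | |].
    - intros w Hw. apply holo_minus; apply holo_mult.
      + apply holo_evalC.
      + now apply Hm3.
      + apply holo_prodw. intros p v.
        apply holo_minus; [apply holo_id | apply holo_const].
      + apply (regular_holo (Ball r) g J w (r - Cmod w) u Hg HJ); [lra |].
        intros v Hv. unfold Ball. rewrite Hnorm_emb by exact HJ.
        pose proof (Cmod_le_sub v w). simpl. lra.
    - intros x Hx. unfold cleared. fold W.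
      destruct (excluded_middle_informative (Sg (emb J (RtoC x)))) as [HSx | HSx].
      + rewrite Hm2; [ring | now rewrite Cmod_R | exact HSx].
      + rewrite emb_RtoC in *. rewrite <- (Hreal x Hx HSx).
        rewrite <- (emb_RtoC J x), evalH_emb, <- (@mult_assoc H_Ring), lam_mult by exact HJ.
        ring. }
  specialize (HG z Hz). unfold cleared in HG.
  destruct (excluded_middle_informative (Sg (emb J z))) as [| _]; [easy |].
  fold W in HG.
  assert (HW : W z <> 0%C).
  { apply prodw_neq_0. intros p Hp. apply Csub_neq_0. intros ->. apply HSq, Hm1, Hp. }
  rewrite evalH_emb, <- (@mult_assoc H_Ring), lam_mult by exact HJ.
  apply Cmod_sub_0.
  match goal with |- Cmod ?e = 0 => replace e with (/ W z * (W z * e))%C by (field; exact HW) end.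
  match type of HG with ?X = _ =>
    match goal with |- Cmod (_ * ?Y) = 0 => replace Y with X by ring end end.
  rewrite HG, Cmult_0_r. apply Cmod_0.
Qed.

Theorem theorem1p5 :
  forall (R0 : Rbar) (Sg : H -> Prop) (f : H -> H),
    Rbar_lt 0 R0 ->
    semiregular (Ball R0) Sg f ->
    forall (r : R) (I : H),
      0 < r -> Rbar_lt r R0 -> imag_unit I ->
      exists P g : H -> H,
        polynomial_over (L I) P /\
        (exists q, Ball r q /\ P q <> 0%H) /\
        regular (Ball r) g /\
        (forall q, Ball r q -> ~ Sg q -> reg_sym r P q <> 0%H ->
           f q = left_quotient r P g q).
Proof.
  intros R0 Sg f _ Hf r I Hr HrR HI.
  destruct (semiregular_cleared R0 Sg f r I omega_conj Hf HrR HI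
              holo_omega_conj omega_conj_self) as (m & Hm1 & _ & Hm3).
  destruct (prodw_conj_real m) as [l Hl].
  (* the real parts of [h], [h i], [h j], [h k] are the coordinates of [h] up to sign *)
  set (ui := (0, 1, 0, 0) : H). set (uj := (0, 0, 1, 0) : H). set (uk := (0, 0, 0, 1) : H).
  assert (Htaylor : forall u, exists c : nat -> R,
    forall x, Rabs x < r ->
      is_series (fun n => c n * x ^ n) (Re (cleared Sg f omega_conj I m u (RtoC x)))).
  { intros u. destruct (holo_taylor _ r Hr (Hm3 u)) as [c Hc].
    exists (fun n => Re (c n)). intros x Hx.
    destruct (Hc (RtoC x)) as (K & s & Hs & Hb); [now rewrite Cmod_R |].
    apply geometric_bound_is_series with K s; [exact Hs |]. intros n.
    eapply Rle_trans; [| apply (Hb n)]. eapply Rle_trans; [| apply re_le_Cmod].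
    right. f_equal. rewrite Re_sub, Re_csum. f_equal. apply sum_n_ext. intros k.
    rewrite <- RtoC_pow. unfold Cmult, Re. simpl. ring. }
  destruct (Htaylor 1%H) as [c0 H0]. destruct (Htaylor ui) as [c1 H1].
  destruct (Htaylor uj) as [c2 H2]. destruct (Htaylor uk) as [c3 H3].
  set (b := fun n => (c0 n, - c1 n, - c2 n, - c3 n) : H).
  assert (Hopp : forall c x s, is_series (fun n => c n * x ^ n) s ->
            is_series (fun n => - c n * x ^ n) (- s)).
  { intros c x s Hs. apply is_series_ext with (fun n => opp (c n * x ^ n)).
    - intros n. unfold opp. simpl. ring.
    - now apply (@is_series_opp R_AbsRing R_NormedModule). }
  set (F := fun x => (Re (cleared Sg f omega_conj I m 1%H (RtoC x)),
                      - Re (cleared Sg f omega_conj I m ui (RtoC x)),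
                      - Re (cleared Sg f omega_conj I m uj (RtoC x)),
                      - Re (cleared Sg f omega_conj I m uk (RtoC x))) : H).
  assert (HF : forall x, Rabs x < r -> is_Hseries (fun n => RtoH x ^ n * b n)%H (F x)).
  { intros x Hx. apply is_Hseries_real_coords. unfold b, F, Hre, Hc1, Hc2, Hc3.
    cbn [fst snd].
    split; [| split; [| split]]; [apply H0 | apply Hopp, H1 | apply Hopp, H2 | apply Hopp, H3];
      exact Hx. }
  assert (Hb : rapid r b).
  { intros rho Hrho.
    destruct (is_Hseries_bounded _ _ (HF rho ltac:(rewrite Rabs_pos_eq; lra))) as [M HM].
    exists M. intros n. specialize (HM n).
    rewrite Hnorm_mult, Hnorm_pow, Hnorm_RtoH, Rabs_pos_eq in HM by lra. lra. }
  assert (Hexp : is_expansion r (Hpseries b) b).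
  { intros q Hq. now apply (rapid_is_Hseries r). }
  assert (Hreg : regular (Ball r) (Hpseries b)) by now apply Hpseries_regular.
  assert (Hreal : forall x, Rabs x < r -> ~ Sg (RtoH x) ->
            (evalH l (RtoH x) * f (RtoH x))%H = Hpseries b (RtoH x)).
  { intros x Hx HSx.
    assert (HB : Ball r (RtoH x)) by (unfold Ball; now rewrite Hnorm_RtoH).
    rewrite (is_Hseries_unique _ _ _ (Hexp _ HB) (HF x Hx)).
    assert (Hcl : forall u, cleared Sg f omega_conj I m u (RtoC x)
                            = lam I (evalH l (RtoH x) * f (RtoH x) * u)%H).
    { intros u. unfold cleared. rewrite (emb_RtoC I x).
      destruct (excluded_middle_informative (Sg (RtoH x))) as [| _]; [easy |].
      rewrite Hl, <- (emb_RtoC I x), evalH_emb, <- (@mult_assoc H_Ring), lam_mult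
        by exact HI. reflexivity. }
    unfold F. rewrite !Hcl. generalize (evalH l (RtoH x) * f (RtoH x))%H.
    intros [[[h0 h1] h2] h3]. unfold ui, uj, uk.
    cbv -[Rplus Rmult Rminus Ropp IZR]. repeat apply (f_equal2 pair); ring. }
  exists (evalH l), (Hpseries b). split; [| split; [| split; [exact Hreg |]]].
  - exists (length l), (fun n => RtoH (nth n l 0)). split.
    + intros n. exists (nth n l 0), 0. generalize (nth n l 0). intros y. clear. H_ring.
    + intros q. now apply evalH_sum_n.
  - destruct (list_avoid m) as (d & Hd & Hav). set (x := Rmin d r / 2).
    assert (0 < Rmin d r) by now apply Rmin_glb_lt.
    pose proof (Rmin_l d r). pose proof (Rmin_r d r).
    exists (RtoH x). split.
    + unfold Ball. rewrite Hnorm_RtoH, Rabs_pos_eq by (unfold x; lra). simpl.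
      unfold x. lra.
    + rewrite <- (emb_RtoC I x), evalH_emb, <- Hl by exact HI. intros Hz.
      assert (Hz0 : prodw omega_conj m (RtoC x) = 0%C).
      { apply (emb_inj I _ _ HI). rewrite Hz, (emb_RtoC I 0). reflexivity. }
      revert Hz0. apply prodw_neq_0. intros p Hp. apply omega_conj_real_neq_0.
      apply Hav; [unfold x; lra | exact Hp].
  - intros q Hq HSq Hsym. apply (left_quotient_evalH r l _ b q (f q) Hr Hexp Hq Hsym).
    now apply (semiregular_eq_regular R0 Sg f (Hpseries b) r l Hf Hr HrR Hreg Hreal).
Qed.
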